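(* Let $d=3$, $\tau=1$, $\gamma=2$, and for $\epsilon\in(0,1]$ let $\mathbf S_k=\mathrm{diag}\bigl(((\boldsymbol c_j)_k)_{0\le j<7}\bigr)$, $k=1,2,3$, be the diagonal matrices of the $k$-th components of the $D3Q7$ discrete velocities $\boldsymbol c_0,\dots,\boldsymbol c_6$. Consider the $D3Q7$ discrete velocity Boltzmann equation $$\partial_t\boldsymbol{\mathsf f}+\sum_{k=1}^{3}\mathbf S_k\,\partial_k\boldsymbol{\mathsf f}=-\frac1{\epsilon^\gamma\tau}\bigl(\boldsymbol{\mathsf f}-\boldsymbol{\mathsf f}^{\mathrm{eq}}(\boldsymbol{\mathsf f})\bigr)\quad\text{in }\Omega\times I$$ for $\boldsymbol{\mathsf f}=(\mathsf f_0,\dots,\mathsf f_6)^{\mathrm T}$, with initial condition $\boldsymbol{\mathsf f}(\cdot,0)=\boldsymbol{\mathcal E}_\epsilon(\rho_0)$, where $\boldsymbol{\mathsf f}^{\mathrm{eq}}(\boldsymbol{\mathsf f})=\boldsymbol{\mathcal E}_\epsilon\bigl(\sum_{j}\mathsf f_j\bigr)$ and $\boldsymbol{\mathcal E}_\epsilon$ is the discrete equilibrium. Then, as $\epsilon\searrow0$, the density $\sum_{j=0}^6\mathsf f_j$ converges in $C(I;L^1_{\mathrm{loc}}(\Omega))$ to the unique solution of the initial value problem $$\partial_t\rho+\nabla_{\boldsymbol x}\cdot(\boldsymbol u\rho)-\mu\Delta_{\boldsymbol x}\rho=0\ \text{ in }\Omega\times I,\qquad\rho(\cdot,0)=\rho_0\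 \text{ in }\Omega.$$
   Context: Here $\Omega\subseteq\mathbb R^3$ (all functions periodic on $\Omega$), $I\subseteq\mathbb R_0^+$ is a time interval starting at $0$, $\boldsymbol u\in\mathbb R^3$ is constant, $\mu>0$, and $\rho_0\in L^\infty(\Omega)\cap L^1(\Omega)$. Let $\lambda,\theta>0$ be constants with $\mu=\lambda^2/\theta$. The seven (diffusively scaled) $D3Q7$ velocities are $\mathbf 0$ and $\pm\frac{\lambda}{\epsilon}\boldsymbol e_k$ for $k=1,2,3$, with $\boldsymbol e_k$ the unit vectors of $\mathbb R^3$. The component of the discrete equilibrium $\boldsymbol{\mathcal E}_\epsilon(\eta)$, $\eta\in\mathbb R$, belonging to velocity $\mathbf 0$ is $\bigl(1-\tfrac3\theta\bigr)\eta$, and the component belonging to velocity $\pm\frac\lambda\epsilon\boldsymbol e_k$ is $\tfrac12\bigl[\tfrac{1}{\theta}\eta\pm\tfrac{\epsilon}{\lambda}u_k\eta\bigr]$. Standing stability assumptions: with $a^{(1)}=\lambda^2/\theta=\mu$ and $a^{(2)}=\lambda^2$, one has $a^{(2)}\ge a^{(1)}$ and $\dfrac{a^{(1)}}{\sqrt{\epsilon^{2}a^{(2)}}}\ge|u_k|$ for $k=1,2,3$ and all $\epsilon\in(0,1]$; and every component of $\boldsymbol{\mathcal E}_\epsilon$ is non-decreasing in $\eta$ on $\{|\eta|\le\|\rho_0\|_\infty\}$ for all $\epsilon\in(0,1]$. Solutions are understood in the weak (distributional) sense. *)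

(* Defs.v *)
From HB Require Import structures.
From mathcomp Require Import all_boot all_order all_algebra.
From mathcomp Require Import all_classical all_reals all_analysis.

Set Implicit Arguments.
Unset Strict Implicit.
Unset Printing Implicit Defensive.

Import Order.TTheory GRing.Theory Num.Theory.
Import numFieldNormedType.Exports.

Local Open Scope classical_set_scope.
Local Open Scope ring_scope.

(* Points of R^3 are triples, which carry both the product Lebesgue measure and
   a normed-module structure; constant vectors (drift, velocities, corners of
   the periodicity cell) are rows 'rV[R]_3. *)
Notation space3 R := (R * R * R)%type.

(* measurableTypeR R is R with its Borel sigma-algebra. *)
Notation mspace3 R :=
  (measurableTypeR R * measurableTypeR R * measurableTypeR R)%type.

Definition leb3 (R : realType) : {measure set (mspace3 R) -> \bar R} :=
  ((@lebesgue_measure R \x @lebesgue_measure R) \x @lebesgue_measure R)%E.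

Definition coord (R : realType) (k : 'I_3) (x : space3 R) : R :=
  if k == 0%N :> nat then x.1.1 else if k == 1%N :> nat then x.1.2 else x.2.

Definition basis_vec (R : realType) (k : 'I_3) : space3 R :=
  ((k == 0%N :> nat)%:R, (k == 1%N :> nat)%:R, (k == 2%N :> nat)%:R).

(* A closed box, read as a torus (opposite faces identified): it is compact, so
   "compact subset of the cell" below includes the cell itself. *)
Definition cell (R : realType) (a b : 'rV[R]_3) : set (space3 R) :=
  [set x | forall k : 'I_3, a 0 k <= coord k x <= b 0 k].

Definition cell_periodic (R : realType) (T : Type) (a b : 'rV[R]_3)
    (g : space3 R -> T) : Prop :=
  forall (k : 'I_3) (x : space3 R),
    g (x + (b 0 k - a 0 k) *: basis_vec R k) = g x.

(* Time comes first: a function of (x, t) is written g : R -> space3 R -> _,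
   with g t the spatial profile at time t. *)

Definition in_L1loc (R : realType) (D : set (space3 R)) (g : space3 R -> R) : Prop :=
  forall K : set (space3 R), compact K -> K `<=` D ->
    (leb3 R).-integrable K (EFin \o g).

Definition L1dist (R : realType) (K : set (space3 R)) (g h : space3 R -> R) : \bar R :=
  (\int[leb3 R]_(x in K) `|g x - h x|%:E)%E.

(* g is a family of representatives of an element of C(I; L^1_loc(D)). *)
Definition in_C_L1loc (R : realType) (I : set R) (D : set (space3 R))
    (g : R -> space3 R -> R) : Prop :=
  (forall t, I t -> in_L1loc D (g t)) /\
  (forall K : set (space3 R), compact K -> K `<=` D ->
    forall t, I t -> L1dist K (g s) (g t) @[s --> within I (nbhs t)] --> 0%E).

(* Convergence of the family g_eps to h as eps decreases to 0 in
   C(I; L^1_loc(D)): uniform in t on the compact subsets of I. *)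
Definition cvg_C_L1loc (R : realType) (I : set R) (D : set (space3 R))
    (g : R -> R -> space3 R -> R) (h : R -> space3 R -> R) : Prop :=
  forall (J : set R) (K : set (space3 R)),
    compact J -> J `<=` I -> compact K -> K `<=` D ->
    forall delta : R, 0 < delta ->
      \forall eps \near 0^'+,
        forall t, J t -> (L1dist K (g eps t) (h t) <= delta%:E)%E.

Definition dt (R : realType) (phi : R * space3 R -> R) : R * space3 R -> R :=
  'D_((1 : R), (0 : space3 R)) phi.

Definition dx (R : realType) (k : 'I_3) (phi : R * space3 R -> R) :
    R * space3 R -> R :=
  'D_((0 : R), basis_vec R k) phi.

(* C^infinity: every iterated directional derivative is (Frechet)
   differentiable everywhere. *)
Definition smooth (R : realType) (phi : R * space3 R -> R) : Prop :=
  forall (vs : seq (R * space3 R)) (z : R * space3 R),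
    differentiable (foldr (fun v psi => 'D_v psi) phi vs) z.

(* Smooth, periodic in space, and supported in a compact time interval inside
   the interior of I; the initial condition is imposed separately, on the value
   at time 0 of an element of C(I; L^1_loc). *)
Definition test_function (R : realType) (I : set R) (a b : 'rV[R]_3)
    (phi : R * space3 R -> R) : Prop :=
  [/\ smooth phi,
      forall t, cell_periodic a b (fun x => phi (t, x))
    & exists s1 s2 : R, `[s1, s2] `<=` I° /\
        forall t x, ~ (s1 <= t <= s2) -> phi (t, x) = 0].

(* Integral over I x (cell a b), iterated: for g in C(I; L^1_loc) the inner
   integral against a continuous function is defined at every time, whatever
   the representatives g t. *)
Definition st_integral (R : realType) (I : set R) (a b : 'rV[R]_3)
    (w : R -> space3 R -> R) : R :=
  \int[@lebesgue_measure R]_(t in I) \int[leb3 R]_(x in cell a b) w t x.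

(* D3Q7: index 0 is the rest velocity, indices 1, 2 belong to +e_1, -e_1,
   indices 3, 4 to +e_2, -e_2 and indices 5, 6 to +e_3, -e_3. *)
Definition dir (j : 'I_7) : 'I_3 := inord (j.-1)./2.
Definition sgn_dir (R : realType) (j : 'I_7) : R := (-1) ^+ j.-1.

Definition velocity (R : realType) (lam eps : R) (j : 'I_7) : 'rV[R]_3 :=
  if j == 0 then 0
  else (sgn_dir R j * (lam / eps)) *: delta_mx 0 (dir j).

Definition Smat (R : realType) (lam eps : R) (k : 'I_3) : 'M[R]_7 :=
  diag_mx (\row_(j < 7) velocity lam eps j 0 k).

Definition equilibrium (R : realType) (lam theta : R) (u : 'rV[R]_3)
    (eps eta : R) : 'cV[R]_7 :=
  \col_(j < 7)
    if j == 0 then (1 - 3 / theta) * eta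
    else 1 / 2 * (1 / theta * eta + sgn_dir R j * (eps / lam) * u 0 (dir j) * eta).

Definition total_density (R : realType) (f : 'cV[R]_7) : R := \sum_(j < 7) f j 0.

Definition feq (R : realType) (lam theta : R) (u : 'rV[R]_3) (eps : R)
    (f : 'cV[R]_7) : 'cV[R]_7 :=
  equilibrium lam theta u eps (total_density f).

(* Weak solution in C(I; L^1_loc) of the D3Q7 discrete velocity Boltzmann
   equation with relaxation frequency 1 / (eps ^ gamma * tau). *)
Definition dvbe_solution (R : realType) (I : set R) (a b : 'rV[R]_3)
    (lam theta : R) (u : 'rV[R]_3) (tau : R) (gamma : nat) (eps : R)
    (rho0 : space3 R -> R) (f : R -> space3 R -> 'cV[R]_7) : Prop :=
  [/\ forall t, I t -> cell_periodic a b (f t),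
      forall j : 'I_7, in_C_L1loc I (cell a b) (fun t x => f t x j 0),
      {ae leb3 R, forall x, cell a b x ->
         f 0 x = equilibrium lam theta u eps (rho0 x)}
    & forall (j : 'I_7) (phi : R * space3 R -> R), test_function I a b phi ->
        st_integral I a b (fun t x =>
            f t x j 0 * dt phi (t, x)
          + \sum_(k < 3) (Smat lam eps k *m f t x) j 0 * dx k phi (t, x)
          - 1 / (eps ^+ gamma * tau)
              * (f t x - feq lam theta u eps (f t x)) j 0 * phi (t, x)) = 0].

(* Weak solution in C(I; L^1_loc) of
   d_t rho + div (u rho) - mu Laplace rho = 0, rho(., 0) = rho0. *)
Definition ade_solution (R : realType) (I : set R) (a b : 'rV[R]_3)
    (mu : R) (u : 'rV[R]_3)
    (rho0 : space3 R -> R) (rho : R -> space3 R -> R) : Prop :=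
  [/\ forall t, I t -> cell_periodic a b (rho t),
      in_C_L1loc I (cell a b) rho,
      {ae leb3 R, forall x, cell a b x -> rho 0 x = rho0 x}
    & forall phi : R * space3 R -> R, test_function I a b phi ->
        st_integral I a b (fun t x =>
            rho t x * dt phi (t, x)
          + \sum_(k < 3) u 0 k * rho t x * dx k phi (t, x)
          + mu * rho t x * \sum_(k < 3) dx k (dx k phi) (t, x)) = 0].

Definition Linfty_norm (R : realType) (D : set (space3 R)) (g : space3 R -> R) :
    \bar R :=
  ('N[leb3 R]_+oo [EFin \o (g \_ D)])%E.

(* Main.v *)
(** Both equations are linear with constant coefficients, so everything is read
off the real Fourier modes H_n(x) = cos(kappa_n.x) + sin(kappa_n.x), n in Z^3.

- An L^1 function is small in L^1 as soon as finitely many of its coefficients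
  are small and all of them are dominated by a fixed square-summable family
  (duality with trigonometric polynomials).  Since rho_0 is bounded, its
  coefficients are square-summable, and this reduces L^1 statements that are
  uniform in time to statements about single modes; uniqueness is the case
  where all coefficients vanish.
- Testing the weak equations with (smooth bump in t) * H_n gives ordinary
  differential equations for the coefficients of index n and -n.
- For the Boltzmann equation the stability assumption makes the equilibrium
  weights m_j nonnegative, so sum_j |f_j|^2 / m_j is nonincreasing: this is the
  domination uniform in eps.  A Chapman-Enskog corrector of the density then
  satisfies the limit equation up to O(eps), mode by mode.
- A solution of the limit equation is the L^1 limit, uniform in time, of partial
  sums of the explicit mode solutions.  *)

(* The obstacle is that solutions are only continuous in time with values in L^1: the coefficients
   of an L^1 function need not be square-summable, and no spatial regularity is at hand for energy
   methods. Working mode by mode replaces these by estimates for ordinary differential systems that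
   couple only the indices n and -n, because differentiation maps H_n to a multiple of H_(-n).
   Square-summability comes from rho_0 alone, and the mode estimates carry it to all times. Duality
   requires approximating the sign of an L^1 function g in L^2((1 + |g|) dx). The sets whose
   indicator is reached from trigonometric polynomials by iterated bounded pointwise limits form a
   sigma-algebra containing the half-spaces, which yields this approximation without any summation
   kernel. The flux in the density equation is of order 1/eps. Two corrections of the density, built
   from eps^2 c_j f_j and eps^4 c_j^2 f_j with c_j = O(1/eps), cancel it and leave a remainder
   O(eps). The constant of that estimate grows with the mode, so it serves finitely many modes only;
   the uniform domination handles the others. *)
Require Import Defs.
From HB Require Import structures.
From mathcomp Require Import all_boot all_order all_algebra.
From mathcomp Require Import all_classical all_reals all_analysis.
From mathcomp Require Import measurable_realfun ess_sup_inf ring lra.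
Import Order.TTheory GRing.Theory Num.Theory.
Import numFieldNormedType.Exports.
Local Open Scope classical_set_scope.
Local Open Scope ring_scope.

Set Implicit Arguments.
Unset Strict Implicit.
Unset Printing Implicit Defensive.

(* The vector library also defines a [coord]. *)
Local Notation coord := Defs.coord.

(** * Borel sets of space and space-time, the periodicity cell *)

(** The sigma-algebra of [mspace3] is generated by measurable rectangles and not by open sets; a
    countable base is what turns an open set into a countable union of measurable ones. Taking [M]
    as a bare family of sets lets the topology of [space3] and the measurable structure of [mspace3]
    appear together. *)
Definition countable_base (T : topologicalType) (M : set (set T)) :=
  exists (J : countType) (B : J -> set T), (forall j, M (B j)) /\
    forall (U : set T) x, open U -> U x -> exists j, B j x /\ B j `<=` U.

Lemma countable_base_real (R : realType) :
  countable_base (fun A : set R => measurable (A : set (measurableTypeR R))).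
Proof.
exists (rat * rat)%type.
exists (fun q => `](ratr q.1 : R), (ratr q.2 : R)[%classic); split=> [q|U x oU Ux].
  exact: measurable_itv.
have : nbhs x U by exact: open_nbhs_nbhs.
move=> /nbhs_ballP[e /= e0 eU].
have [|q1] := @rat_in_itvoo R (x - e) x; first by lra.
have [|q2] := @rat_in_itvoo R x (x + e); first by lra.
rewrite !in_itv/= => /andP[h1 h2] /andP[h3 h4].
exists (q1, q2); split => /=; first by rewrite in_itv/= h4 h1.
move=> y /=; rewrite in_itv/= => /andP[h5 h6]; apply: eU.
by rewrite /ball/= ltr_norml; apply/andP; split; lra.
Qed.

Lemma countable_base_prod (T1 T2 : topologicalType) (M1 : set (set T1))
    (M2 : set (set T2)) (M : set (set (T1 * T2))) :
  (forall A B, M1 A -> M2 B -> M (A `*` B)) ->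
  countable_base M1 -> countable_base M2 -> countable_base M.
Proof.
move=> MM [J1 [B1 [mB1 bB1]]] [J2 [B2 [mB2 bB2]]].
exists (J1 * J2)%type, (fun j => B1 j.1 `*` B2 j.2); split=> [j|U [x y] oU Uxy].
  exact: MM.
have : nbhs (x, y) U by exact: open_nbhs_nbhs.
case=> -[V W] /= [nV nW] VWU.
have [j1 [j1x j1V]] := bB1 _ x (open_interior V) nV.
have [j2 [j2x j2W]] := bB2 _ y (open_interior W) nW.
exists (j1, j2); split=> // -[z w] /= [zB wB]; apply: VWU; split => /=.
  by apply: interior_subset; exact: j1V.
by apply: interior_subset; exact: j2W.
Qed.

(** [U] is the union of the base sets that it contains; the others are replaced by the empty set, so
    that the union still runs over all of [J]. *)
Lemma countable_base_open (T : topologicalType) (M : set (set T)) (U : set T) :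
  M set0 -> (forall (J : countType) (F : J -> set T),
    (forall j, M (F j)) -> M (\bigcup_j F j)) ->
  countable_base M -> open U -> M U.
Proof.
move=> M0 MU [J [B [mB bB]]] oU.
have -> : U = \bigcup_j (if `[< B j `<=` U >] then B j else set0).
  apply/seteqP; split=> [x Ux|x [j _]].
    have [j [jx jU]] := bB _ x oU Ux.
    by exists j => //; case: asboolP.
  by case: asboolP => // BU; exact: BU.
by apply: MU => // j; case: ifP.
Qed.

Section borel_space3.
Variable R : realType.

Lemma countable_base_space3 :
  countable_base (fun A : set (space3 R) => measurable (A : set (mspace3 R))).
Proof.
have b1 := @countable_base_real R.
apply: (@countable_base_prod (R * R)%type R
    (fun A => measurable (A : set (measurableTypeR R * measurableTypeR R)%type))
    _ _ _ _ b1) => [A B mA mB|].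
  exact: (@measurableX _ _ (measurableTypeR R * measurableTypeR R)%type).
by apply: (countable_base_prod _ b1 b1) => A B mA mB; exact: measurableX.
Qed.

Lemma countable_base_spacetime :
  countable_base (fun A : set (R * space3 R) =>
    measurable (A : set (measurableTypeR R * mspace3 R)%type)).
Proof.
apply: (countable_base_prod _ (@countable_base_real R) countable_base_space3).
by move=> A B mA mB; apply: (@measurableX _ _ _ (mspace3 R)).
Qed.

Lemma open_measurable3 (U : set (space3 R)) :
  open U -> measurable (U : set (mspace3 R)).
Proof.
apply: (countable_base_open _ _ countable_base_space3); first exact: measurable0.
by move=> J F mF; apply: (@countable_bigcupT_measurable _ (mspace3 R)).
Qed.

Lemma open_measurable4 (U : set (R * space3 R)) :
  open U -> measurable (U : set (measurableTypeR R * mspace3 R)%type).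
Proof.
apply: (countable_base_open _ _ countable_base_spacetime); first exact: measurable0.
move=> J F mF.
by apply: (@countable_bigcupT_measurable _ (measurableTypeR R * mspace3 R)%type).
Qed.

Lemma compact_measurable3 (K : set (space3 R)) :
  compact K -> measurable (K : set (mspace3 R)).
Proof.
move=> cK; rewrite -(setCK K); apply: (@measurableC _ (mspace3 R)).
apply: open_measurable3; apply: closed_openC; apply: compact_closed => //.

Qed.

Lemma continuous_measurable3 (f : space3 R -> R) :
  continuous f -> measurable_fun [set: mspace3 R] f.
Proof.
move=> cf; apply: (measurability _ (RGenOInfty.measurableE R)) => _ [_ [x ->] <-].
rewrite setTI; apply: open_measurable3.
by move/continuousP : cf; apply; exact: interval_open.
Qed.

Lemma continuous_measurable4 (f : R * space3 R -> R) :
  continuous f -> measurable_fun [set: (measurableTypeR R * mspace3 R)%type] f.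
Proof.
move=> cf; apply: (measurability _ (RGenOInfty.measurableE R)) => _ [_ [x ->] <-].
rewrite setTI; apply: open_measurable4.
by move/continuousP : cf; apply; exact: interval_open.
Qed.

End borel_space3.

Lemma ord3_cases (P : 'I_3 -> Prop) :
  P 0 -> P 1 -> P (inord 2) -> forall k, P k.
Proof.
move=> P0 P1 P2 [[|[|[|//]]] hk].
- by rewrite (_ : Ordinal hk = 0)//; apply: val_inj.
- by rewrite (_ : Ordinal hk = 1)//; apply: val_inj.
- by rewrite (_ : Ordinal hk = inord 2)//; apply: val_inj; rewrite /= inordK.
Qed.

Lemma sum3 (V : nmodType) (F : 'I_3 -> V) :
  \sum_(k < 3) F k = F 0 + F 1 + F (inord 2).
Proof.
rewrite !big_ord_recl big_ord0 addr0 addrA; congr (_ + F _ + F _).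
- exact: val_inj.
- by apply: val_inj; rewrite /= inordK.
Qed.

Section cell_facts.
Variables (R : realType) (a b : 'rV[R]_3).

Lemma coord0 (x : space3 R) : coord 0 x = x.1.1.
Proof. by []. Qed.

Lemma coord1 (x : space3 R) : coord 1 x = x.1.2.
Proof. by []. Qed.

Lemma coord2 (x : space3 R) : coord (inord 2) x = x.2.
Proof. by rewrite /coord inordK. Qed.

Lemma coordD k (x y : space3 R) : coord k (x + y) = coord k x + coord k y.
Proof. by rewrite /coord; case: ifP => // _; case: ifP. Qed.

Lemma coordZ k (s : R) (x : space3 R) : coord k (s *: x) = s * coord k x.
Proof. by rewrite /coord; case: ifP => // _; case: ifP. Qed.

Lemma coord_basis_vec k j : coord k (basis_vec R j) = (k == j)%:R.
Proof.
rewrite /coord/=; case: j k => [[|[|[|//]]] ?] [[|[|[|//]]] ?] //=.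
Qed.

Lemma cell_box : cell a b =
  (`[a 0 0, b 0 0]%classic `*` `[a 0 1, b 0 1]%classic)
  `*` `[a 0 (inord 2), b 0 (inord 2)]%classic.
Proof.
apply/seteqP; split=> [[[x y] z] h|[[x y] z] [[/= hx hy] hz]].
  split; first split; rewrite /= in_itv/=.
  - by have := h 0.
  - by have := h 1.
  - by have := h (inord 2); rewrite coord2.
move: hx hy hz; rewrite /= !in_itv/= => hx hy hz.
by apply: ord3_cases; rewrite ?coord0 ?coord1 ?coord2.
Qed.

Lemma compact_cell : compact (cell a b).
Proof.
by rewrite cell_box; apply: compact_setX; first apply: compact_setX;
  exact: segment_compact.
Qed.

Lemma measurable_cell : measurable (cell a b : set (mspace3 R)).
Proof. by apply: compact_measurable3; exact: compact_cell. Qed.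

Lemma leb3_box (A B C : set (measurableTypeR R)) :
  measurable A -> measurable B -> measurable C ->
  leb3 R ((A `*` B) `*` C) =
   (@lebesgue_measure R A * @lebesgue_measure R B * @lebesgue_measure R C)%E.
Proof.
move=> mA mB mC.
pose l := @lebesgue_measure R.
have -> : leb3 R ((A `*` B) `*` C) = ((l \x l) \x l)%E ((A `*` B) `*` C) by [].
rewrite product_measure1E//; last exact: measurableX.
by congr (_ * _)%E; exact: product_measure1E.
Qed.

Definition vol : R := \prod_(k < 3) (b 0 k - a 0 k).

Hypothesis hab : forall k : 'I_3, a 0 k < b 0 k.

Lemma vol_gt0 : 0 < vol.
Proof. by apply: prodr_gt0 => k _; rewrite subr_gt0. Qed.

Lemma leb3_cell : leb3 R (cell a b) = vol%:E.
Proof.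
rewrite cell_box leb3_box; [|exact: measurable_itv..].
rewrite !lebesgue_measure_itv/= !lte_fin !hab.
rewrite /vol !big_ord_recl big_ord0 mulr1 mulrA -!EFinB -!EFinM.
congr ((_ * _ * _)%:E).
  by congr (b 0 _ - a 0 _); apply: val_inj.
by congr (b 0 _ - a 0 _); apply: val_inj; rewrite /= inordK.
Qed.

Lemma leb3_cell_lty : (leb3 R (cell a b) < +oo)%E.
Proof. by rewrite leb3_cell ltry. Qed.

Lemma continuous_bounded_cell (f : space3 R -> R) : continuous f ->
  exists2 M, 0 < M & forall x, cell a b x -> `|f x| <= M.
Proof.
move=> cf.
have : compact (f @` cell a b).
  apply: continuous_compact; last exact: compact_cell.
  exact: continuous_subspaceT.
move/compact_bounded => [M [_ hM]].
exists (`|M| + 1) => [|x cx]; first by rewrite ltr_wpDl.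
apply: (hM (`|M| + 1)); last by exists x.
by rewrite (le_lt_trans (ler_norm M))// ltrDl.
Qed.

Lemma bounded_integrable_cell (f : space3 R -> R) (M : R) :
  measurable_fun (cell a b : set (mspace3 R)) f ->
  (forall x, cell a b x -> `|f x| <= M) ->
  (leb3 R).-integrable (cell a b) (EFin \o f).
Proof.
move=> mf fM; apply: measurable_bounded_integrable => //.
- exact: measurable_cell.
- exact: leb3_cell_lty.
- exists M; split; first exact: num_real.
  by move=> N MN x /= cx; rewrite (le_trans (fM x cx))// ltW.
Qed.

Lemma continuous_integrable_cell (f : space3 R -> R) : continuous f ->
  (leb3 R).-integrable (cell a b) (EFin \o f).
Proof.
move=> cf; have [M _ fM] := continuous_bounded_cell cf.
apply: bounded_integrable_cell fM.
by apply: measurable_funTS; exact: continuous_measurable3.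
Qed.

End cell_facts.

(** * Integrals of derivatives over the cell *)

Lemma is_derive_line (R : realType) (V : normedModType R) (G D : V -> R) (v : V) :
  (forall x, is_derive x v G (D x)) ->
  forall (x : V) (h : R), is_derive h 1 (fun s : R => G (x + s *: v)) (D (x + h *: v)).
Proof.
move=> GD x h; have [dG <-] := GD (x + h *: v).
have E : (fun s => s^-1 *: (((fun s : R => G (x + s *: v)) \o shift h) (s *: 1)
      - G (x + h *: v))) =
  (fun s => s^-1 *: ((G \o shift (x + h *: v)) (s *: v) - G (x + h *: v))).
  apply/funext => s /=; congr (_ *: (G _ - _)).
  rewrite (_ : s%:A = s); last by rewrite /GRing.scale/= mulr1.
  by rewrite scalerDl addrCA.
split; first by rewrite /derivable E.
by rewrite /derive E.
Qed.

Lemma FTC_is_derive (R : realType) (F f : R -> R) (a b : R) : a < b ->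
  continuous f -> (forall x : R, is_derive x 1 F (f x)) ->
  (\int[@lebesgue_measure R]_(x in `[a, b]) (f x)%:E = (F b - F a)%:E)%E.
Proof.
move=> ab cf dF.
have cF : continuous F.
  move=> x; apply: differentiable_continuous; apply/derivable1_diffP.
  by case: (dF x).
rewrite (@continuous_FTC2 _ f F)//.
- exact: continuous_subspaceT.
- split.
  + by move=> x _; case: (dF x).
  + by apply: cvg_at_right_filter; exact: cF.
  + by apply: cvg_at_left_filter; exact: cF.
- by move=> x _; rewrite derive1E; apply: derive_val.
Qed.

Section fubini_zero.
Context d1 d2 (T1 : measurableType d1) (T2 : measurableType d2) (R : realType).
Variables (m1 : {sigma_finite_measure set T1 -> \bar R})
  (m2 : {sigma_finite_measure set T2 -> \bar R}) (f : T1 * T2 -> \bar R).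
Hypothesis intf : (m1 \x m2)%E.-integrable setT f.

Lemma integral_prod_eq0l : (forall x, \int[m2]_y f (x, y) = 0)%E ->
  (\int[m1 \x m2]_z f z = 0)%E.
Proof.
by move=> h; rewrite -integral12_prod_meas1//; apply: integral0_eq => x _; exact: h.
Qed.

Lemma integral_prod_eq0r : (forall y, \int[m1]_x f (x, y) = 0)%E ->
  (\int[m1 \x m2]_z f z = 0)%E.
Proof.
by move=> h; rewrite -integral21_prod_meas1//; apply: integral0_eq => x _; exact: h.
Qed.

End fubini_zero.

Section product_sigma_finite.
Context d1 d2 (T1 : measurableType d1) (T2 : measurableType d2) (R : realType).
Variables (m1 : {sigma_finite_measure set T1 -> \bar R})
  (m2 : {sigma_finite_measure set T2 -> \bar R}).

(** An alias of the product measure to which sigma-finiteness is attached, as Fubini for the triple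
    product asks of its first factor. *)
Definition product2 : set (T1 * T2) -> \bar R := (m1 \x m2)%E.

HB.instance Definition _ := Measure.copy product2 (m1 \x m2)%E.

Let product2_sigma_finite : sigma_finite setT product2.
Proof.
have /sigma_finiteP[F [TF ndF Foo]] := sigma_finiteT m1.
have /sigma_finiteP[G [TG ndG Goo]] := sigma_finiteT m2.
exists (fun n => F n `*` G n) => [|k].
  rewrite -setXTT TF TG; apply/seteqP; split=> [[x y] [[n _ Fx] [k _ Gy]]|[x y] [n _ [Fx Gy]]].
    exists (maxn n k) => //; split.
      by move: Fx; apply: subsetPset; apply: ndF; exact: leq_maxl.
    by move: Gy; apply: subsetPset; apply: ndG; exact: leq_maxr.
  by split; exists n.
have [? ?] := Foo k; have [? ?] := Goo k; split; first exact: measurableX.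
by rewrite /product2 product_measure1E// lte_mul_pinfty// ge0_fin_numE.
Qed.

HB.instance Definition _ := Measure_isSigmaFinite.Build _ _ _ product2
  product2_sigma_finite.

End product_sigma_finite.

Section fubini_zero3.
Context d1 d2 d3 (T1 : measurableType d1) (T2 : measurableType d2)
  (T3 : measurableType d3) (R : realType).
Variables (m1 : {sigma_finite_measure set T1 -> \bar R})
  (m2 : {sigma_finite_measure set T2 -> \bar R})
  (m3 : {sigma_finite_measure set T3 -> \bar R}) (f : T1 * T2 * T3 -> \bar R).
Hypothesis intf : ((product2 m1 m2) \x m3)%E.-integrable setT f.
Hypothesis intfz : forall z, (m1 \x m2)%E.-integrable setT (fun xy => f (xy, z)).

(** Fubini with the first variable innermost. The inner application takes place at every [z], hence
    the assumption on all slices; the integrand used below is bounded with bounded support, so all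
    its slices are integrable. *)
Lemma integral_prod3_eq0_1 : (forall y z, \int[m1]_x f (x, y, z) = 0)%E ->
  (\int[(product2 m1 m2) \x m3]_x f x = 0)%E.
Proof.
move=> h; apply: (integral_prod_eq0r intf) => z.
by apply: (integral_prod_eq0r (intfz z)) => y; exact: h.
Qed.

Lemma integral_prod3_eq0_2 : (forall x z, \int[m2]_y f (x, y, z) = 0)%E ->
  (\int[(product2 m1 m2) \x m3]_x f x = 0)%E.
Proof.
move=> h; apply: (integral_prod_eq0r intf) => z.
by apply: (integral_prod_eq0l (intfz z)) => y; exact: h.
Qed.

Lemma integral_prod3_eq0_3 : (forall x y, \int[m3]_z f (x, y, z) = 0)%E ->
  (\int[(product2 m1 m2) \x m3]_x f x = 0)%E.
Proof.
by move=> h; apply: (integral_prod_eq0l intf) => -[x y]; exact: h.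
Qed.

End fubini_zero3.

Lemma bounded_integrable_restrict d (T : measurableType d) (R : realType)
    (mu : {measure set T -> \bar R}) (A : set T) (f : T -> R) (M : R) :
  measurable A -> (mu A < +oo)%E -> measurable_fun A f ->
  (forall x, A x -> `|f x| <= M) ->
  mu.-integrable setT ((EFin \o f) \_ A).
Proof.
move=> mA muA mf fM; apply/(integrable_mkcond _ mA).
apply: measurable_bounded_integrable => //.
exists M; split; first exact: num_real.
by move=> N MN x /= cx; rewrite (le_trans (fM x cx))// ltW.
Qed.

Lemma line_continuous (R : realType) (V : normedModType R) (y v : V) :
  continuous (fun s : R => y + s *: v).
Proof.
by move=> s; apply: cvgD; [exact: cvg_cst|exact: scalel_continuous].
Qed.

Section integral_derivative.
Variables (R : realType) (a b : 'rV[R]_3).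
Hypothesis hab : forall k : 'I_3, a 0 k < b 0 k.
Variables (G D : space3 R -> R) (k : 'I_3).
Hypotheses (cD : continuous D) (GD : forall x, is_derive x (basis_vec R k) G (D x))
  (pG : cell_periodic a b G).

(** The fundamental theorem of calculus over a full period: the two end points differ by one period
    in direction [k], where [G] takes equal values. *)
Lemma integral_line_deriv (y : space3 R) :
  (\int[@lebesgue_measure R]_(h in `[a 0%R k, b 0%R k])
     (D (y + h *: basis_vec R k))%:E = 0)%E.
Proof.
have cDy : continuous (fun s : R => D (y + s *: basis_vec R k)).
  by move=> s; exact: (continuous_comp (@line_continuous _ _ y (basis_vec R k) s) (@cD _)).
rewrite (FTC_is_derive (hab k) cDy (is_derive_line GD y)).
have -> : y + b 0 k *: basis_vec R k =
    y + a 0 k *: basis_vec R k + (b 0 k - a 0 k) *: basis_vec R k.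
  by rewrite -addrA -scalerDl [a 0 k + _]addrC subrK.
by rewrite pG subrr.
Qed.

(** Fubini with the [k]-th coordinate innermost reduces the claim to [integral_line_deriv]. *)
Lemma integral_deriv_cell : (\int[leb3 R]_(x in cell a b) (D x)%:E = 0)%E.
Proof.
have [M M0 DM] := @continuous_bounded_cell _ a b _ cD.
have mc := @measurable_cell _ a b.
rewrite integral_mkcond.
pose f := (fun x => (D x)%:E) \_ (cell a b).
have intf : (leb3 R).-integrable setT f.
  apply: (bounded_integrable_restrict mc _ _ DM); first exact: leb3_cell_lty.
  by apply: measurable_funTS; exact: continuous_measurable3.
pose A := `[a 0 0, b 0 0]%classic : set R.
pose B := `[a 0 1, b 0 1]%classic : set R.
pose C := `[a 0 (inord 2), b 0 (inord 2)]%classic : set R.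
(* Membership in the cell splits into one test per coordinate, so that each one-dimensional slice
   can be read off. *)
have fE x y z : f (x, y, z) =
  if [&& x \in A, y \in B & z \in C] then (D (x, y, z))%:E else 0%E.
  rewrite /f patchE cell_box -/A -/B -/C.
  congr (if _ then _ else _).
  apply/idP/and3P; rewrite !inE; first by move=> [[/= ? ?] ?].
  by move=> [? ? ?].
(* [g] is a slice in direction [k] through the point [y], whose [k]-th coordinate will be 0; [p]
   tells whether the two frozen coordinates lie in the cell. *)
have lE (y : space3 R) (p : bool) (g : R -> \bar R) :
    (forall h, g h = if p && (h \in `[a 0%R k, b 0%R k]) then
      (D (y + h *: basis_vec R k))%:E else 0%E) ->
    (\int[@lebesgue_measure R]_h g h = 0)%E.
  move=> gE; case: p gE => gE; last exact: integral0_eq.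
  rewrite -[RHS](integral_line_deriv y) [RHS]integral_mkcond.
  by apply: eq_integral => h _; rewrite gE patchE mem_setE.
have intfz z : (@lebesgue_measure R \x @lebesgue_measure R)%E.-integrable setT
    (fun xy => f (xy, z)).
  have [zC|zC] := boolP (z \in C); last first.
    apply: eq_integrable (integrable0 _ _) => // -[x y] _.
    by rewrite /= fE (negbTE zC) !andbF.
  have -> : (fun xy => f (xy, z)) =
      (EFin \o (fun xy : R * R => D (xy, z))) \_ (A `*` B).
    apply/funext => -[x y]; rewrite fE zC andbT patchE.
    congr (if _ then _ else _).
    by apply/andP/idP; rewrite !inE; move=> [].
  apply: (@bounded_integrable_restrict _ _ _ _ _ _ M).
  - by apply: measurableX; exact: measurable_itv.
  - rewrite [ltLHS](_ : _ = @lebesgue_measure R A * @lebesgue_measure R B)%E;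
      last by apply: product_measure1E; exact: measurable_itv.
    by rewrite /= !lebesgue_measure_itv/= !lte_fin !hab -!EFinB -EFinM ltry.
  - apply: (@measurable_funTS _ _ _ _ (A `*` B)).
    exact: (@measurable_fun_pair1 _ _ _ (measurableTypeR R * measurableTypeR R)%type
      (measurableTypeR R) _ D z (continuous_measurable3 cD)).
  - move=> [x y] [/= xA yB]; apply: DM; rewrite cell_box; split => //=.
    by rewrite inE in zC.
rewrite -/f.
have [|[]] : k = 0 \/ k = 1 \/ k = inord 2.
  by apply: (@ord3_cases (fun k => k = 0 \/ k = 1 \/ k = inord 2));
    [left|right; left|right; right].
- move=> k0; apply: (integral_prod3_eq0_1 intf intfz) => y z.
  apply: (lE (0, y, z) ((y \in B) && (z \in C))) => h.
  rewrite fE k0 (_ : (h \in A) = (h \in `[a 0 0, b 0 0])); last by rewrite mem_setE.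
  rewrite [in RHS]andbC; congr (if _ then (D _)%:E else _).
  rewrite [RHS](_ : _ = (0 + h * 1, y + h * 0, z + h * 0)); first by rewrite ?mulr1 ?mulr0 ?addr0 ?add0r.
  by rewrite /basis_vec/= ?inordK.
- move=> k0; apply: (integral_prod3_eq0_2 intf intfz) => x z.
  apply: (lE (x, 0, z) ((x \in A) && (z \in C))) => h.
  rewrite fE k0 (_ : (h \in B) = (h \in `[a 0 1, b 0 1])); last by rewrite mem_setE.
  rewrite [in RHS]andbAC -[in RHS]andbA.
  congr (if _ then (D _)%:E else _).
  rewrite [RHS](_ : _ = (x + h * 0, 0 + h * 1, z + h * 0)); first by rewrite ?mulr1 ?mulr0 ?addr0 ?add0r.
  by rewrite /basis_vec/= ?inordK.
- move=> k0; apply: (integral_prod3_eq0_3 intf) => x y.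
  apply: (lE (x, y, 0) ((x \in A) && (y \in B))) => h.
  rewrite fE k0 (_ : (h \in C) = (h \in `[a 0 (inord 2), b 0 (inord 2)])); last by rewrite mem_setE.
  rewrite -[in RHS]andbA.
  congr (if _ then (D _)%:E else _).
  rewrite [RHS](_ : _ = (x + h * 0, y + h * 0, 0 + h * 1)); first by rewrite ?mulr1 ?mulr0 ?addr0 ?add0r.
  by rewrite /basis_vec/= ?inordK.
Qed.

Lemma Rintegral_deriv_cell : \int[leb3 R]_(x in cell a b) D x = 0.
Proof. by rewrite /Rintegral integral_deriv_cell. Qed.

End integral_derivative.

(** * Fourier modes *)

(** Transfers a directional derivative to a derivative at 0 on the real line, where the one-variable
    rules, in particular the chain rule, apply. *)
Lemma is_derive_dirP (R : realType) (V : normedModType R) (f : V -> R) (x v : V) (df : R) :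
  is_derive x v f df <-> is_derive (0 : R) 1 (fun s : R => f (x + s *: v)) df.
Proof.
have E : (fun s => s^-1 *: (((fun s : R => f (x + s *: v)) \o shift 0) (s *: 1)
      - (fun s : R => f (x + s *: v)) 0)) =
  (fun s => s^-1 *: ((f \o shift x) (s *: v) - f x)).
  apply/funext => s /=; rewrite scale0r !addr0; congr (_ *: (f _ - _)).
  by rewrite (_ : s%:A = s) 1?addrC// /GRing.scale/= mulr1.
split=> -[df1 df2]; split.
- by rewrite /derivable E.
- by rewrite -df2 /derive E.
- by rewrite /derivable -E.
- by rewrite -df2 /derive -E.
Qed.

Lemma is_derive_chain (R : realType) (V : normedModType R) (f : V -> R) (g : R -> R)
    (x v : V) (df dg : R) :
  is_derive x v f df -> is_derive (f x) 1 g dg ->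
  is_derive x v (fun y => g (f y)) (dg * df).
Proof.
move=> /is_derive_dirP hf hg; apply/is_derive_dirP.
apply: (@is_derive1_comp _ g (fun s : R => f (x + s *: v))) => //.
by rewrite scale0r addr0.
Qed.

Section hartley.
Variables (R : realType) (a b : 'rV[R]_3).
Hypothesis hab : forall k : 'I_3, a 0 k < b 0 k.

Definition mode := (int * int * int)%type.

Definition mcoord (k : 'I_3) (n : mode) : int :=
  if k == 0%N :> nat then n.1.1 else if k == 1%N :> nat then n.1.2 else n.2.

Lemma mcoordD k (m n : mode) : mcoord k (m + n) = mcoord k m + mcoord k n.
Proof. by rewrite /mcoord; case: ifP => // _; case: ifP. Qed.

Lemma mcoordN k (n : mode) : mcoord k (- n) = - mcoord k n.
Proof. by rewrite /mcoord; case: ifP => // _; case: ifP. Qed.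

Lemma mcoord0 k : mcoord k 0 = 0.
Proof. by rewrite /mcoord; case: ifP => // _; case: ifP. Qed.

Lemma mode_neq0 (n : mode) : n != 0 -> exists k, mcoord k n != 0.
Proof.
move: n => [[n1 n2] n3] n0; apply: contrapT => /forallNP h; case/eqP: n0.
have E k : mcoord k (n1, n2, n3) = 0 by apply/eqP; apply: contrapT => /negP; exact: h.
by have := E 0; have := E 1; have := E (inord 2);
  rewrite /mcoord/= inordK//= => -> -> ->.
Qed.

Definition freq (n : mode) (k : 'I_3) : R :=
  (pi *+ 2) / (b 0 k - a 0 k) * (mcoord k n)%:~R.

Lemma freqD m n k : freq (m + n) k = freq m k + freq n k.
Proof. by rewrite /freq mcoordD intrD mulrDr. Qed.

Lemma freqN n k : freq (- n) k = - freq n k.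
Proof. by rewrite /freq mcoordN intrN mulrN. Qed.

Lemma freq0 k : freq 0 k = 0.
Proof. by rewrite /freq mcoord0 mulr0. Qed.

Lemma freq_neq0 n : n != 0 -> exists k, freq n k != 0.
Proof.
move=> /mode_neq0[k nk]; exists k; rewrite /freq !mulf_neq0//.
- by rewrite mulrn_eq0/= gt_eqF// pi_gt0.
- by rewrite invr_eq0 subr_eq0 gt_eqF.
- by rewrite intr_eq0.
Qed.

Definition phase (n : mode) (x : space3 R) : R := \sum_(k < 3) freq n k * coord k x.

Lemma phaseD m n x : phase (m + n) x = phase m x + phase n x.
Proof. by rewrite /phase -big_split; apply: eq_bigr => k _; rewrite freqD mulrDl. Qed.

Lemma phaseN n x : phase (- n) x = - phase n x.
Proof. by rewrite /phase -sumrN; apply: eq_bigr => k _; rewrite freqN mulNr. Qed.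

Lemma phase0 x : phase 0 x = 0.
Proof. by rewrite /phase big1// => k _; rewrite freq0 mul0r. Qed.

Lemma phase_line n x k s : phase n (x + s *: basis_vec R k) = phase n x + s * freq n k.
Proof.
rewrite /phase (bigD1 k)//= [in RHS](bigD1 k)//= coordD coordZ coord_basis_vec eqxx mulr1.
rewrite mulrDr -!addrA; congr (_ + _); rewrite addrC [s * _]mulrC; congr (_ + _).
apply: eq_bigr => j jk; rewrite coordD coordZ coord_basis_vec.
by rewrite (negbTE jk) mulr0 addr0.
Qed.

Lemma continuous_coord k : continuous (@coord R k).
Proof.
elim/ord3_cases: k => x.
- rewrite (_ : coord 0 = fst \o fst)//.
  by apply: continuous_comp; [exact: cvg_fst|exact: cvg_fst].
- rewrite (_ : coord 1 = snd \o fst)//.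
  by apply: continuous_comp; [exact: cvg_fst|exact: cvg_snd].
- rewrite (_ : coord (inord 2) = snd); first exact: cvg_snd.
  by apply/funext => y; rewrite coord2.
Qed.

Lemma continuous_phase n : continuous (phase n).
Proof.
have -> : phase n = fun x => freq n 0 * coord 0 x + freq n 1 * coord 1 x +
    freq n (inord 2) * coord (inord 2) x by apply/funext => x; rewrite /phase sum3.
move=> x; apply: cvgD; [apply: cvgD|].
all: by apply: cvgM; [exact: cvg_cst|exact: continuous_coord].
Qed.

Lemma is_derive_phase n k x : is_derive x (basis_vec R k) (phase n) (freq n k).
Proof.
apply/is_derive_dirP.
rewrite (_ : (fun _ => _) = cst (phase n x) + (freq n k \*: id)); last first.
  by apply/funext => s; rewrite phase_line mulrC.
by apply: is_derive_eq; rewrite add0r /GRing.scale/= mulr1.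
Qed.

(** The kernel of the Hartley transform: a real orthogonal family with exactly one function per
    index, closed under differentiation up to the sign of the index. This sign is the reason why the
    coefficients of n and -n evolve together. *)
Definition hartley (n : mode) (x : space3 R) : R := cos (phase n x) + sin (phase n x).

Lemma hartleyN n x : hartley (- n) x = cos (phase n x) - sin (phase n x).
Proof. by rewrite /hartley phaseN cosN sinN. Qed.

Lemma hartley0 x : hartley 0 x = 1.
Proof. by rewrite /hartley phase0 cos0 sin0 addr0. Qed.

Lemma cos_phase n x : cos (phase n x) = (hartley n x + hartley (- n) x) / 2.
Proof. by rewrite hartleyN /hartley; field. Qed.

Lemma sin_phase n x : sin (phase n x) = (hartley n x - hartley (- n) x) / 2.
Proof. by rewrite hartleyN /hartley; field. Qed.

Lemma hartleyM m n x :
  hartley m x * hartley n x = cos (phase (m - n) x) + sin (phase (m + n) x).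
Proof. by rewrite /hartley !phaseD phaseN cosB sinD; ring. Qed.

Lemma hartley_bound n x : `|hartley n x| <= 2.
Proof.
rewrite (le_trans (ler_normD _ _))// -[leRHS]/(1 + 1).
by rewrite lerD// ?cos_max ?sin_max.
Qed.

Lemma continuous_cos_phase n : continuous (fun x => cos (phase n x)).
Proof.
move=> x; apply: (@continuous_comp _ _ _ (phase n) (@cos R)).
  exact: continuous_phase.
exact: continuous_cos.
Qed.

Lemma continuous_sin_phase n : continuous (fun x => sin (phase n x)).
Proof.
move=> x; apply: (@continuous_comp _ _ _ (phase n) (@sin R)).
  exact: continuous_phase.
exact: continuous_sin.
Qed.

Lemma continuous_hartley n : continuous (hartley n).
Proof.
by move=> x; apply: cvgD; [exact: continuous_cos_phase|exact: continuous_sin_phase].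
Qed.

Lemma is_derive_cos_phase n k x :
  is_derive x (basis_vec R k) (fun x => cos (phase n x)) (- sin (phase n x) * freq n k).
Proof. exact: (is_derive_chain (is_derive_phase n k x) (is_derive_cos _)). Qed.

Lemma is_derive_sin_phase n k x :
  is_derive x (basis_vec R k) (fun x => sin (phase n x)) (cos (phase n x) * freq n k).
Proof. exact: (is_derive_chain (is_derive_phase n k x) (is_derive_sin _)). Qed.

Lemma is_derive_hartley n k x :
  is_derive x (basis_vec R k) (hartley n) (freq n k * hartley (- n) x).
Proof.
have h := is_deriveD (is_derive_cos_phase n k x) (is_derive_sin_phase n k x).
by apply: (is_derive_eq h); rewrite hartleyN; ring.
Qed.

Lemma cosD2piz (x : R) (z : int) : cos (x + (pi *+ 2) * z%:~R) = cos x.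
Proof.
case: z => m; first by rewrite -pmulrn mulr_natr (periodicn (@cosD2pi R)).
by rewrite NegzE mulrNz mulrN -pmulrn mulr_natr
  -[in RHS](subrK (pi *+ 2 *+ m.+1) x) (periodicn (@cosD2pi R)).
Qed.

Lemma sinD2piz (x : R) (z : int) : sin (x + (pi *+ 2) * z%:~R) = sin x.
Proof.
case: z => m; first by rewrite -pmulrn mulr_natr (periodicn (@sinD2pi R)).
by rewrite NegzE mulrNz mulrN -pmulrn mulr_natr
  -[in RHS](subrK (pi *+ 2 *+ m.+1) x) (periodicn (@sinD2pi R)).
Qed.

Lemma phase_period n k x :
  phase n (x + (b 0 k - a 0 k) *: basis_vec R k) =
  phase n x + (pi *+ 2) * (mcoord k n)%:~R.
Proof.
rewrite phase_line /freq; congr (_ + _); rewrite mulrA; congr (_ * _).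
by rewrite mulrCA divff ?mulr1// subr_eq0 gt_eqF.
Qed.

Lemma periodic_cos_phase n : cell_periodic a b (fun x => cos (phase n x)).
Proof. by move=> k x; rewrite phase_period cosD2piz. Qed.

Lemma periodic_sin_phase n : cell_periodic a b (fun x => sin (phase n x)).
Proof. by move=> k x; rewrite phase_period sinD2piz. Qed.

Lemma periodic_hartley n : cell_periodic a b (hartley n).
Proof. by move=> k x; rewrite /hartley phase_period cosD2piz sinD2piz. Qed.

Let cint (f : space3 R -> R) : continuous f ->
  (leb3 R).-integrable (cell a b) (EFin \o f).
Proof. exact: continuous_integrable_cell. Qed.

(** For a nonzero index some frequency is nonzero, and that frequency times the integrand is a
    derivative of the periodic function sin(phase). *)
Lemma integral_cos_phase n :
  \int[leb3 R]_(x in cell a b) cos (phase n x) = if n == 0 then vol a b else 0.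
Proof.
have mc := @measurable_cell _ a b.
case: eqVneq => [->|/freq_neq0[k nk]].
  under eq_Rintegral do rewrite phase0 cos0.
  rewrite Rintegral_cst// mul1r.
  by have -> : leb3 R (cell a b) = (vol a b)%:E by exact: leb3_cell.
apply: (mulfI nk); rewrite mulr0 -RintegralZl//; last first.
  exact/cint/continuous_cos_phase.
apply: (@Rintegral_deriv_cell _ _ _ hab (fun x => sin (phase n x)) _ k).
- by move=> x; apply: cvgM; [exact: cvg_cst|exact: continuous_cos_phase].
- by move=> x; apply: is_derive_eq (is_derive_sin_phase n k x) _; rewrite mulrC.
- exact: periodic_sin_phase.
Qed.

Lemma integral_sin_phase n : \int[leb3 R]_(x in cell a b) sin (phase n x) = 0.
Proof.
have mc := @measurable_cell _ a b.
have [->|/freq_neq0[k nk]] := eqVneq n 0.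
  under eq_Rintegral do rewrite phase0 sin0.
  by rewrite Rintegral_cst// mul0r.
apply: (mulfI nk); rewrite mulr0 -RintegralZl//; last first.
  exact/cint/continuous_sin_phase.
apply: (@Rintegral_deriv_cell _ _ _ hab (fun x => - cos (phase n x)) _ k).
- by move=> x; apply: cvgM; [exact: cvg_cst|exact: continuous_sin_phase].
- move=> x; apply: is_derive_eq (is_deriveN (is_derive_cos_phase n k x)) _.
  by rewrite mulNr opprK mulrC.
- by move=> j x; rewrite periodic_cos_phase.
Qed.

(** In the product formula the sine term always integrates to 0, and the cosine term survives only
    when its index m - n vanishes. *)
Lemma hartley_orthogonal m n :
  \int[leb3 R]_(x in cell a b) (hartley m x * hartley n x) =
  if m == n then vol a b else 0.
Proof.
under eq_Rintegral do rewrite hartleyM.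
rewrite RintegralD; [|exact: measurable_cell|exact/cint/continuous_cos_phase
  |exact/cint/continuous_sin_phase].
by rewrite integral_cos_phase integral_sin_phase addr0 subr_eq0.
Qed.

End hartley.

(** * Density of trigonometric polynomials *)

Section threshold_polynomials.
Variable R : realType.

(** Bernoulli gives 1 + m y <= (1 + y)^m, and (1 - y)(1 + y) = 1 - y^2 <= 1. *)
Lemma onem_pow_bound (y : R) (m : nat) : 0 <= y <= 1 ->
  (1 - y) ^+ m * (1 + y *+ m) <= 1.
Proof.
move=> /andP[y0 y1].
have hb : 1 + y *+ m <= (1 + y) ^+ m.
  elim: m => [|m ih]; first by rewrite mulr0n addr0 expr0.
  rewrite exprS (le_trans _ (ler_wpM2l _ ih))//; last by rewrite addr_ge0.
  rewrite mulrDl mul1r mulrDr mulr1 mulrSr addrA [leRHS]addrA lerDl.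
  by rewrite mulr_ge0// mulrn_wge0.
apply: (le_trans (ler_wpM2l _ hb)); first by rewrite exprn_ge0// subr_ge0.
rewrite -exprMn exprn_ile1// ?mulr_ge0// ?subr_ge0// ?addr_ge0//.
by rewrite (_ : (1 - y) * (1 + y) = 1 - y ^+ 2) ?gerBl ?sqr_ge0//; ring.
Qed.

Lemma onem_pow_ge (y : R) (m : nat) : 0 <= y <= 1 -> 1 - y *+ m <= (1 - y) ^+ m.
Proof.
move=> /andP[y0 y1]; elim: m => [|m ih]; first by rewrite mulr0n subr0 expr0.
rewrite exprS; apply: le_trans (ler_wpM2l _ ih); last by rewrite subr_ge0.
rewrite mulrBr mulr1 mulrBl mul1r mulrSr opprB opprD !addrA.
rewrite -subr_ge0 (_ : _ - _ = y * y *+ m); last by ring.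
by rewrite mulrn_wge0// mulr_ge0.
Qed.

(* q_n(u) = (1 - u^n)^(n 2^n); the factor n makes the limit 0 also at u = 1/2. *)
Definition threshold (n : nat) (u : R) : R := (1 - u ^+ n) ^+ (n * 2 ^ n).

Lemma threshold_bound n u : 0 <= u <= 1 -> 0 <= threshold n u <= 1.
Proof.
move=> /andP[u0 u1]; have un : 0 <= u ^+ n <= 1 by rewrite exprn_ge0// exprn_ile1.
move/andP: un => [un0 un1].
by rewrite exprn_ge0 ?subr_ge0//= exprn_ile1 ?subr_ge0// gerBl.
Qed.

(** With s the square root of r, n r^n = (n s^n) s^n, and [onem_pow_bound] at y = 1 - s bounds n s^n
    by 1/(1 - s). *)
Lemma cvg_natM_expr (r : R) : 0 <= r < 1 -> (fun n : nat => r ^+ n *+ n) @ \oo --> (0 : R).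
Proof.
move=> /andP[r0 r1].
pose s := Num.sqrt r.
have s0 : 0 <= s by exact: sqrtr_ge0.
have s1 : s < 1 by rewrite -sqrtr1 ltr_sqrt.
have sr : s ^+ 2 = r by rewrite sqr_sqrtr.
have ds : 0 < 1 - s by rewrite subr_gt0.
have bd n : (s ^+ n *+ n) * (1 - s) <= 1.
  have := @onem_pow_bound (1 - s) n; rewrite subKr => h.
  have {h} := h _; rewrite lerBlDr lerDl s0 (ltW ds) => /(_ isT).
  move=> h; apply: le_trans h.
  by rewrite [leRHS]mulrDr mulr1 mulrnAl [X in _ <= _ + X]mulrnAr lerDr exprn_ge0.
apply: (@squeeze_cvgr _ _ _ _ (fun=> 0) (fun n => (1 - s)^-1 * s ^+ n)).
- near=> n; rewrite mulrn_wge0 ?exprn_ge0//= -sr -exprM mulnC exprM expr2.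
  rewrite -mulrnAl ler_wpM2r ?exprn_ge0//.
  by rewrite -[leRHS]mul1r ler_pdivlMr.
- exact: cvg_cst.
- rewrite -[X in _ --> X](mulr0 (1 - s)^-1); apply: cvgM; first exact: cvg_cst.
  by apply: cvg_expr; rewrite ger0_norm.
Unshelve. all: by end_near. Qed.

(** The two Bernoulli bounds at y = u^n with exponent n 2^n: below 1/2 the value is at least 1 - n
    (2u)^n, which tends to 1; from 1/2 on it is at most 1/(1 + n (2u)^n) <= 1/(n + 1). Such
    polynomials occur in elementary proofs of the Stone-Weierstrass theorem. *)
Lemma cvg_threshold (u : R) : 0 <= u <= 1 ->
  (fun n => threshold n u) @ \oo --> ((u < 2^-1)%R%:R : R).
Proof.
move=> u01; have /andP[u0 u1] := u01.
have un n : 0 <= u ^+ n <= 1 by rewrite exprn_ge0// exprn_ile1.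
have powE n : (2 * u) ^+ n = u ^+ n *+ 2 ^ n by rewrite exprMn -natrX mulr_natl.
case: ltP => h.
  apply: (@squeeze_cvgr _ _ _ _ (fun n => 1 - (2 * u) ^+ n *+ n) (fun=> 1)).
  - near=> n; have /andP[_ ->] := threshold_bound n u01; rewrite andbT.
    apply: le_trans (onem_pow_ge _ (un n)).
    by rewrite powE mulnC mulrnA.
  - rewrite -[X in _ --> X]subr0; apply: cvgB; first exact: cvg_cst.
    by apply: cvg_natM_expr; rewrite mulr_ge0//= mulrC -ltr_pdivlMr// mul1r.
  - exact: cvg_cst.
apply: (@squeeze_cvgr _ _ _ _ (fun=> 0) (fun n => n.+1%:R^-1)).
- near=> n; have /andP[-> _] := threshold_bound n u01.
  rewrite -[leRHS]mul1r ler_pdivlMr ?ltr0n//=.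
  apply: le_trans (onem_pow_bound (n * 2 ^ n) (un n)).
  apply: ler_wpM2l; first by case/andP: (threshold_bound n u01).
  rewrite -natr1 addrC lerD2l mulnC mulrnA ler_wMn2r//.
  rewrite -powE exprn_ege1//.
  by rewrite mulrC -ler_pdivrMr// mul1r.
- exact: cvg_cst.
- exact: cvg_harmonic.
Unshelve. all: by end_near. Qed.

End threshold_polynomials.

(** * Closure of an algebra of bounded functions under bounded pointwise limits *)

Section bounded_closure.
Variables (R : realType) (T : Type) (O : set T) (B : set (T -> R)).

(* Closure under bounded pointwise limits on [O]; approximability in L^2 with an
   integrable weight passes to such limits. *)
Inductive bclosure : (T -> R) -> Prop :=
| bclosure_base f : B f -> bclosure f
| bclosure_lim (f_ : nat -> T -> R) f (M : R) : (forall n, bclosure (f_ n)) ->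
    (forall n x, O x -> `|f_ n x| <= M) ->
    (forall x, O x -> f_ ^~ x @ \oo --> f x) -> bclosure f.

Hypotheses (B_add : forall f g, B f -> B g -> B (fun x => f x + g x))
  (B_mul : forall f g, B f -> B g -> B (fun x => f x * g x))
  (B_cst : forall c, B (fun=> c))
  (B_bounded : forall f, B f -> exists M, forall x, O x -> `|f x| <= M).

Lemma bclosure_bounded f : bclosure f -> exists M, forall x, O x -> `|f x| <= M.
Proof.
elim=> {f} [f /B_bounded//|f_ f M _ _ fM ff]; exists M => x Ox.
have /cvg_lim <- // : (fun n => `|f_ n x|) @ \oo --> `|f x| by apply: cvg_norm; exact: ff.
apply: limr_le; first by apply/cvg_ex; exists `|f x|; apply: cvg_norm; exact: ff.
by near=> n; exact: fM.
Unshelve. all: by end_near. Qed.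

(** A constant sequence converges on [O] to anything that agrees with it there. *)
Lemma bclosure_ext f g : bclosure f -> (forall x, O x -> f x = g x) -> bclosure g.
Proof.
move=> cf fg; have [M fM] := bclosure_bounded cf.
apply: (@bclosure_lim (fun=> f) g M) => // x Ox.
by rewrite -fg//; exact: cvg_cst.
Qed.

Lemma bclosure_cst c : bclosure (fun=> c).
Proof. by apply: bclosure_base; exact: B_cst. Qed.

Lemma bclosure_add f g : bclosure f -> bclosure g -> bclosure (fun x => f x + g x).
Proof.
move=> cf; elim: cf g => {f} [f Bf g|f_ f M cf ih fM ff g cg].
  elim=> {g} [g Bg|g_ g M cg ih gM gg]; first by apply: bclosure_base; exact: B_add.
  have [N fN] := B_bounded Bf.
  apply: (@bclosure_lim (fun n x => f x + g_ n x) _ (N + M)) => // [n x Ox|x Ox].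
    by rewrite (le_trans (ler_normD _ _))// lerD// ?fN ?gM.
  by apply: cvgD; [exact: cvg_cst|exact: gg].
have [N gN] := bclosure_bounded cg.
apply: (@bclosure_lim (fun n x => f_ n x + g x) _ (M + N)) => [n|n x Ox|x Ox].
- exact: ih.
- by rewrite (le_trans (ler_normD _ _))// lerD// ?fM ?gN.
- by apply: cvgD; [exact: ff|exact: cvg_cst].
Qed.

Lemma bclosure_mul f g : bclosure f -> bclosure g -> bclosure (fun x => f x * g x).
Proof.
move=> cf; elim: cf g => {f} [f Bf g|f_ f M cf ih fM ff g cg].
  elim=> {g} [g Bg|g_ g M cg ih gM gg]; first by apply: bclosure_base; exact: B_mul.
  have [N fN] := B_bounded Bf.
  apply: (@bclosure_lim (fun n x => f x * g_ n x) _ (N * M)) => // [n x Ox|x Ox].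
    by rewrite normrM ler_pM// ?fN ?gM.
  by apply: cvgM; [exact: cvg_cst|exact: gg].
have [N gN] := bclosure_bounded cg.
apply: (@bclosure_lim (fun n x => f_ n x * g x) _ (M * N)) => [n|n x Ox|x Ox].
- exact: ih.
- by rewrite normrM ler_pM// ?fM ?gN.
- by apply: cvgM; [exact: ff|exact: cvg_cst].
Qed.

Lemma bclosure_sub f g : bclosure f -> bclosure g -> bclosure (fun x => f x - g x).
Proof.
move=> cf cg; apply: (@bclosure_ext (fun x => f x + (-1) * g x)).
  by apply: bclosure_add => //; apply: bclosure_mul => //; exact: bclosure_cst.
by move=> x _; rewrite mulN1r.
Qed.

Lemma bclosure_exp f n : bclosure f -> bclosure (fun x => f x ^+ n).
Proof.
move=> cf; elim: n => [|n ih].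
  by apply: (bclosure_ext (bclosure_cst 1)) => x _; rewrite expr0.
by apply: (bclosure_ext (bclosure_mul cf ih)) => x _; rewrite exprS.
Qed.

Lemma bclosure_threshold f : bclosure f -> (forall x, O x -> 0 <= f x <= 1) ->
  bclosure (fun x => (f x < 2^-1)%R%:R).
Proof.
move=> cf f01; apply: (@bclosure_lim (fun n x => threshold n (f x)) _ 1).
- move=> n; apply: bclosure_exp; apply: bclosure_sub; first exact: bclosure_cst.
  exact: bclosure_exp.
- move=> n x Ox; have /andP[h1 h2] := threshold_bound n (f01 x Ox).
  by rewrite ger0_norm.
- by move=> x Ox; apply: cvg_threshold; exact: f01.
Qed.

(** Complements are 1 - 1_A. The complement of a countable union is the limit of the finite products
    of the functions 1 - 1_(A_i), all bounded by 1. *)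
Lemma bclosure_sigma_algebra : sigma_algebra setT [set A | bclosure \1_A].
Proof.
have compl A : bclosure \1_A -> bclosure \1_(~` A).
  move=> cA; apply: (bclosure_ext (bclosure_sub (bclosure_cst 1) cA)) => x _.
  by rewrite !indicE in_setC; case: (x \in A) => /=; rewrite ?subrr ?subr0.
split => [|A cA|A cA] /=.
- by apply: (bclosure_ext (bclosure_cst 0)) => x _; rewrite indicE in_set0.
- by rewrite setTD; exact: compl.
- pose p n x : R := \prod_(i < n) (1 - \1_(A i) x).
  have p01 n x : 0 <= p n x <= 1.
    apply/andP; split.
      by apply: prodr_ge0 => i _; rewrite subr_ge0 indicE; case: (_ \in _).
    by apply: prodr_ile1 => i _; rewrite indicE; case: (_ \in _); rewrite ?subrr ?subr0 ?lexx ?ler01.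
  have cp n : bclosure (p n).
    elim: n => [|n ih].
      by apply: (bclosure_ext (bclosure_cst 1)) => x _; rewrite /p big_ord0.
    apply: (bclosure_ext (bclosure_mul ih (bclosure_sub (bclosure_cst 1) (cA n)))) => x _.
    by rewrite /p big_ord_recr.
  rewrite -(setCK (\bigcup_k A k)); apply: compl.
  apply: (@bclosure_lim p _ 1) => // [n x _|x _].
    by have /andP[h1 h2] := p01 n x; rewrite ger0_norm.
  rewrite indicE in_setC; have [/set_mem[k _ Akx]|/negP xA] := boolP (x \in \bigcup_k A k).
    apply: cvg_near_cst; exists k.+1 => // n /= kn.
    apply/eqP; rewrite prodf_seq_eq0; apply/hasP; exists (Ordinal kn) => //=.
      by rewrite mem_index_enum.
    by rewrite indicE mem_set//= subrr.
  apply: cvg_near_cst; apply: nearW => n; rewrite /p big1// => i _.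
  rewrite indicE memNset ?subr0// => Aix; apply: xA; apply/mem_set.
  by exists (nat_of_ord i).
Qed.

End bounded_closure.

Section bclosure_approximation.
Context d (T : measurableType d) (R : realType).
Variables (mu : {measure set T -> \bar R}) (O : set T) (B : set (T -> R)).
Hypotheses (mO : measurable O) (B_meas : forall f, B f -> measurable_fun O f).
Variable w : T -> R.
Hypotheses (w0 : forall x, 0 <= w x) (iw : mu.-integrable O (EFin \o w)).

Lemma bclosure_measurable s : bclosure O B s -> measurable_fun O s.
Proof.
elim=> {s} [f /B_meas//|f_ f M _ mf fM ff]; exact: measurable_fun_cvg ff.
Qed.

Let mw : measurable_fun O w.
Proof. by apply/measurable_EFinP; exact: measurable_int iw. Qed.

(** Induction on the closure: a bounded limit is approximated by one of its terms through dominated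
    convergence, with dominating function (2M)^2 w, and that term by a member of [B] through the
    induction hypothesis. *)
Lemma bclosure_approx s (delta : R) : bclosure O B s -> 0 < delta ->
  exists2 P, B P & (\int[mu]_(x in O) ((s x - P x) ^+ 2 * w x)%:E <= delta%:E)%E.
Proof.
move=> cs; elim: cs delta => {s} [f Bf delta d0|f_ f M cf ih fM ff delta d0].
  exists f => //; under eq_integral do rewrite subrr expr0n/= mul0r.
  by rewrite integral0 lee_fin ltW.
have mf_ n := bclosure_measurable (cf n).
have mf : measurable_fun O f by apply: measurable_fun_cvg ff.
have msq (g h : T -> R) : measurable_fun O g -> measurable_fun O h ->
    measurable_fun O (fun x => (g x - h x) ^+ 2 * w x).
  move=> mg mh; apply: measurable_funM => //.
  by apply: measurable_funX; exact: measurable_funB.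
have fM' x : O x -> `|f x| <= M.
  move=> Ox; have /cvg_lim <- // : (fun n => `|f_ n x|) @ \oo --> `|f x|.
    by apply: cvg_norm; exact: ff.
  apply: limr_le; first by apply/cvg_ex; exists `|f x|; apply: cvg_norm; exact: ff.
  by near=> n; exact: fM.
have cv : ([sequence \int[mu]_(x in O) ((f x - f_ n x) ^+ 2 * w x)%:E]_n @ \oo -->
    \int[mu]_(x in O) (cst 0 x))%E.
  have [] // := @dominated_convergence _ _ _ mu O mO
      (fun n x => ((f x - f_ n x) ^+ 2 * w x)%:E) (cst 0%E)
      (fun x => (((2 * M) ^+ 2)%:E * (w x)%:E)%E).
  - by move=> n; apply/measurable_EFinP; exact: msq.
  - apply: aeW => x Ox; apply: cvg_EFin; first exact: nearW.
    rewrite /comp/=.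
    rewrite [X in _ --> X](_ : 0 = (f x - f x) ^+ 2 * w x); last first.
      by rewrite subrr expr0n mul0r.
    apply: cvgM; last exact: cvg_cst.
    by rewrite expr2; apply: cvgM; apply: cvgB; [exact: cvg_cst|exact: ff|
      exact: cvg_cst|exact: ff].
  - exact: integrableZl.
  - apply: aeW => x n Ox; rewrite -EFinM abse_EFin lee_fin.
    rewrite ger0_norm; last by rewrite mulr_ge0// sqr_ge0.
    rewrite ler_wpM2r//.
    rewrite -real_normK ?num_real// ler_sqr ?nnegrE//; last first.
      by rewrite mulr_ge0// (le_trans _ (fM' x Ox)).
    by rewrite (le_trans (ler_normB _ _))// mulr_natl mulr2n lerD ?fM ?fM'.
rewrite integral0 in cv.
(* Each of the two errors gets delta/4, because (x + y)^2 <= 2 x^2 + 2 y^2 doubles both. *)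
have [n hn] : exists n, (\int[mu]_(x in O) ((f x - f_ n x) ^+ 2 * w x)%:E <=
    (delta / 4)%:E)%E.
  have d4 : (0%E < (delta / 4)%:E)%E by rewrite lte_fin divr_gt0.
  have [n _ hn] := cv _ (open_ereal_lt' d4).
  by exists n; apply: ltW; exact: (hn n (leqnn n)).
have [P BP hP] := ih n (delta / 4) ltac:(by rewrite divr_gt0).
exists P => //.
apply: (@le_trans _ _ (\int[mu]_(x in O)
   (2%:E * ((f x - f_ n x) ^+ 2 * w x)%:E + 2%:E * ((f_ n x - P x) ^+ 2 * w x)%:E))%E).
  apply: ge0_le_integral => //.
  - by move=> x _; rewrite lee_fin mulr_ge0// sqr_ge0.
  - by apply/measurable_EFinP; apply: msq => //; exact: B_meas.
  - apply: emeasurable_funD; apply: measurable_funeM; apply/measurable_EFinP; apply: msq => //.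
    exact: B_meas.
  - move=> x _; rewrite -!EFinM -EFinD lee_fin !mulrA -mulrDl ler_wpM2r//.
    rewrite -subr_ge0 (_ : _ - _ = (f x - 2 * f_ n x + P x) ^+ 2) ?sqr_ge0//; ring.
rewrite ge0_integralD//; last 4 first.
- by move=> x _; rewrite -!EFinM lee_fin mulr_ge0// mulr_ge0// sqr_ge0.
- by apply: measurable_funeM; apply/measurable_EFinP; exact: msq.
- by move=> x _; rewrite -!EFinM lee_fin mulr_ge0// mulr_ge0// sqr_ge0.
- by apply: measurable_funeM; apply/measurable_EFinP; apply: msq => //; exact: B_meas.
have m2 (g h : T -> R) : measurable_fun O g -> measurable_fun O h ->
   (\int[mu]_(x in O) (2%:E * ((g x - h x) ^+ 2 * w x)%:E) =
    2%:E * \int[mu]_(x in O) ((g x - h x) ^+ 2 * w x)%:E)%E.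
  move=> mg mh; rewrite ge0_integralZl//; first by apply/measurable_EFinP; exact: msq.
  by move=> x _; rewrite lee_fin mulr_ge0// sqr_ge0.
rewrite !m2//; last exact: B_meas.
apply: (@le_trans _ _ (2%:E * (delta / 4)%:E + 2%:E * (delta / 4)%:E)%E).
  by apply: leeD; apply: lee_wpmul2l.
by rewrite -!EFinM -EFinD lee_fin; lra.
Unshelve. all: by end_near. Qed.

End bclosure_approximation.

(** The sets whose preimage lies in [M] form a sigma-algebra, so it is enough to test them on a
    generating family of rays. *)
Lemma sigma_algebra_preimage_real (R : realType) (S : Type) (M : set (set S)) (f : S -> R) :
  sigma_algebra setT M -> (forall c, M [set x | f x < c]) ->
  forall B : set (measurableTypeR R), measurable B -> M (f @^-1` B).
Proof.
move=> sM Mf B mB; have sI := sigma_algebra_image f sM.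
suff : image_set_system setT f M B by rewrite /image_set_system/= setTI.
move: B mB; rewrite (RGenInftyO.measurableE R); apply: smallest_sub => //.
move=> _ [c ->]; rewrite /image_set_system/= setTI.
by have := Mf c; congr M; apply/seteqP; split=> x /=; rewrite in_itv.
Qed.

Lemma sigma_algebra_preimage_prod d1 d2 (T1 : measurableType d1) (T2 : measurableType d2)
    (S : Type) (M : set (set S)) (f : S -> T1 * T2) :
  sigma_algebra setT M ->
  (forall B, measurable B -> M ((fst \o f) @^-1` B)) ->
  (forall B, measurable B -> M ((snd \o f) @^-1` B)) ->
  forall A, measurable A -> M (f @^-1` A).
Proof.
move=> sM M1 M2 A mA; have sI := sigma_algebra_image f sM.
suff : image_set_system setT f M A by rewrite /image_set_system/= setTI.
move: A mA; apply: smallest_sub => // _ [[B mB <-]|[B mB <-]];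
  rewrite /image_set_system/= !setTI; [exact: M1|exact: M2].
Qed.

(** * Trigonometric polynomials and the indicators of Borel sets *)

Section trigonometric_polynomials.
Variables (R : realType) (a b : 'rV[R]_3).
Hypothesis hab : forall k : 'I_3, a 0 k < b 0 k.
Local Notation H := (hartley a b).

Definition trig_poly : set (space3 R -> R) :=
  [set P | exists (F : seq mode) (c : mode -> R), uniq F /\
     P = fun x => \sum_(n <- F) c n * H n x].

Lemma sum_extend (F G : seq mode) (f : mode -> R) : uniq F -> uniq G ->
  {subset F <= G} -> \sum_(n <- G) (if n \in F then f n else 0) = \sum_(n <- F) f n.
Proof.
move=> uF uG FG; rewrite -big_mkcond/= -big_filter; apply: perm_big.
apply: uniq_perm => //; first exact: filter_uniq.
by move=> n; rewrite mem_filter; case: (boolP (n \in F)) => // /FG ->.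
Qed.

Lemma trig_poly_add P Q : trig_poly P -> trig_poly Q -> trig_poly (fun x => P x + Q x).
Proof.
move=> [F [c [uF ->]]] [G [d [uG ->]]].
exists (undup (F ++ G)).
exists (fun n => (if n \in F then c n else 0) + (if n \in G then d n else 0)).
split; first exact: undup_uniq.
apply/funext => x; under [RHS]eq_bigr do rewrite mulrDl.
rewrite big_split/=; congr (_ + _).
- rewrite -(@sum_extend F (undup (F ++ G))) ?undup_uniq//.
    by apply: eq_bigr => n _; case: ifP => // _; rewrite mul0r.
  by move=> n nF; rewrite mem_undup mem_cat nF.
- rewrite -(@sum_extend G (undup (F ++ G))) ?undup_uniq//.
    by apply: eq_bigr => n _; case: ifP => // _; rewrite mul0r.
  by move=> n nF; rewrite mem_undup mem_cat nF orbT.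
Qed.

Lemma trig_poly_scale (c : R) P : trig_poly P -> trig_poly (fun x => c * P x).
Proof.
move=> [F [d [uF ->]]]; exists F, (fun n => c * d n); split => //.
by apply/funext => x; rewrite mulr_sumr; apply: eq_bigr => n _; rewrite mulrA.
Qed.

Lemma trig_poly_hartley n : trig_poly (H n).
Proof.
exists [:: n], (fun=> 1); split => //.
by apply/funext => x; rewrite big_seq1 mul1r.
Qed.

Lemma trig_poly_cst c : trig_poly (fun=> c).
Proof.
have := trig_poly_scale c (trig_poly_hartley 0).
by congr trig_poly; apply/funext => x; rewrite hartley0 mulr1.
Qed.

Lemma trig_poly_cos n : trig_poly (fun x => cos (phase a b n x)).
Proof.
have := trig_poly_scale 2^-1 (trig_poly_add (trig_poly_hartley n) (trig_poly_hartley (- n))).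
by congr trig_poly; apply/funext => x; rewrite cos_phase mulrC.
Qed.

Lemma trig_poly_sin n : trig_poly (fun x => sin (phase a b n x)).
Proof.
have := trig_poly_scale 2^-1 (trig_poly_add (trig_poly_hartley n)
  (trig_poly_scale (-1) (trig_poly_hartley (- n)))).
by congr trig_poly; apply/funext => x; rewrite sin_phase mulrC mulN1r.
Qed.

Lemma trig_poly_sum (I : Type) (s : seq I) (f : I -> space3 R -> R) :
  (forall i, trig_poly (f i)) -> trig_poly (fun x => \sum_(i <- s) f i x).
Proof.
move=> tf; elim: s => [|i s ih].
  by have := trig_poly_cst 0; congr trig_poly; apply/funext => x; rewrite big_nil.
have := trig_poly_add (tf i) ih.
by congr trig_poly; apply/funext => x; rewrite big_cons.
Qed.

Lemma trig_poly_mul P Q : trig_poly P -> trig_poly Q -> trig_poly (fun x => P x * Q x).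
Proof.
move=> [F [c [uF ->]]] [G [d [uG ->]]].
have : trig_poly (fun x => \sum_(m <- F) \sum_(n <- G) (c m * d n) *
    (cos (phase a b (m - n) x) + sin (phase a b (m + n) x))).
  apply: trig_poly_sum => m; apply: trig_poly_sum => n; apply: trig_poly_scale.
  by apply: trig_poly_add; [exact: trig_poly_cos|exact: trig_poly_sin].
congr trig_poly; apply/funext => x; rewrite mulr_suml; apply: eq_bigr => m _.
by rewrite mulr_sumr; apply: eq_bigr => n _; rewrite -hartleyM mulrACA.
Qed.

Lemma trig_poly_continuous P : trig_poly P -> continuous P.
Proof.
move=> [F [c [_ ->]]]; elim: F => [|n F ih].
  by under eq_fun do rewrite big_nil; exact: cst_continuous.
under eq_fun do rewrite big_cons.
move=> x; apply: cvgD; last exact: ih.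
by apply: cvgM; [exact: cvg_cst|exact: continuous_hartley].
Qed.

Lemma trig_poly_bounded P : trig_poly P -> exists M, forall x, `|P x| <= M.
Proof.
move=> [F [c [_ ->]]]; exists (\sum_(n <- F) `|c n| * 2) => x.
apply: (le_trans (ler_norm_sum _ _ _)); apply: ler_sum => n _.
by rewrite normrM ler_wpM2l// hartley_bound.
Qed.

(** Trigonometric polynomials take equal values on opposite faces of the closed cell and cannot
    separate them. Approximation therefore takes place on the interior; the boundary is a null
    set. *)
Definition open_cell : set (space3 R) :=
  [set x | forall k : 'I_3, a 0 k < coord k x < b 0 k].

Local Notation BC := (bclosure open_cell trig_poly).

Let B_bounded f : trig_poly f -> exists M, forall x, open_cell x -> `|f x| <= M.
Proof. by move=> /trig_poly_bounded[M fM]; exists M. Qed.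

Definition unit_mode (k : 'I_3) : mode :=
  ((k == 0%N :> nat)%:Z, (k == 1%N :> nat)%:Z, (k == 2%N :> nat)%:Z).

Lemma phase_unit_mode k x :
  phase a b (unit_mode k) x = (pi *+ 2) / (b 0 k - a 0 k) * coord k x.
Proof.
rewrite /phase (bigD1 k)//= big1 ?addr0 => [|j jk].
  rewrite /freq (_ : mcoord k (unit_mode k) = 1) ?mulr1//.
  by rewrite /mcoord/unit_mode; case: k => [[|[|[|//]]] ?].
rewrite /freq (_ : mcoord j (unit_mode k) = 0) ?mulr0 ?mul0r//.
by move: jk; rewrite /mcoord/unit_mode -val_eqE; case: j k => [[|[|[|//]]] ?] [[|[|[|//]]] ?].
Qed.

(* With c' the midpoint and r the half-length of ]a_k, c[, a point of ]a_k, b_k[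
   lies below c iff its circular distance to c' is below r. *)
Lemma arc_cos (k : 'I_3) (c y : R) : a 0 k < c < b 0 k -> a 0 k < y < b 0 k ->
  let w := (pi *+ 2) / (b 0 k - a 0 k) in
  (y < c) = (cos (w * ((c - a 0 k) / 2)) < cos (w * (y - (a 0 k + c) / 2))).
Proof.
move=> /andP[ac cb] /andP[ay yb] w.
have L0 : 0 < b 0 k - a 0 k by rewrite subr_gt0.
have pi0 := pi_gt0 R.
have w0 : 0 < w by rewrite /w divr_gt0// mulrn_wgt0.
have wL : w * (b 0 k - a 0 k) = pi *+ 2 by rewrite /w divfK// gt_eqF.
set r := (c - a 0 k) / 2; set d := y - _.
have r0 : 0 <= w * r by rewrite mulr_ge0 ?ltW// /r divr_gt0// subr_gt0.
have rpi : w * r <= pi.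
  rewrite /r mulrA ler_pdivrMr// mulr_natr -wL ler_pM2l//.
  by rewrite lerD2r ltW.
have mono z : 0 <= z <= pi -> (cos (w * r) < cos z) = (z < w * r).
  by move=> zpi; rewrite ltr_cos// in_itv/= ?r0.
have [yc|cy] := ltP y c.
  have dr : `|d| < r by rewrite ltr_norml; apply/andP; split; rewrite /d /r; lra.
  have wd : w * `|d| < w * r by rewrite ltr_pM2l.
  rewrite -[cos (w * d)]cos_norm normrM (gtr0_norm w0) mono ?wd//.
  by rewrite mulr_ge0 ?(ltW w0)//= (le_trans (ltW wd)).
(* For y beyond c the angle [w * d] lies between [w * r] and 2 pi - [w * r]. If it exceeds pi it is
   reflected to 2 pi - [w * d], which lies in the range where the cosine decreases. *)
have wrd : w * r <= w * d by rewrite ler_pM2l// /d /r; lra.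
have wd2 : w * d < pi *+ 2 - w * r.
  by rewrite -wL -mulrBr ltr_pM2l// /d /r; lra.
apply/esym/negbTE; have [dpi|dpi] := leP (w * d) pi.
  by rewrite mono ?dpi ?(le_trans r0)// -leNgt.
rewrite -(cosN (w * d)) -(cosD2pi (- (w * d))) mono -?leNgt; last first.
  by apply/andP; split; rewrite addrC subr_ge0 || rewrite addrC; rewrite ?mulr2n in wd2 *; lra.
by rewrite addrC lerBrDr addrC -lerBrDr ltW.
Qed.

(** Within the open cell a half-space is a sublevel set of one trigonometric polynomial, by
    [arc_cos], and [bclosure_threshold] then gives its indicator. For [c] outside the range of the
    coordinate the indicator is constant there. *)
Lemma bclosure_halfspace (k : 'I_3) (c : R) :
  BC \1_[set x : space3 R | coord k x < c].
Proof.
have cst v := bclosure_cst open_cell trig_poly_cst v.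
have [ca|ac] := leP c (a 0 k).
  apply: (bclosure_ext B_bounded (cst 0)) => x /(_ k)/andP[xa xb].
  by rewrite indicE memNset//=; apply/negP; rewrite -leNgt (le_trans ca)// ltW.
have [bc|cb] := leP (b 0 k) c.
  apply: (bclosure_ext B_bounded (cst 1)) => x /(_ k)/andP[xa xb].
  by rewrite indicE mem_set//=; exact: lt_le_trans bc.
pose w := (pi *+ 2) / (b 0 k - a 0 k).
pose e := cos (w * ((c - a 0 k) / 2)).
pose m := w * ((a 0 k + c) / 2).
(* The difference of two cosines lies in [-2, 2]; dividing by 4 and shifting by 1/2 puts [P] in
   [0, 1], with P < 1/2 exactly on the half-space. The cosine is expanded by the addition formula to
   display a trigonometric polynomial. *)
pose P x := 2^-1 + (e - (cos (phase a b (unit_mode k) x) * cos m +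
  sin (phase a b (unit_mode k) x) * sin m)) / 4.
have PE x : P x = 2^-1 + (e - cos (w * (coord k x - (a 0 k + c) / 2))) / 4.
  by rewrite /P phase_unit_mode -cosB mulrBr.
have tP : trig_poly P.
  have := trig_poly_add (trig_poly_cst (2^-1 + e / 4)) (trig_poly_add
    (trig_poly_scale (- (cos m / 4)) (trig_poly_cos (unit_mode k)))
    (trig_poly_scale (- (sin m / 4)) (trig_poly_sin (unit_mode k)))).
  by congr trig_poly; apply/funext => x; rewrite /P; field.
have bP : BC P by exact: bclosure_base.
have P01 x : open_cell x -> 0 <= P x <= 1.
  move=> _; rewrite PE.
  have := cos_max (w * (coord k x - (a 0 k + c) / 2)); have := cos_max (w * ((c - a 0 k) / 2)).
  rewrite -/e !ler_norml => /andP[? ?] /andP[? ?].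
  by apply/andP; split; lra.
have cth : BC (fun x => (P x < 2^-1)%R%:R).
  exact: (bclosure_threshold trig_poly_add trig_poly_mul trig_poly_cst B_bounded bP P01).
apply: (bclosure_ext B_bounded cth) => x Ox; rewrite indicE.
congr (nat_of_bool _)%:R; rewrite PE.
have -> : (x \in [set x0 : space3 R | coord k x0 < c]) = (coord k x < c).
  by apply/idP/idP; rewrite inE.
rewrite (arc_cos _ (Ox k)) ?ac//= -/w -/e.
by apply/idP/idP => ?; lra.
Qed.

Lemma bclosure_indic (A : set (mspace3 R)) : measurable A -> BC (\1_A : space3 R -> R).
Proof.
have sM := bclosure_sigma_algebra trig_poly_add trig_poly_mul trig_poly_cst B_bounded.
have Mk k := sigma_algebra_preimage_real sM (bclosure_halfspace k).
apply: (@sigma_algebra_preimage_prod _ _ (measurableTypeR R * measurableTypeR R)%type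
  (measurableTypeR R) _ _ id sM) => [|B mB].
  apply: (@sigma_algebra_preimage_prod _ _ (measurableTypeR R) (measurableTypeR R)
    _ _ fst sM) => B mB; [exact: (Mk 0)|exact: (Mk 1)].
by have := Mk (inord 2) B mB; congr bclosure; congr indic; apply/seteqP; split => x /=;
  rewrite coord2.
Qed.

End trigonometric_polynomials.

(** * Controlling the L^1 norm by the coefficients *)

Section fourier_coefficients.
Variables (R : realType) (a b : 'rV[R]_3).
Hypothesis hab : forall k : 'I_3, a 0 k < b 0 k.
Local Notation H := (hartley a b).
Local Notation ocell := (open_cell a b).
Local Notation ig g := ((leb3 R).-integrable (cell a b) (EFin \o g)).

Let mc : measurable (cell a b : set (mspace3 R)).
Proof. exact: measurable_cell. Qed.

Lemma open_cell_box : ocell =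
  (`]a 0 0, b 0 0[%classic `*` `]a 0 1, b 0 1[%classic)
  `*` `]a 0 (inord 2), b 0 (inord 2)[%classic.
Proof.
apply/seteqP; split=> [[[x y] z] h|[[x y] z] [[/= hx hy] hz]].
  split; first split; rewrite /= in_itv/=.
  - by have := h 0.
  - by have := h 1.
  - by have := h (inord 2); rewrite coord2.
move: hx hy hz; rewrite /= !in_itv/= => hx hy hz.
by apply: ord3_cases; rewrite ?coord0 ?coord1 ?coord2.
Qed.

Lemma measurable_open_cell : measurable (ocell : set (mspace3 R)).
Proof.
rewrite open_cell_box; apply: measurableX; last exact: measurable_itv.
by apply: measurableX; exact: measurable_itv.
Qed.

Lemma open_cell_sub : ocell `<=` cell a b.
Proof. by move=> x h k; have /andP[? ?] := h k; rewrite !ltW. Qed.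

Lemma cell_boundary_null : leb3 R (cell a b `\` ocell) = 0%E.
Proof.
have mo := measurable_open_cell.
rewrite measureD//; last exact: leb3_cell_lty.
rewrite (setIidr open_cell_sub).
have E1 : leb3 R (cell a b) = (vol a b)%:E by exact: leb3_cell.
have E2 : leb3 R ocell = (vol a b)%:E.
  rewrite -E1 open_cell_box cell_box !leb3_box; [|exact: measurable_itv..].
  by rewrite !lebesgue_measure_itv.
rewrite [X in (X - _)%E](_ : _ = (vol a b)%:E); last exact: E1.
by rewrite [X in (_ - X)%E](_ : _ = (vol a b)%:E) ?subee//; exact: E2.
Qed.

Lemma ge0_integral_open_cell (f : space3 R -> \bar R) :
  measurable_fun (cell a b : set (mspace3 R)) f -> (forall x, cell a b x -> (0 <= f x)%E) ->
  (\int[leb3 R]_(x in cell a b) f x = \int[leb3 R]_(x in ocell) f x)%E.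
Proof.
move=> mf f0.
have mN : measurable ((cell a b `\` ocell) : set (mspace3 R)).
  by apply: measurableD => //; exact: measurable_open_cell.
have := @ge0_negligible_integral _ _ R (leb3 R) (cell a b) (cell a b `\` ocell) f
  mN mc mf f0 cell_boundary_null.
by rewrite setDD (setIidr open_cell_sub).
Qed.

Lemma integrable_cell_mul (g f : space3 R -> R) (M : R) : ig g -> measurable_fun (cell a b : set (mspace3 R)) f ->
  (forall x, cell a b x -> `|f x| <= M) -> ig (fun x => g x * f x).
Proof.
move=> gi mf fM.
have := @integrableMl _ _ _ (leb3 R) _ mc (EFin \o g) f gi mf _.
apply; exists M; split; first exact: num_real.
by move=> N MN x /= cx; rewrite (le_trans (fM x cx))// ltW.
Qed.

Lemma integrable_cell_continuous (g f : space3 R -> R) : ig g -> continuous f -> ig (fun x => g x * f x).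
Proof.
move=> gi cf; have [M _ fM] := @continuous_bounded_cell _ a b _ cf.
apply: integrable_cell_mul fM => //.
by apply: measurable_funTS; exact: continuous_measurable3.
Qed.

(** Not divided by [vol a b], the squared L^2 norm of every mode; that factor is restored when a
    function is synthesised from its coefficients. *)
Definition coef (n : mode) (g : space3 R -> R) : R :=
  \int[leb3 R]_(x in cell a b) (g x * H n x).

Lemma integrable_cell_sum (I : Type) (s : seq I) (f : I -> space3 R -> R) :
  (forall i, ig (f i)) -> ig (fun x => \sum_(i <- s) f i x).
Proof.
move=> fi; have := @integrable_sum _ _ _ (leb3 R) _ mc _ s xpredT (fun i x => (f i x)%:E)
  (fun i _ => fi i).
by apply: eq_integrable => // x _; rewrite /= sumEFin.
Qed.

Lemma Rintegral_cell_sum (I : Type) (s : seq I) (f : I -> space3 R -> R) :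
  (forall i, ig (f i)) ->
  \int[leb3 R]_(x in cell a b) (\sum_(i <- s) f i x) =
  \sum_(i <- s) \int[leb3 R]_(x in cell a b) f i x.
Proof.
move=> fi; elim: s => [|i s ih].
  by under eq_Rintegral do rewrite big_nil; rewrite Rintegral_cst// mul0r big_nil.
under eq_Rintegral do rewrite big_cons.
by rewrite RintegralD//; [rewrite ih big_cons|exact: integrable_cell_sum].
Qed.

Lemma integrable_hartley (g : space3 R -> R) n : ig g -> ig (fun x => g x * H n x).
Proof. by move=> gi; apply: integrable_cell_continuous => //; exact: continuous_hartley. Qed.

Lemma pairing_trig (g : space3 R -> R) (F : seq mode) (c : mode -> R) : ig g ->
  \int[leb3 R]_(x in cell a b) (g x * \sum_(n <- F) c n * H n x) =
  \sum_(n <- F) c n * coef n g.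
Proof.
move=> gi.
transitivity (\int[leb3 R]_(x in cell a b) (\sum_(n <- F) c n * (g x * H n x))).
  by apply: eq_Rintegral => x _; rewrite mulr_sumr; apply: eq_bigr => n _; rewrite mulrCA.
rewrite Rintegral_cell_sum => [|n].
  by apply: eq_bigr => n _; rewrite RintegralZl//; exact: integrable_hartley.
exact: (integrableZl mc (c n) (integrable_hartley n gi)).
Qed.

Lemma coef_trig (F : seq mode) (c : mode -> R) n : uniq F ->
  coef n (fun x => \sum_(m <- F) c m * H m x) = (if n \in F then c n else 0) * vol a b.
Proof.
move=> uF; rewrite /coef; under eq_Rintegral do rewrite mulrC.
rewrite pairing_trig; last exact/continuous_integrable_cell/continuous_hartley.
under eq_bigr do rewrite /coef hartley_orthogonal//.
case: ifPn => nF.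
  rewrite (bigD1_seq n)//= eqxx big1_seq ?addr0// => m /andP[mn _].
  by rewrite eq_sym (negbTE mn) mulr0.
rewrite big1_seq ?mul0r// => m /andP[_ mF]; case: eqP => [E|_]; last by rewrite mulr0.
by rewrite E mF in nF.
Qed.

Lemma norm2_trig (F : seq mode) (c : mode -> R) : uniq F ->
  \int[leb3 R]_(x in cell a b) ((\sum_(n <- F) c n * H n x) ^+ 2) =
  vol a b * \sum_(n <- F) c n ^+ 2.
Proof.
move=> uF; under eq_Rintegral do rewrite expr2.
rewrite pairing_trig; last first.
  apply: continuous_integrable_cell => //; apply: (@trig_poly_continuous _ a b).
  by exists F, c.
rewrite mulr_sumr !big_seq; apply: eq_bigr => n nF.
by rewrite coef_trig// nF expr2; ring.
Qed.

(** Expansion of the nonnegative integral of (g - P)^2, where [P] is the orthogonal projection of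
    [g] on the modes in [F]. *)
Lemma bessel (g : space3 R -> R) (F : seq mode) : ig g -> ig (fun x => g x ^+ 2) -> uniq F ->
  \sum_(n <- F) coef n g ^+ 2 <= vol a b * \int[leb3 R]_(x in cell a b) (g x ^+ 2).
Proof.
move=> gi g2i uF.
set S := \sum_(n <- F) coef n g ^+ 2; have v0 := vol_gt0 hab.
pose c n := coef n g / vol a b.
pose P x := \sum_(n <- F) c n * H n x.
have cP : continuous P by apply: (@trig_poly_continuous _ a b); exists F, c.
have Pi : ig (fun x => P x ^+ 2).
  apply: continuous_integrable_cell => // x.
  exact: (cvgM (@cP x) (@cP x)).
have gPi : ig (fun x => g x * P x) by exact: integrable_cell_continuous.
have : 0 <= \int[leb3 R]_(x in cell a b) ((g x ^+ 2 - 2 * (g x * P x)) + P x ^+ 2).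
  apply: Rintegral_ge0 => x _.
  rewrite (_ : _ + _ = (g x - P x) ^+ 2) ?sqr_ge0//; ring.
have g2Pi : ig (fun x => 2 * (g x * P x)) by exact: (integrableZl mc 2 gPi).
rewrite RintegralD//; last exact: (integrableB mc g2i g2Pi).
rewrite RintegralB// RintegralZl// norm2_trig// pairing_trig//.
have -> : \sum_(n <- F) c n * coef n g = S / vol a b.
  by rewrite mulr_suml; apply: eq_bigr => n _; rewrite /c expr2; ring.
have -> : vol a b * (\sum_(n <- F) c n ^+ 2) = S / vol a b.
  rewrite mulr_sumr mulr_suml; apply: eq_bigr => n _; rewrite /c; field.
  by rewrite gt_eqF.
rewrite -addrA (_ : - _ + _ = - (S / vol a b)); last by ring.
by rewrite subr_ge0 ler_pdivrMr// mulrC.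
Qed.

Lemma ge0_Rintegral_le (f : space3 R -> R) (delta : R) :
  measurable_fun (cell a b : set (mspace3 R)) f -> (forall x, 0 <= f x) ->
  (\int[leb3 R]_(x in cell a b) (f x)%:E <= delta%:E)%E ->
  ig f /\ \int[leb3 R]_(x in cell a b) f x <= delta.
Proof.
move=> mf f0 fd.
have fi : ig f.
  apply/integrableP; split; first exact/measurable_EFinP.
  apply: (@le_lt_trans _ _ delta%:E); last exact: ltry.
  by under eq_integral do rewrite /= ger0_norm//.
split => //; rewrite -lee_fin /Rintegral fineK//.
exact: (integrable_fin_num mc fi).
Qed.

(* Test [g] against a trigonometric polynomial close to its sign in
   L^2((1 + |g|) dx). *)
Lemma L1_le_coef (g : space3 R -> R) (B : R) : 0 < B -> ig g ->
  (forall F : seq mode, uniq F -> \sum_(n <- F) coef n g ^+ 2 <= B ^+ 2) ->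
  \int[leb3 R]_(x in cell a b) `|g x| <= 2 * B.
Proof.
move=> B0 gi coefB; have v0 := vol_gt0 hab.
have mg : measurable_fun (cell a b : set (mspace3 R)) g.
  by apply/measurable_EFinP; exact: measurable_int gi.
have gai : ig (fun x => `|g x|) by exact: (integrable_norm gi).
set G := \int[leb3 R]_(x in cell a b) `|g x|.
have G0 : 0 <= G by exact: Rintegral_ge0.
pose Ap := cell a b `&` g @^-1` `]0, +oo[%classic.
pose An := cell a b `&` g @^-1` `]-oo, 0[%classic.
have mAp : measurable (Ap : set (mspace3 R)) by apply: mg => //; exact: measurable_itv.
have mAn : measurable (An : set (mspace3 R)) by apply: mg => //; exact: measurable_itv.
pose s x : R := (\1_Ap x - \1_An x).
have cs : bclosure ocell (trig_poly a b) s.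
  apply: bclosure_sub; [exact: trig_poly_add|exact: trig_poly_mul|exact: trig_poly_cst|..].
  - by move=> f /trig_poly_bounded[M fM]; exists M.
  - exact: bclosure_indic.
  - exact: bclosure_indic.
have sg x : cell a b x -> s x * g x = `|g x| /\ `|s x| <= 1.
  move=> cx; rewrite /s !indicE.
  have -> : (x \in Ap) = (0 < g x).
    by apply/idP/idP; rewrite inE /Ap/= in_itv/= ?andbT; [move=> []|move=> ->].
  have -> : (x \in An) = (g x < 0).
    by apply/idP/idP; rewrite inE /An/= in_itv/= ?andbT; [move=> []|move=> ->].
  case: (ltgtP (g x) 0) => /= gx.
  - by rewrite ltr0_norm// sub0r mulN1r normrN1.
  - by rewrite gtr0_norm// subr0 mul1r normr1.
  - by rewrite gx normr0 subrr mulr0 normr0.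
(* Chosen so that the terms of the final estimate that carry [eta] add up to at most B/2; this is
   [etaE]. *)
pose eta0 := B / 2 / (B / vol a b + (G + 1) / 2).
have D0 : 0 < B / vol a b + (G + 1) / 2.
  by rewrite addr_gt0// divr_gt0// ltr_wpDl.
have eta00 : 0 < eta0 by rewrite !divr_gt0.
pose eta := Num.min 1 eta0.
have eta_gt0 : 0 < eta by rewrite lt_min ltr01.
have eta1 : eta <= 1 by rewrite ge_min lexx.
have etaE : eta * (B / vol a b + (G + 1) / 2) <= B / 2.
  by rewrite -ler_pdivlMr// ge_min lexx orbT.
(* The part 1 of the weight controls the L^2 norm of the polynomial, the part |g| controls the error
   made in the pairing with [g]. *)
have iw : (leb3 R).-integrable ocell (EFin \o (fun x => 1 + `|g x|)).
  apply: (integrableS mc (measurable_open_cell) open_cell_sub).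
  apply: (@eq_integrable _ _ _ _ _ mc (fun x => (1%:E + `|g x|%:E)%E)) => //.
  apply: integrableD => //.
  by apply: continuous_integrable_cell => //; exact: cst_continuous.
have [P tP hP] := bclosure_approx measurable_open_cell
  (fun f tf => measurable_funTS (continuous_measurable3 (trig_poly_continuous tf)))
  (fun x => addr_ge0 ler01 (normr_ge0 (g x))) iw cs (exprn_gt0 2 eta_gt0).
have cP := trig_poly_continuous tP.
pose q x := (s x - P x) ^+ 2 * (1 + `|g x|).
have q0 x : 0 <= q x by rewrite mulr_ge0// ?sqr_ge0// addr_ge0.
have mP : measurable_fun (cell a b : set (mspace3 R)) P.
  by apply: measurable_funTS; exact: continuous_measurable3.
have mq : measurable_fun (cell a b : set (mspace3 R)) q.
  apply: measurable_funM; last first.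
    by apply: measurable_funD => //; exact: measurableT_comp.
  apply: measurable_funX; apply: measurable_funB => //.
  by apply: measurable_funB; apply: measurable_funTS; exact: measurable_indic.
have [qi qle] : ig q /\ \int[leb3 R]_(x in cell a b) q x <= eta ^+ 2.
  apply: ge0_Rintegral_le => //; rewrite ge0_integral_open_cell//.
    exact/measurable_EFinP.
  by move=> x _; rewrite lee_fin.
have [F [c [uF PE]]] := tP.
have gPi : ig (fun x => g x * P x) by exact: integrable_cell_continuous.
have gPE : \int[leb3 R]_(x in cell a b) (g x * P x) = \sum_(n <- F) c n * coef n g.
  by rewrite PE pairing_trig.
have P2i : ig (fun x => P x ^+ 2).
  by apply: continuous_integrable_cell => // x; exact: (cvgM (@cP x) (@cP x)).
have q2i : ig (fun x => 2 * q x) by exact: (integrableZl mc 2 qi).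
have onei : ig (fun=> 2 : R).
  by apply: continuous_integrable_cell => //; exact: cst_continuous.
set C := \sum_(n <- F) c n ^+ 2.
(* From P^2 <= 2 s^2 + 2 (s - P)^2 and |s| <= 1, integrated over the cell. *)
have CE : vol a b * C <= 2 * vol a b + 2 * eta ^+ 2.
  have <- : \int[leb3 R]_(x in cell a b) (P x ^+ 2) = vol a b * C by rewrite PE norm2_trig.
  apply: (@le_trans _ _ (\int[leb3 R]_(x in cell a b) (2 + 2 * q x))).
    apply: le_Rintegral => //; first exact: (integrableD mc onei q2i).
    move=> x /sg[_ s1].
    have s2 : s x ^+ 2 <= 1.
      by rewrite -real_normK ?num_real// exprn_ile1.
    have hq : (s x - P x) ^+ 2 <= q x.
      by rewrite /q ler_peMr ?sqr_ge0// lerDl.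
    have h3 := sqr_ge0 (P x - 2 * s x).
    nra.
  rewrite RintegralD// RintegralZl// Rintegral_cst//.
  rewrite (_ : fine _ = vol a b); last by rewrite leb3_cell.
  by rewrite lerD2l ler_pM2l.
have e2le : eta ^+ 2 <= eta by rewrite expr2 ler_piMr// ltW.
have Cle : C <= 2 + 2 * eta / vol a b.
  rewrite -(ler_pM2l v0) (le_trans CE)// mulrDr [vol a b * 2]mulrC lerD2l.
  by rewrite [leRHS]mulrC divfK ?gt_eqF// ler_pM2l.
(* Young's inequality balanced by [B]: c d <= (B/2) c^2 + d^2/(2B), where the squares of the
   coefficients d sum to at most B^2. *)
have coefle : \sum_(n <- F) c n * coef n g <= B / 2 * C + B / 2.
  apply: (@le_trans _ _ (\sum_(n <- F) (B / 2 * c n ^+ 2 + (2 * B)^-1 * coef n g ^+ 2))).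
    apply: ler_sum => n _; rewrite -subr_ge0.
    rewrite (_ : _ - _ = (2 * B)^-1 * (B * c n - coef n g) ^+ 2); last first.
      by field; rewrite gt_eqF.
    by rewrite mulr_ge0 ?sqr_ge0// invr_ge0 mulr_ge0// ltW.
  rewrite big_split/= -!mulr_sumr lerD2l.
  apply: (le_trans (ler_wpM2l _ (coefB F uF))); first by rewrite invr_ge0 mulr_ge0// ltW.
  by rewrite le_eqVlt; apply/orP; left; apply/eqP; field; rewrite gt_eqF.
have gai2 : ig (fun x => eta / 2 * `|g x|) by exact: (integrableZl mc _ gai).
have qi2 : ig (fun x => (2 * eta)^-1 * q x) by exact: (integrableZl mc _ qi).
(* |g| = s g is split as P g + (s - P) g, with |s - P| <= eta/2 + (s - P)^2/(2 eta). Collecting the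
   bounds gives B + B/2 from the pairing and, by [etaE], another B/2 from the rest, whence the
   constant 2. *)
have Gle : G <= \sum_(n <- F) c n * coef n g + (eta / 2 * G + (2 * eta)^-1 * eta ^+ 2).
  apply: (@le_trans _ _ (\int[leb3 R]_(x in cell a b)
     (g x * P x + (eta / 2 * `|g x| + (2 * eta)^-1 * q x)))).
    apply: le_Rintegral => //; first exact: (integrableD mc gPi (integrableD mc gai2 qi2)).
    move=> x /sg[sgx _].
    have h1 : `|g x| <= g x * P x + `|g x| * `|s x - P x|.
      rewrite -[leLHS]sgx -normrM -lerBlDl (le_trans _ (ler_norm _))//.
      by rewrite mulrBr [s x * _]mulrC.
    apply: (le_trans h1); rewrite lerD2l.
    apply: (@le_trans _ _ (eta / 2 * `|g x| + (2 * eta)^-1 * (`|g x| * (s x - P x) ^+ 2))).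
      rewrite -[in leRHS](real_normK (num_real (s x - P x))) -subr_ge0.
      rewrite (_ : _ - _ = `|g x| * (2 * eta)^-1 * (eta - `|s x - P x|) ^+ 2); last first.
        by field; rewrite gt_eqF.
      by rewrite mulr_ge0 ?sqr_ge0// mulr_ge0// invr_ge0 mulr_ge0// ltW.
    rewrite lerD2l ler_wpM2l ?invr_ge0 ?mulr_ge0 ?(ltW eta_gt0)//.
    by rewrite /q mulrC ler_wpM2l ?sqr_ge0// lerDr.
  rewrite RintegralD//; last exact: (integrableD mc gai2 qi2).
  rewrite RintegralD// !RintegralZl// gPE lerD2l lerD2l ler_wpM2l//.
  by rewrite invr_ge0 mulr_ge0// ltW.
have e1 : (2 * eta)^-1 * eta ^+ 2 = eta / 2 by field; rewrite gt_eqF.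
have e3 : B / 2 * C <= B / 2 * (2 + 2 * eta / vol a b) by rewrite ler_wpM2l// divr_ge0// ltW.
have e4 : B / 2 * (2 + 2 * eta / vol a b) = B + eta * (B / vol a b) by field; rewrite gt_eqF.
have e5 : eta * (B / vol a b + (G + 1) / 2) = eta * (B / vol a b) + (eta / 2 * G + eta / 2).
  by field; rewrite gt_eqF.
rewrite e1 in Gle; rewrite e5 in etaE; rewrite e4 in e3; lra.
Qed.

End fourier_coefficients.

Section small_coefficients.
Variables (R : realType) (a b : 'rV[R]_3).
Hypothesis hab : forall k : 'I_3, a 0 k < b 0 k.
Local Notation ig g := ((leb3 R).-integrable (cell a b) (EFin \o g)).

(** By [L1_le_coef] it suffices that the squared coefficients sum to at most (delta/2)^2 = 2e.
    Outside a finite set that nearly attains the supremum of the sums of [Bd] the bound [Bd] leaves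
    at most e; inside it the tolerance [eta] does. *)
Lemma L1_small (Bd : mode -> R) (K : R) : (forall n, 0 <= Bd n) ->
  (forall F : seq mode, uniq F -> \sum_(n <- F) Bd n <= K) ->
  forall delta, 0 < delta -> exists (F : seq mode) (eta : R), 0 < eta /\
    forall g : space3 R -> R, ig g -> (forall n, coef a b n g ^+ 2 <= Bd n) ->
      (forall n, n \in F -> `|coef a b n g| <= eta) ->
      \int[leb3 R]_(x in cell a b) `|g x| <= delta.
Proof.
move=> Bd0 BdK delta d0.
pose A := [set s : R | exists F : seq mode, uniq F /\ s = \sum_(n <- F) Bd n].
have supA : has_sup A.
  split; first by exists (\sum_(n <- [::]) Bd n), [::].
  by exists K => _ [F [uF ->]]; exact: BdK.
pose e := (delta / 2) ^+ 2 / 2.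
have e0 : 0 < e by rewrite divr_gt0// exprn_gt0// divr_gt0.
have [_ [F0 [uF0 ->]] hF0] := sup_adherent e0 supA.
(* The cap at 1 gives eta^2 <= eta, and the successor keeps the denominator nonzero when [F0] is
   empty. *)
pose eta := Num.min 1 (e / (size F0).+1%:R).
have eta0 : 0 < eta by rewrite lt_min ltr01 divr_gt0// ltr0n.
have eta1 : eta <= 1 by rewrite ge_min lexx.
have etaE : eta ^+ 2 *+ size F0 <= e.
  apply: (@le_trans _ _ (eta *+ size F0)).
    by rewrite lerMn2r expr2 ler_piMr ?orbT// ltW.
  apply: (@le_trans _ _ (eta *+ (size F0).+1)); first by rewrite mulrSr lerDl ltW.
  by rewrite -mulr_natr -ler_pdivlMr ?ltr0n// ge_min lexx orbT.
exists F0, eta; split => // g gi gB gF.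
rewrite -[delta](divfK (_ : 2 != 0 :> R))// mulrC.
apply: L1_le_coef => //; first by rewrite divr_gt0.
move=> F uF; rewrite (bigID (mem F0))/=.
rewrite (_ : _ ^+ 2 = e + e); last by rewrite /e; field.
apply: lerD.
  apply: le_trans etaE.
  rewrite -big_filter.
  have uf : uniq [seq n <- F | n \in F0] by rewrite filter_uniq.
  apply: (@le_trans _ _ (\sum_(n <- [seq n <- F | n \in F0]) eta ^+ 2)).
    rewrite !big_seq; apply: ler_sum => n; rewrite mem_filter => /andP[nF0 _].
    by rewrite -real_normK ?num_real// ler_sqr ?nnegrE ?(ltW eta0)// gF.
  rewrite big_const_seq count_predT iter_addr_0; apply: ler_wpMn2l; first by rewrite exprn_ge0// ltW.
  by apply: uniq_leq_size => // n; rewrite mem_filter => /andP[].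
apply: (@le_trans _ _ (\sum_(n <- [seq n <- F | n \notin F0]) Bd n)).
  by rewrite big_filter; apply: ler_sum => n _; exact: gB.
have uF1 : uniq (F0 ++ [seq n <- F | n \notin F0]).
  rewrite cat_uniq uF0 filter_uniq// andbT/=; apply/hasPn => n.
  by rewrite mem_filter => /andP[].
have : \sum_(n <- F0 ++ [seq n <- F | n \notin F0]) Bd n <= sup A.
  by apply: sup_upper_bound => //; exists (F0 ++ [seq n <- F | n \notin F0]).
rewrite big_cat/=; lra.
Qed.

End small_coefficients.

(** * Smooth test functions and weak derivatives *)

Section flat_function.
Variable R : realType.

(** The factor x^(-n) makes the family stable under differentiation up to linear combinations
    ([is_derive_flat]), so that one first-order computation covers derivatives of every order. *)
Definition flat (n : nat) (x : R) : R :=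
  if 0 < x then x^-1 ^+ n * expR (- x^-1) else 0.

Lemma flat_ge0 n x : 0 <= flat n x.
Proof.
rewrite /flat; case: ifP => // x0.
by rewrite mulr_ge0 ?expR_ge0// exprn_ge0// invr_ge0 ltW.
Qed.

Lemma flat_le0 n x : x <= 0 -> flat n x = 0.
Proof. by rewrite /flat => x0; rewrite ltNge x0. Qed.

(** y/m <= 1 + y/m <= exp(y/m), raised to the power m. *)
Lemma exprn_le_expR (m : nat) (y : R) : 0 <= y -> y ^+ m <= m%:R ^+ m * expR y.
Proof.
case: m => [|m] y0; first by rewrite !expr0 mul1r -expR0 ler_expR.
have m0 : 0 < m.+1%:R :> R by rewrite ltr0n.
have {1}-> : y = m.+1%:R * (y / m.+1%:R) by rewrite mulrC divfK// gt_eqF.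
rewrite exprMn; apply: ler_wpM2l; first by rewrite exprn_ge0// ltW.
have -> : expR y = expR (y / m.+1%:R) ^+ m.+1 by rewrite -expRM_natr divfK// gt_eqF.
have y1 : 0 <= y / m.+1%:R by rewrite divr_ge0// ltW.
rewrite lerXn2r ?nnegrE ?expR_ge0//.
by rewrite (le_trans _ (expR_ge1Dx _))// lerDr.
Qed.

Lemma flat_bound n (x : R) : `|flat n x| <= n.+1%:R ^+ n.+1 * `|x|.
Proof.
rewrite ger0_norm ?flat_ge0// /flat; case: ifPn => x0; last first.
  by rewrite mulr_ge0// exprn_ge0.
rewrite gtr0_norm// -ler_pdivrMr// mulrAC -exprSr expRN ler_pdivrMr ?expR_gt0//.
by apply: exprn_le_expR; rewrite invr_ge0 ltW.
Qed.

Lemma is_derive_flat (n : nat) (x : R) : is_derive x 1 (flat n) (flat n.+2 x - n%:R * flat n.+1 x).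
Proof.
have [x0|x0|x0] := ltgtP x 0.
- rewrite !flat_le0 ?ltW// mulr0 subr0.
  apply: (@near_eq_is_derive R R R (cst 0)).
  near=> y; rewrite /= flat_le0//; apply: ltW; near: y.
  exact: lt_nbhsl.
- apply: (@near_eq_is_derive R R R (fun y => y^-1 ^+ n * expR (- y^-1))).
    near=> y; rewrite /flat ifT//; near: y; exact: lt_nbhsr.
  have x1 : x != 0 by rewrite gt_eqF.
  have dV : is_derive x 1 (fun y : R => y^-1) (- x ^- 2).
    by have := @is_deriveV R id x 1 1 x1 _; rewrite /GRing.scale/= mulr1; apply.
  have dE : is_derive x 1 (fun y : R => expR (- y^-1)) (expR (- x^-1) * x ^- 2).
    have dN := is_deriveN dV; rewrite opprK in dN.
    exact: (is_derive_chain dN (is_derive_expR (- x^-1))).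
  have dX := is_deriveX n dV; rewrite exprfctE in dX.
  apply: (is_derive_eq (is_deriveM dX dE)).
  rewrite /flat x0 /GRing.scale/= /GRing.scale/=.
  case: n dX => [|n] _; first by rewrite !mul0r mulr0 addr0 subr0 expr0 mul1r exprVn mulrC.
  rewrite /= (_ : x ^- 2 = x^-1 ^+ 2) ?exprVn// !exprS.
  rewrite expr0 mulr1 !invfM; move: (expR (- x^-1)) (x^-1) ((x ^+ n)^-1) (n.+1%:R : R) => E y p m.
  by ring.
- rewrite x0 !flat_le0// mulr0 subr0.
  (* At 0 the difference quotient is [flat n.+1] itself, since flat_n(z) = z flat_(n+1)(z); its
     continuity at 0 comes from the linear bound [flat_bound]. *)
  apply/is_derive1_caratheodory; exists (flat n.+1); split.
  + move=> z; rewrite (flat_le0 n (lexx 0)) !subr0 /flat; case: ifP => z0; last by rewrite mul0r.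
    by rewrite exprS -!mulrA [expR _ * z]mulrC mulrCA [z^-1 * _]mulrA mulVf ?mul1r// gt_eqF.
  + rewrite /prop_for /continuous_at (flat_le0 n.+1 (lexx 0)).
    apply/norm_cvg0P.
    apply: (@squeeze_cvgr _ _ _ _ (fun=> 0) (fun z => n.+2%:R ^+ n.+2 * `|z|)).
    * by near=> z; rewrite normr_ge0/= flat_bound.
    * exact: cvg_cst.
    * have : (n.+2%:R ^+ n.+2 * `|z|) @[z --> (0 : R)] --> n.+2%:R ^+ n.+2 * `|0 : R|.
        by apply: cvgM; [exact: cvg_cst|exact: norm_continuous].
      by rewrite normr0 mulr0.
  + by rewrite flat_le0.
Unshelve. all: by end_near. Qed.

Lemma flat_le (x y : R) : x <= y -> flat 0 x <= flat 0 y.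
Proof.
move=> xy; have [x0|x0] := leP x 0; first by rewrite flat_le0 ?flat_ge0.
rewrite /flat x0 (lt_le_trans x0 xy) !expr0 !mul1r ler_expR lerN2 lef_pV2// posrE//.
exact: lt_le_trans xy.
Qed.

Lemma flat_gt0 (n : nat) (x : R) : 0 < x -> 0 < flat n x.
Proof. by move=> x0; rewrite /flat x0 mulr_gt0 ?expR_gt0// exprn_gt0// invr_gt0. Qed.

(* Smooth, constant on ]-oo, 0] and zero on [r, +oo[. *)
Definition step (r x : R) : R := flat 0 (flat 0 r - flat 0 x).

Definition step' (r x : R) : R := - (flat 2 (flat 0 r - flat 0 x) * flat 2 x).

Lemma is_derive_flat0 (x : R) : is_derive x 1 (flat 0) (flat 2 x).
Proof. by apply: (is_derive_eq (is_derive_flat 0 x)); rewrite mul0r subr0. Qed.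

Lemma is_derive_step (r x : R) : is_derive x 1 (step r) (step' r x).
Proof.
have h : is_derive x 1 (fun y => flat 0 r - flat 0 y) (- flat 2 x).
  have := is_deriveB (is_derive_cst (flat 0 r) x 1) (is_derive_flat0 x).
  by rewrite sub0r.
by apply: (is_derive_eq (is_derive_chain h (is_derive_flat0 _))); rewrite mulrN.
Qed.

Lemma step_le0 (r x : R) : x <= 0 -> step r x = step r 0.
Proof. by move=> x0; rewrite /step !(@flat_le0 0 x)// !(@flat_le0 0 0). Qed.

Lemma step_ge (r x : R) : r <= x -> step r x = 0.
Proof. by move=> rx; rewrite /step flat_le0// subr_le0 flat_le. Qed.

Lemma step0_gt0 (r : R) : 0 < r -> 0 < step r 0.
Proof. by move=> r0; rewrite /step (@flat_le0 0 0)// subr0 !flat_gt0. Qed.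

Lemma step'_npos (r x : R) : step' r x <= 0.
Proof. by rewrite oppr_le0 mulr_ge0 ?flat_ge0. Qed.

Lemma step'_le0 (r x : R) : x <= 0 -> step' r x = 0.
Proof. by move=> x0; rewrite /step' (@flat_le0 2 x)// mulr0 oppr0. Qed.

Lemma step'_ge (r x : R) : r <= x -> step' r x = 0.
Proof. by move=> rx; rewrite /step' flat_le0 ?mul0r ?oppr0// subr_le0 flat_le. Qed.

Lemma continuous_flat (n : nat) : continuous (flat n).
Proof.
move=> x; apply: differentiable_continuous; apply/derivable1_diffP.
by case: (is_derive_flat n x).
Qed.

Lemma continuous_step' (r : R) : continuous (step' r).
Proof.
move=> x; apply: cvgN; apply: cvgM; last exact: continuous_flat.
apply: (@continuous_comp _ _ _ (fun x => flat 0 r - flat 0 x) (flat 2)).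
  by apply: cvgB; [exact: cvg_cst|exact: continuous_flat].
exact: continuous_flat.
Qed.

End flat_function.

Lemma differentiable_linear (R : numFieldType) (V W : normedModType R) (f : V -> W) (x : V) :
  linear f -> continuous f -> differentiable f x.
Proof.
move=> lf cf; pose L : {linear V -> W} := HB.pack f (GRing.isLinear.Build _ _ _ _ f lf).
exact: (@linear_differentiable _ _ _ L x cf).
Qed.

Section smooth_expressions.
Variable R : realType.
Local Notation ST := (R * space3 R)%type.

Inductive prim : (R -> R) -> Prop :=
| prim_cos : prim (@cos R)
| prim_sin : prim (@sin R)
| prim_flat n : prim (flat n).

(** A class of expressions containing the test functions and stable under every directional
    derivative. Membership passes through arbitrary lists of derivatives, which is what [smooth]
    asks for. *)
Inductive smooth_expr : (ST -> R) -> Prop :=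
| expr_cst c : smooth_expr (fun=> c)
| expr_time : smooth_expr fst
| expr_coord k : smooth_expr (fun z => coord k z.2)
| expr_add f g : smooth_expr f -> smooth_expr g -> smooth_expr (fun z => f z + g z)
| expr_mul f g : smooth_expr f -> smooth_expr g -> smooth_expr (fun z => f z * g z)
| expr_comp g f : prim g -> smooth_expr f -> smooth_expr (fun z => g (f z)).

Lemma prim_derive g : prim g -> exists g1 g2 c1 c2, [/\ prim g1, prim g2 &
  forall x : R, is_derive x 1 g (c1 * g1 x + c2 * g2 x)].
Proof.
case=> [||n].
- exists (@sin R), (@sin R), (-1), 0; split; try exact: prim_sin.
  by move=> x; apply: (is_derive_eq (is_derive_cos x)); rewrite mul0r addr0 mulN1r.
- exists (@cos R), (@cos R), 1, 0; split; try exact: prim_cos.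
  by move=> x; apply: (is_derive_eq (is_derive_sin x)); rewrite mul0r addr0 mul1r.
- exists (flat n.+2), (flat n.+1), 1, (- n%:R); split; try exact: prim_flat.
  by move=> x; apply: (is_derive_eq (is_derive_flat n x)); rewrite mul1r mulNr.
Qed.

Lemma is_derive_linear (f : ST -> R) (z v : ST) : linear f -> is_derive z v f (f v).
Proof.
move=> lf; apply/is_derive_dirP.
have -> : (fun s : R => f (z + s *: v)) = cst (f z) + (f v \*: id).
  by apply/funext => s; rewrite addrC lf addrC /GRing.scale/= mulrC.
by apply: is_derive_eq; rewrite add0r /GRing.scale/= mulr1.
Qed.

Lemma linear_coord2 k : linear (fun z : ST => coord k z.2).
Proof. by move=> s x y; rewrite /= coordD coordZ. Qed.

Lemma smooth_expr_derive f : smooth_expr f -> forall z, differentiable f z /\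
  forall v, smooth_expr ('D_v f).
Proof.
elim=> {f} [c|//|k|f g sf ihf sg ihg|f g sf ihf sg ihg|g f pg sf ihf] z.
- split=> [|v]; first exact: differentiable_cst.
  rewrite (_ : 'D_v _ = fun=> 0); first exact: expr_cst.
  by apply/funext => y; exact: derive_cst.
- split=> [|v].
    by apply: differentiable_linear => // y; exact: cvg_fst.
  rewrite (_ : 'D_v _ = fun=> v.1); first exact: expr_cst.
  apply/funext => y; have h := @is_derive_linear fst y v (fun _ _ _ => erefl).
  exact: derive_val.
- split=> [|v].
    apply: differentiable_linear; first exact: linear_coord2.
    move=> y; apply: (@continuous_comp _ _ _ snd (coord k)); first exact: cvg_snd.
    exact: continuous_coord.
  rewrite (_ : 'D_v _ = fun=> coord k v.2); first exact: expr_cst.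
  apply/funext => y; have h := is_derive_linear y v (linear_coord2 k).
  exact: derive_val.
- split=> [|v]; first by apply: differentiableD; [case: (ihf z)|case: (ihg z)].
  rewrite (_ : 'D_v _ = fun y => 'D_v f y + 'D_v g y).
    by apply: expr_add; [case: (ihf z)|case: (ihg z)].
  apply/funext => y; apply: deriveD; apply: diff_derivable; [by case: (ihf y)|by case: (ihg y)].
- split=> [|v]; first by apply: differentiableM; [case: (ihf z)|case: (ihg z)].
  rewrite (_ : 'D_v _ = fun y => f y * 'D_v g y + g y * 'D_v f y).
    by apply: expr_add; apply: expr_mul => //; [case: (ihg z)|case: (ihf z)].
  apply/funext => y; apply: deriveM; apply: diff_derivable; [by case: (ihf y)|by case: (ihg y)].
- have [g1 [g2 [c1 [c2 [p1 p2 dg]]]]] := prim_derive pg.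
  split=> [|v].
    apply: (@differentiable_comp _ _ _ _ f g); first by case: (ihf z).
    by apply/derivable1_diffP; case: (dg (f z)).
  rewrite (_ : 'D_v _ = fun y => (c1 * g1 (f y) + c2 * g2 (f y)) * 'D_v f y).
    apply: expr_mul; last by case: (ihf z).
    by apply: expr_add; apply: expr_mul; (exact: expr_cst) || exact: expr_comp.
  apply/funext => y.
  have df : is_derive y v f ('D_v f y).
    by apply: DeriveDef => //; apply: diff_derivable; case: (ihf y).
  have h := is_derive_chain df (dg (f y)).
  exact: derive_val.
Qed.

Lemma smooth_expr_smooth f : smooth_expr f -> smooth f.
Proof.
move=> sf vs z; suff : smooth_expr (foldr (fun v psi => 'D_v psi) f vs).
  by move=> /smooth_expr_derive/(_ z)[].
by elim: vs => //= v vs /smooth_expr_derive/(_ z)[].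
Qed.

Lemma dt_product (g dg : R -> R) (P : space3 R -> R) (t : R) (x : space3 R) :
  (forall s : R, is_derive s 1 g (dg s)) ->
  dt (fun z : ST => g z.1 * P z.2) (t, x) = dg t * P x.
Proof.
move=> hg.
suff h : is_derive (t, x) ((1 : R), (0 : space3 R)) (fun z : ST => g z.1 * P z.2) (dg t * P x).
  exact: derive_val.
apply/is_derive_dirP.
have -> : (fun s : R => g ((t, x) + s *: ((1 : R), (0 : space3 R))).1 *
    P ((t, x) + s *: ((1 : R), (0 : space3 R))).2) = P x \*: (fun s : R => g (t + s *: 1)).
  by apply/funext => s; rewrite /= scaler0 addr0 mulrC.
have ht : is_derive (0 : R) 1 (fun s : R => g (t + s *: 1)) (dg t).
  exact: ((is_derive_dirP g t 1 (dg t)).1 (hg t)).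
by apply: (is_derive_eq (is_deriveZ (P x) ht)); rewrite /GRing.scale/= mulrC.
Qed.

Lemma dx_product k (g : R -> R) (P dP : space3 R -> R) (t : R) (x : space3 R) :
  (forall y, is_derive y (basis_vec R k) P (dP y)) ->
  dx k (fun z : ST => g z.1 * P z.2) (t, x) = g t * dP x.
Proof.
move=> hP.
suff h : is_derive (t, x) ((0 : R), basis_vec R k) (fun z : ST => g z.1 * P z.2) (g t * dP x).
  exact: derive_val.
apply/is_derive_dirP.
have -> : (fun s : R => g ((t, x) + s *: ((0 : R), basis_vec R k)).1 *
    P ((t, x) + s *: ((0 : R), basis_vec R k)).2) =
    g t \*: (fun s : R => P (x + s *: basis_vec R k)).
  by apply/funext => s; rewrite /= scaler0 addr0.
have hx : is_derive (0 : R) 1 (fun s : R => P (x + s *: basis_vec R k)) (dP x).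
  exact: ((is_derive_dirP P x (basis_vec R k) (dP x)).1 (hP x)).
exact: (is_deriveZ (g t) hx).
Qed.

End smooth_expressions.

Section fourier_test_functions.
Variables (R : realType) (a b : 'rV[R]_3).
Hypothesis hab : forall k : 'I_3, a 0 k < b 0 k.
Local Notation ST := (R * space3 R)%type.

(** A smooth plateau supported in [s, t + r]: it rises on [s, s + r], has height [step r 0] up to t
    when s + r <= t, and falls on [t, t + r]. *)
Definition window (r s t tau : R) : R := step r (tau - t) - step r (tau - s).
Definition window' (r s t tau : R) : R := step' r (tau - t) - step' r (tau - s).

Lemma is_derive_window (r s t tau : R) :
  is_derive tau 1 (window r s t) (window' r s t tau).
Proof.
have sh c : is_derive tau 1 (fun y : R => step r (y - c)) (step' r (tau - c)).
  have h : is_derive tau 1 (fun y : R => y - c) 1.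
    by have := is_deriveB (is_derive_id tau 1) (is_derive_cst c tau 1); rewrite subr0.
  by apply: (is_derive_eq (is_derive_chain h (is_derive_step r _))); rewrite mulr1.
exact: (is_deriveB (sh t) (sh s)).
Qed.

Lemma window_support (r s t tau : R) : s <= t -> ~ (s <= tau <= t + r) ->
  window r s t tau = 0.
Proof.
move=> st /negP; rewrite negb_and -!ltNge /window => /orP[h|h].
  by rewrite !step_le0 ?subrr// subr_le0 ltW// (lt_le_trans h).
by rewrite !step_ge ?subrr//; lra.
Qed.

Lemma continuous_window (r s t : R) : continuous (window r s t).
Proof.
move=> x; apply: differentiable_continuous; apply/derivable1_diffP.
by case: (is_derive_window r s t x).
Qed.

Lemma continuous_window' (r s t : R) : continuous (window' r s t).
Proof.
have sh c : continuous (fun y : R => step' r (y - c)).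
  move=> x; apply: (@continuous_comp _ _ _ (fun y : R => y - c) (step' r)).
    by apply: cvgB; [exact: cvg_id|exact: cvg_cst].
  exact: continuous_step'.
by move=> x; apply: cvgB; exact: sh.
Qed.

Definition fourier_test (r s t : R) (n : mode) (z : ST) : R :=
  window r s t z.1 * hartley a b n z.2.

Lemma fourier_test_smooth r s t n : smooth (fourier_test r s t n).
Proof.
apply: smooth_expr_smooth; apply: expr_mul.
  have sh c : smooth_expr (fun z : ST => step r (z.1 - c)).
    apply: (expr_comp (prim_flat R 0)); apply: expr_add; first exact: expr_cst.
    rewrite (_ : (fun z : ST => - flat 0 (z.1 - c)) = fun z => (-1) * flat 0 (z.1 - c)).
      apply: expr_mul; first exact: expr_cst.
      apply: (expr_comp (prim_flat R 0)); apply: expr_add; first exact: expr_time.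
      exact: expr_cst.
    by apply/funext => z; rewrite mulN1r.
  apply: expr_add; first exact: sh.
  rewrite (_ : (fun z : ST => - step r (z.1 - s)) = fun z => (-1) * step r (z.1 - s)).
    by apply: expr_mul; [exact: expr_cst|exact: sh].
  by apply/funext => z; rewrite mulN1r.
have ph : smooth_expr (fun z : ST => phase a b n z.2).
  rewrite (_ : (fun z : ST => phase a b n z.2) = fun z =>
    freq a b n 0 * coord 0 z.2 + freq a b n 1 * coord 1 z.2 +
    freq a b n (inord 2) * coord (inord 2) z.2).
    apply: expr_add; [apply: expr_add|];
      by apply: expr_mul; [exact: expr_cst|exact: expr_coord].
  by apply/funext => z; rewrite /phase sum3.
by apply: expr_add; [apply: (expr_comp (prim_cos R))|apply: (expr_comp (prim_sin R))].
Qed.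

Lemma fourier_testP (I : set R) r s t n : s <= t -> `[s, t + r] `<=` I° ->
  test_function I a b (fourier_test r s t n).
Proof.
move=> st sI; split.
- exact: fourier_test_smooth.
- by move=> tau k x; rewrite /fourier_test/= periodic_hartley.
- exists s, (t + r); split => // tau x h.
  by rewrite /fourier_test/= window_support// mul0r.
Qed.

Lemma dt_fourier_test r s t n tau x :
  dt (fourier_test r s t n) (tau, x) = window' r s t tau * hartley a b n x.
Proof. by apply: dt_product => y; exact: is_derive_window. Qed.

Lemma dx_fourier_test r s t n k tau x :
  dx k (fourier_test r s t n) (tau, x) =
  window r s t tau * (freq a b n k * hartley a b (- n) x).
Proof.
exact: (@dx_product _ k (window r s t) (hartley a b n)
  (fun y => freq a b n k * hartley a b (- n) y) tau x (is_derive_hartley a b n k)).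
Qed.

Lemma dxx_fourier_test r s t n k tau x :
  dx k (dx k (fourier_test r s t n)) (tau, x) =
  - (window r s t tau * (freq a b n k ^+ 2 * hartley a b n x)).
Proof.
have -> : dx k (fourier_test r s t n) = fun z : ST =>
    window r s t z.1 * (freq a b n k * hartley a b (- n) z.2).
  by apply/funext => -[tau' x']; rewrite dx_fourier_test.
pose dP y := - (freq a b n k ^+ 2 * hartley a b n y).
have h y : is_derive y (basis_vec R k) (fun x => freq a b n k * hartley a b (- n) x) (dP y).
  have h := is_deriveZ (freq a b n k) (is_derive_hartley a b (- n) k y).
  by apply: (is_derive_eq h); rewrite freqN opprK /GRing.scale/= /dP expr2; ring.
by rewrite (@dx_product _ k (window r s t) _ dP tau x h) /dP mulrN.
Qed.

End fourier_test_functions.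

(** * From weak to classical derivatives in time *)

Section du_bois_reymond.
Variable R : realType.
Local Notation mu := (@lebesgue_measure R).

Lemma FTC_closed (F f : R -> R) (a b : R) : a < b ->
  (forall x, a <= x <= b -> {for x, continuous f}) ->
  (forall x : R, a <= x <= b -> is_derive x 1 F (f x)) ->
  mu.-integrable `[a, b] (EFin \o f) /\ \int[mu]_(x in `[a, b]) f x = F b - F a.
Proof.
move=> ab cf dF.
have cfw : {within `[a, b], continuous f}.
  by apply: continuous_in_subspaceT => x; rewrite inE/= in_itv/=; exact: cf.
have cF x : a <= x <= b -> {for x, continuous F}.
  move=> xab; apply: differentiable_continuous; apply/derivable1_diffP.
  by case: (dF x xab).
split.
  by apply: continuous_compact_integrable => //; exact: segment_compact.
rewrite /Rintegral (@continuous_FTC2 _ f F)//.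
- split.
  + by move=> x; rewrite in_itv/= => /andP[? ?]; case: (dF x) => //; rewrite !ltW.
  + by apply: cvg_at_right_filter; apply: cF; rewrite lexx ltW.
  + by apply: cvg_at_left_filter; apply: cF; rewrite lexx ltW.
- move=> x; rewrite in_itv/= => /andP[ax xb]; rewrite derive1E.
  have h : is_derive x 1 F (f x) by apply: dF; rewrite !ltW.
  exact: derive_val.
Qed.

Lemma Rintegral_support (A B : set R) (f : R -> R) : B `<=` A ->
  (forall x, ~ B x -> f x = 0) -> \int[mu]_(x in A) f x = \int[mu]_(x in B) f x.
Proof.
move=> BA f0; rewrite [LHS]Rintegral_mkcond [RHS]Rintegral_mkcond.
apply: eq_Rintegral => x _; rewrite !patchE.
have [xB|xB] := boolP (x \in B).
  by rewrite mem_set//; apply: BA; exact/set_mem.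
by case: ifP => // _; apply: f0 => Bx; move/negP: xB; apply; exact/mem_set.
Qed.

Lemma window0_ends (r s t : R) : 0 < r -> s <= t ->
  window r s t s = 0 /\ window r s t (t + r) = 0.
Proof.
move=> r0 st.
have e1 : step r (t + r - s) = 0 by apply: step_ge; lra.
have e2 : step r (t + r - t) = 0 by apply: step_ge; lra.
have e3 : step r (s - t) = step r 0 by apply: step_le0; lra.
by rewrite /window e1 e2 e3 !subrr.
Qed.

Lemma window'_support (r s t tau : R) : 0 < r -> s <= t -> ~ (s <= tau <= t + r) ->
  window' r s t tau = 0.
Proof.
move=> r0 st /negP; rewrite negb_and -!ltNge /window' => /orP[h|h].
  have e1 : step' r (tau - t) = 0 by apply: step'_le0; lra.
  have e2 : step' r (tau - s) = 0 by apply: step'_le0; lra.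
  by rewrite e1 e2 subrr.
have e1 : step' r (tau - t) = 0 by apply: step'_ge; lra.
have e2 : step' r (tau - s) = 0 by apply: step'_ge; lra.
by rewrite e1 e2 subrr.
Qed.

Section weak_constant.
Variables (s0 e0 : R) (C : R -> R).
Hypothesis cC : forall x, s0 < x < e0 -> {for x, continuous C}.
Hypothesis C0 : forall r s t : R, 0 < r -> s0 < s -> s < t -> t + r < e0 ->
  \int[mu]_(x in `[s, (t + r)%R]) (C x * window' r s t x) = 0.

(* [window' r s t] is a nonnegative bump on [s, s + r] minus its translate on
   [t, t + r], so testing with it compares [C s] and [C t]. *)
Lemma weak_constant_le s t : s0 < s -> s < t -> t < e0 -> C t <= C s.
Proof.
move=> ss st te; rewrite leNgt; apply/negP => Cst.
(* [m] is the midpoint of the assumed gap and [eta] a quarter of it, so C < m - eta near s and C > m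
   + eta near t. *)
pose m := (C s + C t) / 2; pose eta := (C t - C s) / 4.
have eta0 : 0 < eta by rewrite divr_gt0// subr_gt0.
have cs : C x @[x --> s] --> C s by apply: cC; rewrite ss (lt_trans st).
have ct : C x @[x --> t] --> C t by apply: cC; rewrite te (lt_trans ss).
have ns : \forall x \near s, C x < m - eta.
  by apply: (cvgr_lt _ cs); rewrite /m /eta; lra.
have nt : \forall x \near t, m + eta < C x.
  by apply: (cvgr_gt _ ct); rewrite /m /eta; lra.
move/nbhs_ballP : ns => [r1 /= r10 h1]; move/nbhs_ballP : nt => [r2 /= r20 h2].
pose r : R := Num.min (Num.min r1 r2) (Num.min (t - s) (e0 - t)) / 2.
have r0 : 0 < r by rewrite divr_gt0// !lt_min r10 r20 !subr_gt0 st te.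
have [rr1 rr2 rr3 rr4] : [/\ r < r1, r < r2, r < t - s & r < e0 - t].
  have h : r < Num.min (Num.min r1 r2) (Num.min (t - s) (e0 - t)).
    by rewrite ltr_pdivrMr// ltr_pMr ?ltr1n// !lt_min r10 r20 !subr_gt0 st te.
  by move: h; rewrite !lt_min => /andP[/andP[? ?] /andP[? ?]].
clearbody r.
have tr : t + r < e0 by lra.
have str : s < t + r by lra.
pose S x := step r (x - s) + step r (x - t).
pose S' x := step' r (x - s) + step' r (x - t).
have inn (x : R) : s <= x <= t + r -> s0 < x < e0.
  by move=> /andP[? ?]; apply/andP; split; lra.
have hs (x : R) : s <= x <= s + r -> C x < m - eta.
  by move=> /andP[? ?]; apply: h1; rewrite /ball/= ltr_norml; apply/andP; split; lra.
have ht (x : R) : t <= x <= t + r -> m + eta < C x.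
  by move=> /andP[? ?]; apply: h2; rewrite /ball/= ltr_norml; apply/andP; split; lra.
(* [S'] is nonpositive and equals -|window'|, since r < t - s keeps the two bumps apart. After
   integration the left side is 0, because both C and constants are orthogonal to window', while the
   right side is -2 eta [step r 0] < 0. *)
have key (x : R) : s <= x <= t + r -> (C x - m) * window' r s t x <= eta * S' x.
  move=> /andP[sx xt]; rewrite /window' /S'.
  have [xsr|xsr] := leP x (s + r).
    rewrite (@step'_le0 _ r (x - t)); last by lra.
    have := hs x; rewrite sx xsr => /(_ isT) hC.
    by have := step'_npos r (x - s); nra.
  rewrite (@step'_ge _ r (x - s)); last by lra.
  have [xt'|xt'] := ltP x t.
    by rewrite (@step'_le0 _ r (x - t)) ?subrr ?addr0 ?mulr0//; lra.
  have := ht x; rewrite xt' xt => /(_ isT) hC.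
  by have := step'_npos r (x - t); nra.
have SE : S (t + r) - S s = - (step r 0 *+ 2).
  have e1 : step r (t + r - s) = 0 by apply: step_ge; lra.
  have e2 : step r (t + r - t) = 0 by apply: step_ge; lra.
  have e3 : step r (s - t) = step r 0 by apply: step_le0; lra.
  by rewrite /S e1 e2 e3 subrr addr0 sub0r mulr2n.
have dsh c (x : R) : is_derive x 1 (fun y : R => step r (y - c)) (step' r (x - c)).
  have h : is_derive x 1 (fun y : R => y - c) 1.
    by have := is_deriveB (is_derive_id x 1) (is_derive_cst c x 1); rewrite subr0.
  by apply: (is_derive_eq (is_derive_chain h (is_derive_step r _))); rewrite mulr1.
have csh c : continuous (fun y : R => step' r (y - c)).
  move=> x; apply: (@continuous_comp _ _ _ (fun y : R => y - c) (step' r)).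
    by apply: cvgB; [exact: cvg_id|exact: cvg_cst].
  exact: continuous_step'.
have [iS iSE] := @FTC_closed S S' s (t + r) str
  (fun x _ => cvgD (@csh s x) (@csh t x)) (fun x _ => is_deriveD (dsh s x) (dsh t x)).
have [iw iwE] := @FTC_closed (window r s t) (window' r s t) s (t + r) str
  (fun x _ => @continuous_window' _ r s t x) (fun x _ => is_derive_window r s t x).
have [w0 w1] := window0_ends r0 (ltW st).
rewrite w0 w1 subrr in iwE.
have cCw : {within `[s, t + r], continuous (fun x => C x * window' r s t x)}.
  apply: continuous_in_subspaceT => x; rewrite inE/= in_itv/= => xst.
  apply: cvgM; last exact: continuous_window'.
  by apply: cC; exact: inn.
have iC : mu.-integrable `[s, (t + r)%R] (EFin \o (fun x => C x * window' r s t x)).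
  by apply: continuous_compact_integrable => //; exact: segment_compact.
have imw : mu.-integrable `[s, (t + r)%R] (EFin \o (fun x => m * window' r s t x)).
  exact: (integrableZl _ m iw).
have ieS : mu.-integrable `[s, (t + r)%R] (EFin \o (fun x => eta * S' x)).
  exact: (integrableZl _ eta iS).
have : \int[mu]_(x in `[s, (t + r)%R]) (C x * window' r s t x - m * window' r s t x) <=
    \int[mu]_(x in `[s, (t + r)%R]) (eta * S' x).
  apply: le_Rintegral => //; first exact: (integrableB _ iC imw).
  by move=> x /=; rewrite in_itv/= => xst; rewrite -mulrBl; exact: key.
rewrite RintegralB// C0// !RintegralZl// iwE iSE SE mulr0 subrr mulrN oppr_ge0.
by apply/negP; rewrite -ltNge mulr_gt0// mulrn_wgt0// step0_gt0.
Qed.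

End weak_constant.

(** Integration by parts against a primitive [D] of [d] shows that c - D is orthogonal to every
    window'. Then [weak_constant_le], applied to c - D and to its opposite, makes it constant near
    the given time. *)
Lemma weak_derivative (I : set R) (c d : R -> R) :
  (forall x, I° x -> {for x, continuous c}) -> (forall x, I° x -> {for x, continuous d}) ->
  (forall r s t : R, 0 < r -> s <= t -> `[s, t + r] `<=` I° ->
    \int[mu]_(x in I) (c x * window' r s t x + d x * window r s t x) = 0) ->
  forall t : R, I° t -> is_derive t 1 c (d t).
Proof.
move=> cc cd W t0 It0.
have /nbhs_ballP[e /= e0 eI] : nbhs t0 I° by apply: open_nbhs_nbhs; split=> //; exact: open_interior.
pose s0 := t0 - e / 2; pose e1 := t0 + e / 2.
have se : s0 < t0 /\ t0 < e1 by rewrite /s0 /e1; split; lra.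
have inI (x : R) : s0 <= x <= e1 -> I° x.
  rewrite /s0 /e1 => /andP[? ?]; apply: eI; rewrite /ball/= ltr_norml.
  by apply/andP; split; lra.
clearbody s0 e1; move: se => [st0 te1].
pose D x := \int[mu]_(y in `[s0, x]) d y.
have id_ : mu.-integrable `[s0, e1] (EFin \o d).
  apply: continuous_compact_integrable; first exact: segment_compact.
  by apply: continuous_in_subspaceT => x; rewrite inE/= in_itv/= => h; apply: cd; exact: inI.
have dD (x : R) : s0 < x < e1 -> is_derive x 1 D (d x).
  move=> /andP[sx xe]; have cdx : {for x, continuous d} by apply: cd; apply: inI; rewrite !ltW.
  have [h1 h2] := continuous_FTC1_closed xe id_ sx cdx.
  by split; [exact: h1|rewrite -derive1E; exact: h2].
have cD (x : R) : s0 < x < e1 -> {for x, continuous D}.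
  move=> h; apply: differentiable_continuous; apply/derivable1_diffP.
  by case: (dD x h).
have inI' (x : R) : s0 < x < e1 -> I° x by move=> /andP[? ?]; apply: inI; rewrite !ltW.
have C0 (r s t : R) : 0 < r -> s0 < s -> s < t -> t + r < e1 ->
    \int[mu]_(x in `[s, (t + r)%R]) ((c x - D x) * window' r s t x) = 0.
  move=> r0 ss st te.
  have str : s < t + r by lra.
  have inn (x : R) : s <= x <= t + r -> s0 < x < e1.
    by move=> /andP[? ?]; apply/andP; split; lra.
  have subI : `[s, t + r] `<=` I°.
    by move=> x /=; rewrite in_itv/= => h; apply: inI'; exact: inn.
  have := W r s t r0 (ltW st) subI.
  rewrite (@Rintegral_support _ `[s, (t + r)%R]%classic); last 2 first.
  - by move=> x /subI; exact: interior_subset.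
  - move=> x; rewrite /= in_itv/= => h.
    by rewrite (window_support (ltW st) h) (window'_support r0 (ltW st) h) !mulr0 addr0.
  have cwk (f : R -> R) g : (forall x : R, s <= x <= t + r -> {for x, continuous f}) ->
      continuous g -> mu.-integrable `[s, (t + r)%R] (EFin \o (fun x => f x * g x)).
    move=> cf cg; apply: continuous_compact_integrable; first exact: segment_compact.
    apply: continuous_in_subspaceT => x; rewrite inE/= in_itv/= => h.
    by apply: cvgM; [exact: cf|exact: cg].
  have icw : mu.-integrable `[s, (t + r)%R] (EFin \o (fun x => c x * window' r s t x)).
    by apply: cwk; [move=> x /inn/inI'; exact: cc|exact: continuous_window'].
  have idw : mu.-integrable `[s, (t + r)%R] (EFin \o (fun x => d x * window r s t x)).
    by apply: cwk; [move=> x /inn/inI'; exact: cd|exact: continuous_window].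
  have iDw : mu.-integrable `[s, (t + r)%R] (EFin \o (fun x => D x * window' r s t x)).
    by apply: cwk; [move=> x /inn; exact: cD|exact: continuous_window'].
  rewrite RintegralD// => W0.
  have [|x xst|_] := @FTC_closed (fun x => D x * window r s t x)
      (fun x => D x * window' r s t x + window r s t x * d x) s (t + r) str.
  - move=> x xst; apply: cvgD; apply: cvgM.
    + by apply: cD; exact: inn.
    + exact: continuous_window'.
    + exact: continuous_window.
    + by apply: cd; apply: inI'; exact: inn.
  - by apply: (is_derive_eq (is_deriveM (dD x (inn x xst)) (is_derive_window r s t x))).
  have [w0 w1] := window0_ends r0 (ltW st).
  rewrite w0 w1 !mulr0 subrr.
  under eq_Rintegral do rewrite [X in _ + X]mulrC.
  rewrite RintegralD// => D0.
  under eq_Rintegral do rewrite mulrBl.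
  rewrite RintegralB//; move/eqP: D0; rewrite addr_eq0 => /eqP ->.
  by rewrite opprK.
have cC (x : R) : s0 < x < e1 -> {for x, continuous (fun x => c x - D x)}.
  by move=> h; apply: cvgB; [apply: cc; exact: inI'|exact: cD].
have C0N (r s t : R) : 0 < r -> s0 < s -> s < t -> t + r < e1 ->
    \int[mu]_(x in `[s, (t + r)%R]) (- (c x - D x) * window' r s t x) = 0.
  move=> r0 ss st te.
  have <- : -1 * \int[mu]_(x in `[s, (t + r)%R]) ((c x - D x) * window' r s t x) = 0.
    by rewrite C0// mulr0.
  rewrite -RintegralZl//; first by apply: eq_Rintegral => x _; rewrite mulN1r mulNr.
  apply: continuous_compact_integrable; first exact: segment_compact.
  apply: continuous_in_subspaceT => x; rewrite inE/= in_itv/= => /andP[h1 h2].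
  apply: cvgM; last exact: continuous_window'.
  by apply: cC; rewrite (lt_le_trans ss)//= (le_lt_trans h2).
have cst (s t : R) : s0 < s -> s < t -> t < e1 -> c t - D t = c s - D s.
  move=> ss st te; apply/eqP; rewrite eq_le; apply/andP; split.
    exact: (weak_constant_le cC C0 ss st te).
  have cN (x : R) : s0 < x < e1 -> {for x, continuous (fun x => - (c x - D x))}.
    by move=> h; apply: cvgN; exact: cC.
  have := weak_constant_le cN C0N ss st te.
  by rewrite lerN2.
have cst' (x : R) : s0 < x < e1 -> c x = D x + (c t0 - D t0).
  move=> /andP[sx xe]; have [xt|xt|->] := ltgtP x t0.
  - by rewrite (cst x t0)// addrC subrK.
  - by rewrite -(cst t0 x)// addrC subrK.
  - by rewrite addrC subrK.
apply: (@near_eq_is_derive R R R (fun x => D x + (c t0 - D t0))).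
  near=> x; rewrite -cst'//; apply/andP; split; near: x.
    exact: lt_nbhsr.
  exact: lt_nbhsl.
have h : is_derive t0 1 D (d t0) by apply: dD; rewrite st0.
by have := is_deriveD h (is_derive_cst (c t0 - D t0) t0 1); rewrite addr0.
Unshelve. all: by end_near. Qed.

End du_bois_reymond.

(** * Evolution of the coefficients *)

Lemma continuous_bigsum (R : realType) (J : Type) (s : seq J) (g : J -> R -> R) (x : R) :
  (forall i, {for x, continuous (g i)}) ->
  {for x, continuous (fun t => \sum_(i <- s) g i t)}.
Proof.
move=> cg; elim: s => [|i s ih].
  rewrite (_ : (fun t => _) = fun=> 0); first exact: cst_continuous.
  by apply/funext => t; rewrite big_nil.
rewrite (_ : (fun t => _) = fun t => g i t + \sum_(i <- s) g i t).
  by apply: cvgD; [exact: cg|exact: ih].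
by apply/funext => t; rewrite big_cons.
Qed.

Section coefficients_in_time.
Variables (R : realType) (a b : 'rV[R]_3).
Hypothesis hab : forall k : 'I_3, a 0 k < b 0 k.
Variable I : set R.
Local Notation C n g := (coef a b n g).
Local Notation ig g := ((leb3 R).-integrable (cell a b) (EFin \o g)).
Let mc : measurable (cell a b : set (mspace3 R)).
Proof. exact: measurable_cell. Qed.

Lemma in_L1loc_cell g : in_L1loc (cell a b) g -> ig g.
Proof. by apply => //; exact: compact_cell. Qed.

Lemma integrable_cellD (g h : space3 R -> R) : ig g -> ig h -> ig (fun x => g x + h x).
Proof. by move=> gi hi; exact: (integrableD mc gi hi). Qed.

Lemma integrable_cellB (g h : space3 R -> R) : ig g -> ig h -> ig (fun x => g x - h x).
Proof. by move=> gi hi; exact: (integrableB mc gi hi). Qed.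

Lemma integrable_cellZ c (g : space3 R -> R) : ig g -> ig (fun x => c * g x).
Proof. by move=> gi; exact: (integrableZl mc c gi). Qed.

Lemma mode_coefZ n c g : ig g -> C n (fun x => c * g x) = c * C n g.
Proof.
move=> gi; rewrite /coef; under eq_Rintegral do rewrite -mulrA.
by rewrite RintegralZl//; exact: integrable_hartley.
Qed.

Lemma mode_coefB n g h : ig g -> ig h -> C n (fun x => g x - h x) = C n g - C n h.
Proof.
move=> gi hi; rewrite /coef; under eq_Rintegral do rewrite mulrBl.
by rewrite RintegralB//; exact: integrable_hartley.
Qed.

Lemma mode_coef_sum (J : Type) (s : seq J) (f : J -> space3 R -> R) n : (forall i, ig (f i)) ->
  C n (fun x => \sum_(i <- s) f i x) = \sum_(i <- s) C n (f i).
Proof.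
move=> fi; rewrite /coef; under eq_Rintegral do rewrite mulr_suml.
by rewrite Rintegral_cell_sum// => i; exact: integrable_hartley.
Qed.

Lemma coef_le_L1 n g : ig g -> `|C n g| <= 2 * \int[leb3 R]_(x in cell a b) `|g x|.
Proof.
move=> gi.
have gni : ig (fun x => `|g x|) by exact: (integrable_norm gi).
have h1 : `|C n g| <= \int[leb3 R]_(x in cell a b) `|g x * hartley a b n x|.
  by apply: le_normr_Rintegral => //; exact: integrable_hartley.
apply: (le_trans h1).
rewrite -RintegralZl//; apply: le_Rintegral => //.
- by apply: integrable_norm; exact: integrable_hartley.
- exact: (integrableZl mc 2 gni).
- by move=> x _; rewrite normrM mulrC ler_wpM2r// hartley_bound.
Qed.

Lemma L1dist_cell g h : ig g -> ig h ->
  L1dist (cell a b) g h = (\int[leb3 R]_(x in cell a b) `|g x - h x|)%:E.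
Proof.
move=> gi hi; rewrite /L1dist /Rintegral fineK//.
have gh : ig (fun x => g x - h x) by exact: (integrableB mc gi hi).
exact: (integrable_fin_num mc (integrable_norm gh)).
Qed.

Lemma coef_continuous (g : R -> space3 R -> R) n t : in_C_L1loc I (cell a b) g -> I t ->
  C n (g s) @[s --> within I (nbhs t)] --> C n (g t).
Proof.
move=> [gL gC] It.
have gi s : I s -> ig (g s) by move=> /gL; exact: in_L1loc_cell.
have h0 : L1dist (cell a b) (g s) (g t) @[s --> within I (nbhs t)] --> 0%E.
  by apply: gC => //; exact: compact_cell.
have h1 : fine (L1dist (cell a b) (g s) (g t)) @[s --> within I (nbhs t)] --> 0.
  exact: (fine_cvg h0).
apply/cvgrPdist_le => e e0.
have /cvgrPdist_le/(_ (e / 2)) := h1.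
rewrite divr_gt0// => /(_ isT); rewrite !near_withinE => h2.
apply: filterS h2 => s h2 Is; have := h2 Is; rewrite L1dist_cell ?gi//= sub0r normrN => {}h2.
rewrite -mode_coefB ?gi// (le_trans (coef_le_L1 _ _))//.
  by apply: integrable_cellB; exact: gi.
rewrite mulrC -ler_pdivlMr// (le_trans _ h2)// ger0_norm ?Rintegral_ge0//.
apply: le_Rintegral => //.
- by apply: integrable_norm; apply: integrable_cellB; exact: gi.
- by apply: integrable_norm; apply: integrable_cellB; exact: gi.
- by move=> x _; rewrite distrC.
Qed.

Lemma coef_continuous_interior (g : R -> space3 R -> R) n t :
  in_C_L1loc I (cell a b) g -> I° t -> {for t, continuous (fun s => C n (g s))}.
Proof.
move=> gC It; have := @coef_continuous g n t gC (interior_subset It).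
by rewrite within_interior.
Qed.

(** The symbol of u.grad, which maps H_n to [advection u n] times H_(-n). The next definition is the
    symbol of minus the Laplacian, which is diagonal. *)
Definition advection (u : 'rV[R]_3) (n : mode) : R := \sum_(k < 3) u 0 k * freq a b n k.
Definition laplace_symbol (n : mode) : R := \sum_(k < 3) freq a b n k ^+ 2.

(** The common shape of both weak equations tested against a window times H_n: a time derivative, a
    first-order term at index -n and a zero- or second-order term. *)
Lemma integral_three (g1 g2 g3 : space3 R -> R) n1 n2 n3 (c1 c2 c3 : R) :
  ig g1 -> ig g2 -> ig g3 ->
  \int[leb3 R]_(x in cell a b) (c1 * (g1 x * hartley a b n1 x) +
     c2 * (g2 x * hartley a b n2 x) + c3 * (g3 x * hartley a b n3 x)) =
  c1 * C n1 g1 + c2 * C n2 g2 + c3 * C n3 g3.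
Proof.
move=> i1 i2 i3.
have h g n : ig g -> ig (fun x => g x * hartley a b n x) by exact: integrable_hartley.
have hz c g n : ig g -> ig (fun x => c * (g x * hartley a b n x)).
  by move=> gi; apply: integrable_cellZ; exact: h.
rewrite RintegralD//; [|by apply: integrable_cellD; exact: hz|exact: hz].
rewrite RintegralD//; [|exact: hz|exact: hz].
by rewrite !RintegralZl//; exact: h.
Qed.

Lemma ade_mode (mu : R) (u : 'rV[R]_3) (rho0 : space3 R -> R) (rho : R -> space3 R -> R) n :
  ade_solution I a b mu u rho0 rho -> forall t : R, I° t ->
  is_derive t 1 (fun s => C n (rho s))
    (advection u n * C (- n) (rho t) - mu * laplace_symbol n * C n (rho t)).
Proof.
move=> [_ rhoC _ weak].
have ri t : I t -> ig (rho t) by move=> It; apply: in_L1loc_cell; case: rhoC => + _; apply.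
pose d t := advection u n * C (- n) (rho t) - mu * laplace_symbol n * C n (rho t).
apply: (@weak_derivative _ I _ d) => [x Ix|x Ix|r s t r0 st stI].
- exact: coef_continuous_interior.
- have h m c : {for x, continuous (fun t => c * C m (rho t))}.
    by apply: cvgM; [exact: cvg_cst|exact: coef_continuous_interior].
  by apply: cvgB; exact: h.
rewrite -[RHS](weak _ (fourier_testP hab n st stI)) /st_integral.
apply: eq_Rintegral => tau; rewrite inE => Itau.
transitivity (window' r s t tau * C n (rho tau) +
  (window r s t tau * advection u n) * C (- n) (rho tau) +
  (- (window r s t tau * (mu * laplace_symbol n))) * C n (rho tau)).
  by rewrite /d; ring.
rewrite -integral_three ?ri//; apply: eq_Rintegral => x _.
rewrite dt_fourier_test /advection /laplace_symbol !sum3 !dx_fourier_test !dxx_fourier_test.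
by ring.
Qed.

Lemma equilibrium_linear lam theta u eps eta j :
  equilibrium lam theta u eps eta j 0 = equilibrium lam theta u eps 1 j 0 * eta :> R.
Proof. by rewrite !mxE; case: ifP => _; ring. Qed.

(** The symbol of the transport operator of component [j]; it is of order 1/eps. *)
Definition mode_speed (lam eps : R) (n : mode) (j : 'I_7) : R :=
  \sum_(k < 3) velocity lam eps j 0 k * freq a b n k.

Lemma dvbe_mode (lam theta : R) (u : 'rV[R]_3) (eps : R) (rho0 : space3 R -> R)
    (f : R -> space3 R -> 'cV[R]_7) n j :
  dvbe_solution I a b lam theta u 1 2 eps rho0 f -> forall t : R, I° t ->
  is_derive t 1 (fun s => C n (fun x => f s x j 0))
    (mode_speed lam eps n j * C (- n) (fun x => f t x j 0) -
     eps ^- 2 * (C n (fun x => f t x j 0) - equilibrium lam theta u eps 1 j 0 *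
       \sum_i C n (fun x => f t x i 0))).
Proof.
move=> [_ fC _ weak].
have fi i t : I t -> ig (fun x => f t x i 0).
  by move=> It; apply: in_L1loc_cell; case: (fC i) => + _; apply.
pose m := equilibrium lam theta u eps 1 j 0.
pose d t := mode_speed lam eps n j * C (- n) (fun x => f t x j 0) -
     eps ^- 2 * (C n (fun x => f t x j 0) - m * \sum_i C n (fun x => f t x i 0)).
have cC i l x : I° x -> {for x, continuous (fun t => C l (fun y => f t y i 0))}.
  by move=> Ix; exact: (@coef_continuous_interior (fun t y => f t y i 0) l x (fC i) Ix).
apply: (@weak_derivative _ I _ d) => [x Ix|x Ix|r s t r0 st stI].
- exact: cC.
- apply: cvgB; first by apply: cvgM; [exact: cvg_cst|exact: cC].
  apply: cvgM; first exact: cvg_cst.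
  apply: cvgB; first exact: cC.
  apply: cvgM; first exact: cvg_cst.
  by apply: continuous_bigsum => i; exact: cC.
rewrite -[RHS](weak j _ (fourier_testP hab n st stI)) /st_integral.
apply: eq_Rintegral => tau; rewrite inE => Itau.
have sumi : ig (fun x => \sum_i f tau x i 0) by apply: integrable_cell_sum => // i; exact: fi.
transitivity ((window' r s t tau - window r s t tau * eps ^- 2) * C n (fun x => f tau x j 0) +
  (window r s t tau * mode_speed lam eps n j) * C (- n) (fun x => f tau x j 0) +
  (window r s t tau * eps ^- 2 * m) * C n (fun x => \sum_i f tau x i 0)).
  by rewrite /d mode_coef_sum => [|i]; [ring|exact: fi].
rewrite -integral_three ?fi//; apply: eq_Rintegral => x _.
rewrite dt_fourier_test.
have -> : \sum_(k < 3) (Smat lam eps k *m f tau x) j 0 *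
    dx k (fourier_test a b r s t n) (tau, x) =
    window r s t tau * mode_speed lam eps n j * (f tau x j 0 * hartley a b (- n) x).
  rewrite /mode_speed mulr_sumr mulr_suml; apply: eq_bigr => k _.
  by rewrite dx_fourier_test /Smat mul_diag_mx !mxE; ring.
have -> : (f tau x - feq lam theta u eps (f tau x)) j 0 =
    f tau x j 0 - m * \sum_i f tau x i 0.
  by rewrite mxE [X in _ + X]mxE /feq equilibrium_linear.
by rewrite /fourier_test/= mulr1 mul1r; ring.
Qed.

End coefficients_in_time.

(** * The kinetic system of a single mode *)

Lemma is_derive_bigsum (R : realType) (J : Type) (s : seq J) (g dg : J -> R -> R) (x : R) :
  (forall i, is_derive x 1 (g i) (dg i x)) ->
  is_derive x 1 (fun t => \sum_(i <- s) g i t) (\sum_(i <- s) dg i x).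
Proof.
move=> h; elim: s => [|i s ih].
  rewrite big_nil (_ : (fun t => _) = fun=> 0); first exact: is_derive_cst.
  by apply/funext => t; rewrite big_nil.
rewrite big_cons (_ : (fun t => _) = fun t => g i t + \sum_(i <- s) g i t).
  exact: is_deriveD.
by apply/funext => t; rewrite big_cons.
Qed.

Lemma within_bigsum (R : realType) (J : Type) (s : seq J) (A : set R) (g : J -> R -> R) :
  (forall i, {within A, continuous (g i)}) ->
  {within A, continuous (fun t => \sum_(i <- s) g i t)}.
Proof.
move=> cg; elim: s => [|i s ih].
  rewrite (_ : (fun t => _) = fun=> 0); first by move=> x; exact: cst_continuous.
  by apply/funext => t; rewrite big_nil.
rewrite (_ : (fun t => _) = fun t => g i t + \sum_(i <- s) g i t).
  by move=> x; apply: cvgD; [exact: cg|exact: ih].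
by apply/funext => t; rewrite big_cons.
Qed.

Lemma is_derive_sqr (R : realType) (f : R -> R) (x df : R) :
  is_derive x 1 f df -> is_derive x 1 (fun t => f t ^+ 2) (2 * f x * df).
Proof.
move=> h; have := is_deriveM h h; congr is_derive.
by rewrite /GRing.scale/= -mulrDl mulr_natl mulr2n mulrDl.
Qed.

Section gronwall.
Variables (R : realType) (T : R).
Hypothesis T0 : 0 < T.

Lemma nonincreasing_endpoints (Z dZ : R -> R) : {within `[0, T], continuous Z} ->
  (forall t, 0 < t < T -> is_derive t 1 Z (dZ t)) ->
  (forall t, 0 < t < T -> dZ t <= 0) -> Z T <= Z 0.
Proof.
move=> cZ derZ dZ0.
have der (x : R) : x \in `]0, T[ -> is_derive x 1 Z (dZ x) by rewrite in_itv/=; exact: derZ.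
have [c cT E] := MVT T0 der cZ.
rewrite -subr_le0 E subr0 pmulr_lle0//; apply: dZ0.
by move: cT; rewrite in_itv.
Qed.

(** Adding the constant L/K makes the inequality homogeneous, and the integrating factor exp(-K t)
    then makes the result nonincreasing. *)
Lemma gronwall (Y dY : R -> R) (K L : R) : 0 < K -> {within `[0, T], continuous Y} ->
  (forall t, 0 < t < T -> is_derive t 1 Y (dY t)) ->
  (forall t, 0 < t < T -> dY t <= K * Y t + L) ->
  Y T + L / K <= expR (K * T) * (Y 0 + L / K).
Proof.
move=> K0 cY derY dYle.
pose Z t := expR (- K * t) * (Y t + L / K).
pose dZ t := expR (- K * t) * (dY t - K * Y t - L).
have derE (t : R) : is_derive t 1 (fun t : R => expR (- K * t)) (expR (- K * t) * - K).
  have h : is_derive t 1 (fun t : R => - K * t) (- K).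
    have := is_deriveZ (- K) (is_derive_id t 1).
    by rewrite /GRing.scale/= mulr1.
  exact: (is_derive_chain h (is_derive_expR _)).
have : Z T <= Z 0.
  apply: (@nonincreasing_endpoints Z dZ).
  - move=> x; apply: cvgM; last by apply: cvgD; [exact: cY|exact: cvg_cst].
    have cE : continuous (fun t : R => expR (- K * t)).
      move=> t; apply: differentiable_continuous; apply/derivable1_diffP.
      by case: (derE t).
    exact: (continuous_subspaceT cE).
  - move=> t tT; have dy : is_derive t 1 (fun t => Y t + L / K) (dY t).
      by have := is_deriveD (derY t tT) (is_derive_cst (L / K) t 1); rewrite addr0.
    apply: (is_derive_eq (is_deriveM (derE t) dy)).
    by rewrite /GRing.scale/= /dZ; field; rewrite gt_eqF.
  - move=> t tT; rewrite /dZ pmulr_rle0 ?expR_gt0//.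
    by have := dYle t tT; lra.
rewrite /Z mulr0 expR0 mul1r mulNr expRN mulrC ler_pdivrMr ?expR_gt0//.
by rewrite [leRHS]mulrC.
Qed.

End gronwall.

(** * Energy bounds for the coefficients of indices n and -n, written [p] and [q] *)

Section kinetic_modes.
Variables (R : realType) (p q : 'I_7 -> R -> R) (be m : 'I_7 -> R) (s : R) (T1 : R).
Local Notation P t := (\sum_i p i t).
Local Notation Q t := (\sum_i q i t).
Hypotheses (cp : forall j, {within `[0, T1], continuous (p j)})
  (cq : forall j, {within `[0, T1], continuous (q j)}).
Let dp j t := be j * q j t - s * (p j t - m j * P t).
Let dq j t := - be j * p j t - s * (q j t - m j * Q t).
Hypotheses (derp : forall j t, 0 < t < T1 -> is_derive t 1 (p j) (dp j t))
  (derq : forall j t, 0 < t < T1 -> is_derive t 1 (q j) (dq j t)).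
Hypothesis s0 : 0 <= s.
Variables P0 Q0 : R.
Hypotheses (p0 : forall j, p j 0 = m j * P0) (q0 : forall j, q j 0 = m j * Q0).

Let derE j t : 0 < t < T1 -> is_derive t 1 (fun t => p j t ^+ 2 + q j t ^+ 2)
   (2 * p j t * dp j t + 2 * q j t * dq j t).
Proof.
move=> tT; apply: is_deriveD; apply: is_derive_sqr; [exact: derp|exact: derq].
Qed.

Let cE j : {within `[0, T1], continuous (fun t => p j t ^+ 2 + q j t ^+ 2)}.
Proof.
by move=> x; apply: cvgD; apply: cvgM; (exact: cp) || exact: cq.
Qed.

Let sub01 (T : R) : T <= T1 -> `[0, T]%classic `<=` `[0, T1]%classic.
Proof.
by move=> TT1 x /=; rewrite !in_itv/= => /andP[-> xT]; exact: le_trans TT1.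
Qed.

(** With zero weight the pair (p_j, q_j) no longer sees the density: transport rotates it,
    relaxation damps it, and it starts at 0. *)
Lemma zero_weight_mode j T : 0 <= T <= T1 -> m j = 0 -> p j T = 0 /\ q j T = 0.
Proof.
move=> /andP[]; rewrite le_eqVlt => /orP[/eqP <- _ mj|T0 TT1 mj].
  by rewrite p0 q0 mj !mul0r.
have : p j T ^+ 2 + q j T ^+ 2 <= p j 0 ^+ 2 + q j 0 ^+ 2.
  apply: (@nonincreasing_endpoints R T T0 (fun t => p j t ^+ 2 + q j t ^+ 2)
    (fun t => 2 * p j t * dp j t + 2 * q j t * dq j t)).
    exact: (continuous_subspaceW (sub01 TT1) (@cE j)).
    by move=> t /andP[t0 tT]; apply: derE; rewrite t0 (lt_le_trans tT).
  move=> t _ /=; rewrite /dp /dq mj !mul0r !subr0.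
  rewrite (_ : _ + _ = - (2 * s * (p j t ^+ 2 + q j t ^+ 2))); last by ring.
  by rewrite oppr_le0 mulr_ge0 ?mulr_ge0// addr_ge0// sqr_ge0.
rewrite p0 q0 mj !mul0r expr0n/= addr0 => h.
have h1 := sqr_ge0 (p j T); have h2 := sqr_ge0 (q j T).
have e1 : p j T ^+ 2 = 0 by apply/eqP; rewrite eq_le; apply/andP; split; lra.
have e2 : q j T ^+ 2 = 0 by apply/eqP; rewrite eq_le; apply/andP; split; lra.
by split; apply/eqP; rewrite -sqrf_eq0; apply/eqP.
Qed.

Hypotheses (m0 : forall j, 0 <= m j) (m1 : \sum_j m j = 1).

(** Cauchy-Schwarz for weights of total mass 1, from the nonnegative variance: the sum of (x_j - m_j
    X)^2 / m_j. A zero weight has inverse 0, and its component is assumed to vanish. *)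
Lemma sum_sqr_le (x : 'I_7 -> R) : (forall j, m j = 0 -> x j = 0) ->
  (\sum_j x j) ^+ 2 <= \sum_j (m j)^-1 * x j ^+ 2.
Proof.
move=> x0; set X := \sum_j x j.
have : 0 <= \sum_j (m j)^-1 * (x j - m j * X) ^+ 2.
  by apply: sumr_ge0 => j _; rewrite mulr_ge0 ?sqr_ge0// invr_ge0.
rewrite (eq_bigr (fun j => (m j)^-1 * x j ^+ 2 - 2 * X * x j + X ^+ 2 * m j)); last first.
  move=> j _; have [mj|mj] := eqVneq (m j) 0.
    by rewrite mj x0// invr0 !mul0r !mulr0 subr0 addr0.
  by field.
rewrite !big_split/= -mulr_sumr m1 mulr1 sumrN -mulr_sumr -/X.
by rewrite expr2 => ?; lra.
Qed.

(* [m j = 0] is allowed: the weight [(m j)^-1] is then 0 and component j vanishes. *)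
Lemma kinetic_energy T : 0 <= T <= T1 ->
  \sum_j (m j)^-1 * (p j T ^+ 2 + q j T ^+ 2) <= P0 ^+ 2 + Q0 ^+ 2.
Proof.
move=> /andP[T0 TT1].
have E0 : \sum_j (m j)^-1 * (p j 0 ^+ 2 + q j 0 ^+ 2) = P0 ^+ 2 + Q0 ^+ 2.
  rewrite -[RHS]mul1r -m1 mulr_suml; apply: eq_bigr => j _.
  rewrite p0 q0; have [->|mj] := eqVneq (m j) 0; first by rewrite invr0 !mul0r.
  by field.
move: T0; rewrite le_eqVlt => /orP[/eqP <-|T0]; first by rewrite E0.
rewrite -E0.
pose dE t := \sum_j (m j)^-1 * (2 * p j t * dp j t + 2 * q j t * dq j t).
apply: (@nonincreasing_endpoints _ _ T0 (fun t => \sum_j (m j)^-1 * (p j t ^+ 2 + q j t ^+ 2)) dE).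
- apply: within_bigsum => j x; apply: cvgM; first exact: cvg_cst.
  exact: (continuous_subspaceW (sub01 TT1) (@cE j)).
- move=> t /andP[t0 tT]; 
  apply: (@is_derive_bigsum R _ _ (fun j t => (m j)^-1 * (p j t ^+ 2 + q j t ^+ 2))
    (fun j t => (m j)^-1 * (2 * p j t * dp j t + 2 * q j t * dq j t))) => j.
  have h : is_derive t 1 (fun t => p j t ^+ 2 + q j t ^+ 2)
     (2 * p j t * dp j t + 2 * q j t * dq j t).
    by apply: derE; rewrite t0 (lt_le_trans tT).
  exact: (is_deriveZ ((m j)^-1) h).
- move=> t /andP[t0 tT].
  have tT1 : 0 <= t <= T1 by rewrite !ltW// (lt_le_trans tT).
  have pz j : m j = 0 -> p j t = 0 by move=> /(zero_weight_mode tT1)[].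
  have qz j : m j = 0 -> q j t = 0 by move=> /(zero_weight_mode tT1)[].
  (* Transport cancels between [p] and [q]. Relaxation contributes -2s times the defect in
     [sum_sqr_le], once for [p] and once for [q]. *)
  rewrite /dE (eq_bigr (fun j => - (2 * s) * ((m j)^-1 * p j t ^+ 2 + (m j)^-1 * q j t ^+ 2
     - P t * p j t - Q t * q j t))); last first.
    move=> j _; rewrite /dp /dq; have [mj|mj] := eqVneq (m j) 0.
      by rewrite mj pz// qz// invr0; ring.
    by field.
  rewrite -mulr_sumr !big_split/= !sumrN -!mulr_sumr mulNr oppr_le0 mulr_ge0 ?mulr_ge0//.
  have := sum_sqr_le pz; have := sum_sqr_le qz; rewrite !expr2; lra.
Qed.

Lemma kinetic_density_bound T : 0 <= T <= T1 -> P T ^+ 2 + Q T ^+ 2 <= P0 ^+ 2 + Q0 ^+ 2.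
Proof.
move=> TT; apply: le_trans (kinetic_energy TT).
under [leRHS]eq_bigr do rewrite mulrDr.
rewrite big_split/= lerD// sum_sqr_le// => j /(zero_weight_mode TT)[]//.
Qed.

Lemma kinetic_mode_bound j T : 0 <= T <= T1 ->
  p j T ^+ 2 + q j T ^+ 2 <= P0 ^+ 2 + Q0 ^+ 2.
Proof.
move=> TT; have [mj|mj] := eqVneq (m j) 0.
  by have [-> ->] := zero_weight_mode TT mj; rewrite expr0n/= addr0 addr_ge0// sqr_ge0.
have mj1 : m j <= 1.
  by rewrite -m1 (bigD1 j)//= lerDl sumr_ge0.
apply: le_trans (kinetic_energy TT); rewrite (bigD1 j)//= -[leLHS]addr0 lerD//.
  by rewrite ler_peMl ?addr_ge0 ?sqr_ge0// invf_ge1// lt_def mj m0.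
by apply: sumr_ge0 => i _; rewrite mulr_ge0 ?invr_ge0// addr_ge0// sqr_ge0.
Qed.

End kinetic_modes.

(** * Error estimate for a single mode *)

Section kinetic_limit.
Variables (R : realType) (p q : 'I_7 -> R -> R) (be m : 'I_7 -> R) (eps T : R).
Local Notation P t := (\sum_i p i t).
Local Notation Q t := (\sum_i q i t).
Hypothesis T0 : 0 < T.
Hypotheses (cp : forall j, {within `[0, T], continuous (p j)})
  (cq : forall j, {within `[0, T], continuous (q j)}).
Hypotheses
  (derp : forall j t, 0 < t < T ->
     is_derive t 1 (p j) (be j * q j t - eps ^- 2 * (p j t - m j * P t)))
  (derq : forall j t, 0 < t < T ->
     is_derive t 1 (q j) (- be j * p j t - eps ^- 2 * (q j t - m j * Q t))).
Hypothesis eps01 : 0 < eps <= 1.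
Variables (P0 Q0 w La B M : R).
Hypotheses (p0 : forall j, p j 0 = m j * P0) (q0 : forall j, q j 0 = m j * Q0).
Hypotheses (m1 : \sum_j m j = 1) (mw : \sum_j m j * be j = w)
  (mLa : eps ^+ 2 * \sum_j m j * be j ^+ 2 = La) (La0 : 0 <= La).
Hypotheses (beB : forall j, `|be j| <= B / eps).
Hypotheses (pM : forall j t, 0 <= t <= T -> `|p j t| <= M)
  (qM : forall j t, 0 <= t <= T -> `|q j t| <= M).
Variables (rp rq : R -> R).
Hypotheses (crp : {within `[0, T], continuous rp}) (crq : {within `[0, T], continuous rq}).
Hypotheses (derrp : forall t, 0 < t < T -> is_derive t 1 rp (w * rq t - La * rp t))
  (derrq : forall t, 0 < t < T -> is_derive t 1 rq (- w * rp t - La * rq t)).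
Hypotheses (rp0 : rp 0 = P0) (rq0 : rq 0 = Q0).

Let ep0 : 0 < eps. Proof. by case/andP: eps01. Qed.
Let ep1 : eps <= 1. Proof. by case/andP: eps01. Qed.
Let B0 : 0 <= B.
Proof.
have := le_trans (normr_ge0 _) (beB ord0).
by rewrite pmulr_lge0// invr_gt0.
Qed.
Let M0 : 0 <= M.
Proof. by apply: (le_trans (normr_ge0 (p ord0 0))); apply: pM; rewrite lexx ltW. Qed.

(* Chapman-Enskog corrector: the relaxation term cancels up to an [eps]-small
   remainder in the evolution of this perturbation of the density. *)
Let cor (x y : 'I_7 -> R -> R) (c : 'I_7 -> R) (t : R) : R :=
  \sum_j ((1 - eps ^+ 4 * c j ^+ 2) * x j t + eps ^+ 2 * c j * y j t).
Let rem (y : 'I_7 -> R -> R) (c : 'I_7 -> R) (t : R) : R := \sum_j eps ^+ 4 * c j ^+ 3 * y j t.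

(** Summing the equations of x_j kills relaxation, as the weights sum to 1, but leaves the flux c_j
    y_j of order 1/eps. The derivative of eps^2 c_j y_j contains -c_j y_j, and adds m_j c_j Y -
    eps^2 c_j^2 x_j. The derivative of -eps^4 c_j^2 x_j turns the last term into -eps^2 m_j c_j^2 X,
    at the price of -eps^4 c_j^3 y_j, which is O(eps). *)
Let der_cor (x y : 'I_7 -> R -> R) (c : 'I_7 -> R) (v t : R) :
  (forall j, is_derive t 1 (x j) (c j * y j t - eps ^- 2 * (x j t - m j * \sum_i x i t))) ->
  (forall j, is_derive t 1 (y j) (- c j * x j t - eps ^- 2 * (y j t - m j * \sum_i y i t))) ->
  \sum_j m j * c j = v -> eps ^+ 2 * \sum_j m j * c j ^+ 2 = La ->
  is_derive t 1 (cor x y c) (v * (\sum_i y i t) - La * (\sum_i x i t) - rem y c t).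
Proof.
move=> dx dy mv mL.
have h j : is_derive t 1 (fun t => (1 - eps ^+ 4 * c j ^+ 2) * x j t + eps ^+ 2 * c j * y j t)
   ((1 - eps ^+ 4 * c j ^+ 2) * (c j * y j t - eps ^- 2 * (x j t - m j * \sum_i x i t)) +
    eps ^+ 2 * c j * (- c j * x j t - eps ^- 2 * (y j t - m j * \sum_i y i t))).
  exact: (is_deriveD (is_deriveZ (1 - eps ^+ 4 * c j ^+ 2) (dx j))
                     (is_deriveZ (eps ^+ 2 * c j) (dy j))).
apply: (is_derive_eq (is_derive_bigsum (index_enum _) (dg := fun j t =>
    (1 - eps ^+ 4 * c j ^+ 2) * (c j * y j t - eps ^- 2 * (x j t - m j * \sum_i x i t)) +
    eps ^+ 2 * c j * (- c j * x j t - eps ^- 2 * (y j t - m j * \sum_i y i t))) h)) => /=.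
rewrite -mv -mL /rem.
set X := \sum_i x i t; set Y := \sum_i y i t.
transitivity (\sum_i (- eps ^- 2 * x i t + (m i * (eps ^- 2 * X) + (m i * c i * Y -
   (m i * c i ^+ 2) * (eps ^+ 2 * X) - eps ^+ 4 * c i ^+ 3 * y i t)))).
  by apply: eq_bigr => i _; field; rewrite gt_eqF.
rewrite big_split/= -mulr_sumr -/X big_split/= -mulr_suml m1 !big_split/= !sumrN.
by rewrite -!mulr_suml; ring.
Qed.

Let cor_close (x y : 'I_7 -> R -> R) (c : 'I_7 -> R) (t : R) :
  (forall j, `|c j| <= B / eps) -> (forall j, `|x j t| <= M) -> (forall j, `|y j t| <= M) ->
  `|\sum_i x i t - cor x y c t| <= 7 * ((B ^+ 2 + B) * M) * eps.
Proof.
move=> cB xM yM; rewrite /cor -sumrB.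
apply: (le_trans (ler_norm_sum _ _ _)).
apply: (@le_trans _ _ (\sum_(i < 7) ((B ^+ 2 + B) * M * eps))); last first.
  by rewrite sumr_const card_ord -[leLHS]mulr_natl !mulrA.
apply: ler_sum => j _.
have cB' : eps * `|c j| <= B by rewrite mulrC -ler_pdivlMr.
rewrite (_ : _ - _ = eps ^+ 2 * ((eps * c j) ^+ 2) * x j t - eps * (eps * c j) * y j t); last by ring.
have nE : `|eps| = eps by rewrite gtr0_norm.
apply: (le_trans (ler_normB _ _)); rewrite !(normrM, normrX) nE.
have e0 := ltW ep0.
have h1 : eps ^+ 2 * (eps * `|c j|) ^+ 2 * `|x j t| <= eps * B ^+ 2 * M.
  apply: ler_pM => //; first by rewrite mulr_ge0 ?exprn_ge0// mulr_ge0.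
  apply: ler_pM; rewrite ?exprn_ge0 ?mulr_ge0//.
    by rewrite expr2 ler_piMr.
  by rewrite ler_sqr// nnegrE mulr_ge0.
have h2 : eps * (eps * `|c j|) * `|y j t| <= eps * B * M.
  apply: ler_pM => //; first by rewrite !mulr_ge0.
  by rewrite ler_pM2l.
apply: (le_trans (lerD h1 h2)).
by rewrite (_ : eps * B ^+ 2 * M + _ = (B ^+ 2 + B) * M * eps)//; ring.
Qed.

Let rem_small (y : 'I_7 -> R -> R) (c : 'I_7 -> R) (t : R) :
  (forall j, `|c j| <= B / eps) -> (forall j, `|y j t| <= M) ->
  `|rem y c t| <= 7 * (B ^+ 3 * M) * eps.
Proof.
move=> cB yM; rewrite /rem; apply: (le_trans (ler_norm_sum _ _ _)).
apply: (@le_trans _ _ (\sum_(i < 7) (B ^+ 3 * M * eps))); last first.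
  by rewrite sumr_const card_ord -[leLHS]mulr_natl !mulrA.
apply: ler_sum => j _.
have cB' : eps * `|c j| <= B by rewrite mulrC -ler_pdivlMr.
rewrite (_ : eps ^+ 4 * _ * _ = eps * ((eps * c j) ^+ 3 * y j t)); last by ring.
have zB : `|eps * c j| <= B by rewrite normrM (gtr0_norm ep0).
rewrite normrM (gtr0_norm ep0) mulrC ler_pM2r// normrM; apply: ler_pM => //.
by rewrite normrX lerXn2r ?nnegrE.
Qed.

(** Per unit of eps, [D] bounds the distance from the density to its corrector and [G] the forcing
    in the equation of the corrected error. The exponential is Gronwall at rate 1; the outer factors
    2 come from (x + y)^2 <= 2 x^2 + 2 y^2. *)
Definition kinetic_limit_constant : R :=
  let D := 7 * ((B ^+ 2 + B) * M) in
  let G := `|w| * D + La * D + 7 * (B ^+ 3 * M) in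
  2 * (expR T * (2 * D ^+ 2 + 2 * G ^+ 2)) + 2 * D ^+ 2.

Let sqr_le (x y : R) : `|x| <= y -> x ^+ 2 <= y ^+ 2.
Proof.
move=> xy; rewrite -real_normK ?num_real// lerXn2r ?nnegrE//.
exact: le_trans xy.
Qed.

Lemma kinetic_limit : (P T - rp T) ^+ 2 <= kinetic_limit_constant * eps ^+ 2.
Proof.
rewrite /kinetic_limit_constant; set D := 7 * _; set G := _ + 7 * _.
pose bn j := - be j.
have bnB j : `|bn j| <= B / eps by rewrite normrN.
pose Ep := cor p q be; pose Eq := cor q p bn.
have cEp (t : R) : 0 <= t <= T -> `|P t - Ep t| <= D * eps.
  by move=> tT; apply: cor_close => // j; [exact: pM|exact: qM].
have cEq (t : R) : 0 <= t <= T -> `|Q t - Eq t| <= D * eps.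
  by move=> tT; apply: cor_close => // j; [exact: qM|exact: pM].
have dEp (t : R) : 0 < t < T -> is_derive t 1 Ep (w * Q t - La * P t - rem q be t).
  move=> tT; exact: (der_cor (fun j => @derp j t tT) (fun j => @derq j t tT) mw mLa).
have dEq (t : R) : 0 < t < T -> is_derive t 1 Eq (- w * P t - La * Q t - rem p bn t).
  move=> tT.
  have dq j : is_derive t 1 (q j) (bn j * p j t - eps ^- 2 * (q j t - m j * Q t)).
    exact: (@derq j t tT).
  have dp j : is_derive t 1 (p j) (- bn j * q j t - eps ^- 2 * (p j t - m j * P t)).
    by rewrite /bn opprK; exact: (@derp j t tT).
  have mwn : \sum_j m j * bn j = - w.
    by rewrite -mw -sumrN; apply: eq_bigr => i _; rewrite mulrN.
  have mLn : eps ^+ 2 * \sum_j m j * bn j ^+ 2 = La.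
    by rewrite -mLa; congr (_ * _); apply: eq_bigr => i _; rewrite sqrrN.
  exact: (der_cor dq dp mwn mLn).
have D0 : 0 <= D by rewrite !mulr_ge0// addr_ge0// exprn_ge0.
have G0 : 0 <= G by rewrite !addr_ge0// mulr_ge0// mulr_ge0// exprn_ge0.
pose v t := Ep t - rp t; pose z t := Eq t - rq t.
(* The equations of [Ep] and [Eq] are driven by the uncorrected densities; [R1] and [R2] collect the
   cost of replacing these by [Ep] and [Eq], together with the remainders. *)
pose R1 t := w * (Q t - Eq t) - La * (P t - Ep t) - rem q be t.
pose R2 t := - w * (P t - Ep t) - La * (Q t - Eq t) - rem p bn t.
have tri (x y c : R) (k1 k2 k3 : R) : `|x| <= k1 -> `|y| <= k2 -> `|c| <= k3 ->
    `|x - y - c| <= k1 + k2 + k3.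
  move=> h1 h2 h3; apply: (le_trans (ler_normB _ _)); apply: lerD => //.
  by apply: (le_trans (ler_normB _ _)); apply: lerD.
have GE : G * eps = `|w| * (D * eps) + La * (D * eps) + 7 * (B ^+ 3 * M) * eps.
  by rewrite /G; ring.
have R1le (t : R) : 0 <= t <= T -> R1 t ^+ 2 <= (G * eps) ^+ 2.
  move=> tT; apply: sqr_le; rewrite GE; apply: tri.
  - by rewrite normrM ler_wpM2l// cEq.
  - by rewrite normrM (ger0_norm La0) ler_wpM2l// cEp.
  - by apply: rem_small => // j; exact: qM.
have R2le (t : R) : 0 <= t <= T -> R2 t ^+ 2 <= (G * eps) ^+ 2.
  move=> tT; apply: sqr_le; rewrite GE; apply: tri.
  - by rewrite normrM normrN ler_wpM2l// cEp.
  - by rewrite normrM (ger0_norm La0) ler_wpM2l// cEq.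
  - by apply: rem_small => // j; exact: pM.
have zin : (0 : R) <= 0 <= T by rewrite lexx ltW.
have Pz : P 0 = P0 by under eq_bigr do rewrite p0; rewrite -mulr_suml m1 mul1r.
have Qz : Q 0 = Q0 by under eq_bigr do rewrite q0; rewrite -mulr_suml m1 mul1r.
have ccor (x y : 'I_7 -> R -> R) c : (forall j, {within `[0, T], continuous (x j)}) ->
    (forall j, {within `[0, T], continuous (y j)}) -> {within `[0, T], continuous (cor x y c)}.
  move=> cx cy; apply: within_bigsum => j s.
  by apply: cvgD; (apply: cvgM; first exact: cvg_cst); [exact: cx|exact: cy].
have cv : {within `[0, T], continuous v} by move=> s; apply: cvgB; [exact: ccor|exact: crp].
have cz : {within `[0, T], continuous z} by move=> s; apply: cvgB; [exact: ccor|exact: crq].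
pose dv t := w * z t - La * v t + R1 t.
pose dz t := - w * v t - La * z t + R2 t.
have derv (t : R) : 0 < t < T -> is_derive t 1 v (dv t).
  move=> tT; apply: (is_derive_eq (is_deriveB (dEp t tT) (derrp tT))).
  by rewrite /dv /z /v /R1; ring.
have derz (t : R) : 0 < t < T -> is_derive t 1 z (dz t).
  move=> tT; apply: (is_derive_eq (is_deriveB (dEq t tT) (derrq tT))).
  by rewrite /dz /z /v /R2; ring.
(* In the derivative of v^2 + z^2 the rotation by [w] cancels and [La] damps. Young's inequality on
   the forcing leaves v^2 + z^2 + 2 (G eps)^2, hence rate 1. *)
have key := @gronwall R T T0 (fun t => v t ^+ 2 + z t ^+ 2)
  (fun t => 2 * v t * dv t + 2 * z t * dz t) 1 (2 * (G * eps) ^+ 2) ltr01.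
have {}key : v T ^+ 2 + z T ^+ 2 + 2 * (G * eps) ^+ 2 <=
    expR T * (v 0 ^+ 2 + z 0 ^+ 2 + 2 * (G * eps) ^+ 2).
  move: key; rewrite divr1 mul1r; apply.
  - by move=> s; apply: cvgD; [apply: cvgM; exact: cv|apply: cvgM; exact: cz].
  - by move=> t tT; apply: is_deriveD; apply: is_derive_sqr; [exact: derv|exact: derz].
  - move=> t /andP[/ltW t0 /ltW tT].
    have tT' : 0 <= t <= T by rewrite t0.
    have := R1le t tT'; have := R2le t tT'.
    rewrite /dv /dz; move: (v t) (z t) (R1 t) (R2 t) ((G * eps) ^+ 2) => x y r1 r2 g h2 h1.
    have h3 : 0 <= La * (x ^+ 2 + y ^+ 2) by rewrite mulr_ge0// addr_ge0// sqr_ge0.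
    have h4 := sqr_ge0 (x - r1); have h5 := sqr_ge0 (y - r2).
    have -> : 2 * x * (w * y - La * x + r1) + 2 * y * (- w * x - La * y + r2) =
      - 2 * (La * (x ^+ 2 + y ^+ 2)) + (x ^+ 2 + r1 ^+ 2 - (x - r1) ^+ 2)
        + (y ^+ 2 + r2 ^+ 2 - (y - r2) ^+ 2) by ring.
    lra.
have v0 : v 0 ^+ 2 <= (D * eps) ^+ 2.
  by apply: sqr_le; rewrite /v rp0 -Pz distrC; exact: cEp.
have z0 : z 0 ^+ 2 <= (D * eps) ^+ 2.
  by apply: sqr_le; rewrite /z rq0 -Qz distrC; exact: cEq.
have PE : (P T - Ep T) ^+ 2 <= (D * eps) ^+ 2.
  by apply: sqr_le; apply: cEp; rewrite lexx ltW.
have h1 : expR T * (v 0 ^+ 2 + z 0 ^+ 2 + 2 * (G * eps) ^+ 2) <=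
    expR T * (2 * (D * eps) ^+ 2 + 2 * (G * eps) ^+ 2).
  by rewrite ler_pM2l ?expR_gt0// lerD2r mulr_natl mulr2n lerD.
have h2 : v T ^+ 2 <= expR T * (2 * (D * eps) ^+ 2 + 2 * (G * eps) ^+ 2).
  apply: le_trans (le_trans key h1); rewrite -addrA lerDl addr_ge0 ?sqr_ge0//.
  by rewrite mulr_ge0// sqr_ge0.
have -> : P T - rp T = (P T - Ep T) + v T by rewrite /v; ring.
have h3 : (P T - Ep T + v T) ^+ 2 <= 2 * (P T - Ep T) ^+ 2 + 2 * v T ^+ 2.
  move: (P T - Ep T) (v T) => x y; have := sqr_ge0 (x - y).
  rewrite (_ : (x - y) ^+ 2 = 2 * x ^+ 2 + 2 * y ^+ 2 - (x + y) ^+ 2); last by ring.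
  by rewrite subr_ge0.
apply: (le_trans h3).
rewrite (_ : _ * eps ^+ 2 = 2 * (D * eps) ^+ 2 +
  2 * (expR T * (2 * (D * eps) ^+ 2 + 2 * (G * eps) ^+ 2))); last by ring.
by rewrite lerD// ler_pM2l.
Qed.

End kinetic_limit.

(* If rho_0 = 0 almost everywhere the monotonicity assumption is void and the
   weights may be negative, so the energy estimate is not available. *)
Section kinetic_zero.
Variables (R : realType) (p q : 'I_7 -> R -> R) (be m : 'I_7 -> R) (s T : R).
Local Notation P t := (\sum_i p i t).
Local Notation Q t := (\sum_i q i t).
Hypotheses (T0 : 0 < T) (s0 : 0 <= s).
Hypotheses (cp : forall j, {within `[0, T], continuous (p j)})
  (cq : forall j, {within `[0, T], continuous (q j)}).
Let dp j t : R := be j * q j t - s * (p j t - m j * P t).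
Let dq j t : R := - be j * p j t - s * (q j t - m j * Q t).
Hypotheses (derp : forall j (t : R), 0 < t < T -> is_derive t 1 (p j) (dp j t))
  (derq : forall j (t : R), 0 < t < T -> is_derive t 1 (q j) (dq j t)).
Hypotheses (p0 : forall j, p j 0 = 0) (q0 : forall j, q j 0 = 0).

(** From 2|x_j x_i| <= x_j^2 + x_i^2: summing over the seven indices i gives 7 x_j^2 plus the full
    sum of squares, hence the factor 8. *)
Lemma weighted_sum_bound (x : 'I_7 -> R) :
  \sum_j 2 * m j * x j * (\sum_i x i) <= 8 * (\sum_j `|m j|) * \sum_i x i ^+ 2.
Proof.
set A := \sum_j `|m j|; set S := \sum_i x i ^+ 2.
have S0 : 0 <= S by apply: sumr_ge0 => i _; exact: sqr_ge0.
apply: (@le_trans _ _ (\sum_j (7 * (`|m j| * S) + `|m j| * S))); last first.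
  rewrite (eq_bigr (fun j => `|m j| * (8 * S))) => [|j _]; last by ring.
  by rewrite -mulr_suml mulrCA mulrA.
apply: ler_sum => j _; rewrite mulr_sumr.
have h i : 2 * m j * x j * x i <= `|m j| * S + `|m j| * x i ^+ 2.
  have xS : x j ^+ 2 <= S.
    by rewrite /S (bigD1 j)//= lerDl sumr_ge0// => k _; exact: sqr_ge0.
  apply: (@le_trans _ _ (`|m j| * x j ^+ 2 + `|m j| * x i ^+ 2)); last first.
    by rewrite lerD2r ler_wpM2l.
  apply: (le_trans (ler_norm _)); rewrite !normrM ger0_norm// -mulrDr -mulrA.
  rewrite [leLHS](_ : _ = `|m j| * (2 * `|x j| * `|x i|)); last by ring.
  rewrite ler_wpM2l// -(real_normK (num_real (x j))) -(real_normK (num_real (x i))).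
  by have := sqr_ge0 (`|x j| - `|x i|); rewrite sqrrB => h; rewrite -subr_ge0 (le_trans h)// mulr_natl; lra.
apply: (le_trans (ler_sum _ (fun i _ => h i))).
rewrite big_split/= sumr_const card_ord -mulr_sumr -/S -[_ *+ 7]mulr_natl.
exact: lexx.
Qed.

(** A crude Gronwall estimate whose rate grows with [s], hence with 1/eps; this is harmless because
    the initial energy is exactly 0. The summand 1 in [K] makes the rate positive. *)
Lemma kinetic_zero j : p j T = 0.
Proof.
pose Y t : R := \sum_j (p j t ^+ 2 + q j t ^+ 2).
pose dY t : R := \sum_j (2 * p j t * dp j t + 2 * q j t * dq j t).
pose K := s * (8 * \sum_j `|m j|) + 1.
have sA : 0 <= s * (8 * \sum_j `|m j|) by rewrite mulr_ge0// mulr_ge0// sumr_ge0.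
have K0 : 0 < K by rewrite /K; lra.
have key := @gronwall R T T0 Y dY K 0 K0.
have Y0 : Y 0 = 0.
  by rewrite /Y big1// => i _; rewrite p0 q0 expr0n/= addr0.
have {}key : Y T <= 0.
  move: key; rewrite Y0 mul0r !addr0 mulr0; apply.
  - apply: within_bigsum => i x.
    by apply: cvgD; [apply: cvgM; exact: cp|apply: cvgM; exact: cq].
  - move=> t tT; apply: (@is_derive_bigsum R _ _ (fun j t => p j t ^+ 2 + q j t ^+ 2)
      (fun j t => 2 * p j t * dp j t + 2 * q j t * dq j t)) => i.
    exact: (is_deriveD (is_derive_sqr (@derp i t tT)) (is_derive_sqr (@derq i t tT))).
  - move=> t tT; rewrite addr0 /dY.
    rewrite (eq_bigr (fun j => - (2 * s) * (p j t ^+ 2 + q j t ^+ 2) +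
       s * (2 * m j * p j t * P t + 2 * m j * q j t * Q t))); last first.
      by move=> i _; rewrite /dp /dq; ring.
    rewrite big_split/= -!mulr_sumr -/(Y t) big_split/=.
    have Y0' : 0 <= Y t by apply: sumr_ge0 => i _; rewrite addr_ge0// sqr_ge0.
    have h : \sum_j 2 * m j * p j t * P t + \sum_j 2 * m j * q j t * Q t <=
        8 * (\sum_j `|m j|) * Y t.
      apply: (le_trans (lerD (weighted_sum_bound _) (weighted_sum_bound _))).
      by rewrite -mulrDr -big_split.
    apply: (@le_trans _ _ (- (2 * s) * Y t + s * (8 * (\sum_j `|m j|) * Y t))).
      by rewrite lerD2l ler_wpM2l.
    have : 0 <= 2 * s * Y t by rewrite !mulr_ge0.
    by rewrite /K [X in _ -> _ <= X]mulrDl mul1r mulNr !mulrA; lra.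
have : p j T ^+ 2 <= Y T.
  rewrite /Y (bigD1 j)//= -addrA lerDl addr_ge0 ?sqr_ge0// sumr_ge0// => i _.
  by rewrite addr_ge0// sqr_ge0.
move=> h; apply/eqP; rewrite -sqrf_eq0 eq_le sqr_ge0 andbT.
exact: le_trans h key.
Qed.

End kinetic_zero.

(** * Existence for the limit equation *)

Section time_cell_fubini.
Variables (R : realType) (a b : 'rV[R]_3) (c d : R) (D : R * space3 R -> R).
Hypothesis hab : forall k : 'I_3, a 0 k < b 0 k.
Hypothesis cD : continuous D.
Local Notation lam := (@lebesgue_measure R).
Local Notation J := (`[c, d]%classic : set (measurableTypeR R)).
Local Notation ST := (measurableTypeR R * mspace3 R)%type.
Let leb3' := product2 (product2 lam lam) lam.
Let f : ST -> \bar R := (EFin \o D) \_ (J `*` cell a b).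

Lemma continuous_bounded_time_cell :
  exists2 M, 0 < M & forall t x, c <= t <= d -> cell a b x -> `|D (t, x)| <= M.
Proof.
have : compact (D @` (`[c, d]%classic `*` cell a b)).
  apply: continuous_compact; first by apply: continuous_subspaceT; exact: cD.
  by apply: compact_setX; [exact: segment_compact|exact: compact_cell].
move=> /compact_bounded[M [Mr hM]]; exists (`|M| + 1); first by rewrite ltr_wpDl.
move=> t x tJ cx; apply: (hM (`|M| + 1)); first by rewrite (le_lt_trans (ler_norm _))// ltrDl.
by exists (t, x) => //; split => //=; rewrite in_itv.
Qed.

Let mJ : measurable J. Proof. exact: measurable_itv. Qed.
Let mC : measurable (cell a b : set (mspace3 R)). Proof. exact: measurable_cell. Qed.

Let intf : (lam \x leb3')%E.-integrable setT f.
Proof.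
have [M _ DM] := continuous_bounded_time_cell.
apply: (@bounded_integrable_restrict _ ST R (lam \x leb3')%E _ D M).
- exact: measurableX.
- have E : ((lam \x leb3') (J `*` cell a b) = lam J * leb3' (cell a b))%E.
    exact: product_measure1E.
  have : (lam J * leb3' (cell a b) < +oo)%E.
    apply: lte_mul_pinfty => //; last exact: (leb3_cell_lty hab).
    by rewrite ge0_fin_numE// lebesgue_measure_itv/=; case: ifP => // _; rewrite -EFinB ltry.
  by rewrite -E.
- by apply: measurable_funTS; exact: continuous_measurable4.
- by move=> [t x] [/= tJ cx]; apply: DM => //; move: tJ; rewrite in_itv.
Qed.

Let FE : (fun t => \int[leb3']_x f (t, x))%E =
  (EFin \o (fun t => \int[leb3 R]_(x in cell a b) D (t, x))) \_ J.
Proof.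
apply/funext => t; rewrite patchE /f; case: ifPn => tJ.
  rewrite [LHS](_ : _ = \int[leb3 R]_(x in cell a b) (D (t, x))%:E)%E; last first.
    rewrite [RHS]integral_mkcond; apply: eq_integral => x _; rewrite !patchE/=.
    by rewrite in_setX tJ.
  rewrite /Rintegral/= fineK//.
  apply: integrable_fin_num => //; apply: (continuous_integrable_cell hab (f := fun x => D (t, x))).
  by move=> x; apply: (continuous_comp _ (@cD (t, x))); exact: cvg_pair (cvg_cst _) cvg_id.
apply: integral0_eq => x _; rewrite patchE in_setX/=.
by rewrite (negbTE tJ).
Qed.

Lemma integrable_time_cell :
  lam.-integrable J (EFin \o (fun t => \int[leb3 R]_(x in cell a b) D (t, x))).
Proof.
apply/(integrable_mkcond _ mJ); rewrite -FE.
exact: (integrable_fubini_F intf).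
Qed.

Lemma integral_time_cell_eq0 :
  (forall x, \int[lam]_(t in J) (D (t, x))%:E = 0)%E ->
  \int[lam]_(t in J) \int[leb3 R]_(x in cell a b) D (t, x) = 0.
Proof.
move=> D0; rewrite /Rintegral [X in fine X](_ : _ = 0%E)//.
rewrite [LHS]integral_mkcond -[X in (\int[_]_x X x)%E]FE.
rewrite (integral12_prod_meas1 intf); apply: (integral_prod_eq0r intf) => x.
have [cx|cx] := pselect (cell a b x).
  rewrite -[RHS](D0 x) [RHS]integral_mkcond; apply: eq_integral => t _.
  by rewrite /f !patchE in_setX/= [x \in _]mem_set// andbT.
by apply: integral0_eq => t _; rewrite /f patchE in_setX/= [x \in _]memNset// andbF.
Qed.

End time_cell_fubini.

Section space_time_derivatives.
Variable R : realType.
Implicit Types (phi : R * space3 R -> R).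

Lemma continuous_slice phi t : continuous phi -> continuous (fun x => phi (t, x)).
Proof.
by move=> c x; apply: (continuous_comp _ (@c (t, x))); exact: cvg_pair (cvg_cst _) cvg_id.
Qed.

Lemma continuous_time phi x : continuous phi -> continuous (fun t => phi (t, x)).
Proof.
by move=> c t; apply: (continuous_comp _ (@c (t, x))); exact: cvg_pair cvg_id (cvg_cst _).
Qed.

Lemma is_derive_space k phi t x d :
  is_derive (t, x) ((0 : R), basis_vec R k) phi d <->
  is_derive x (basis_vec R k) (fun y => phi (t, y)) d.
Proof.
split=> /is_derive_dirP h; apply/is_derive_dirP; move: h; congr is_derive;
  by apply/funext => s; congr (phi (_, _)); rewrite /= scaler0 addr0.
Qed.

Lemma is_derive_time phi t x d :
  is_derive (t, x) ((1 : R), (0 : space3 R)) phi d <->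
  is_derive t 1 (fun s => phi (s, x)) d.
Proof.
split=> /is_derive_dirP h; apply/is_derive_dirP; move: h; congr is_derive;
  by apply/funext => s; congr (phi (_, _)); rewrite /= ?scaler0 ?addr0.
Qed.

Lemma smooth_derive phi v : smooth phi -> smooth ('D_v phi).
Proof. by move=> s vs z; have := s (rcons vs v) z; rewrite foldr_rcons. Qed.

Lemma smooth_continuous phi : smooth phi -> continuous phi.
Proof. by move=> s z; apply: differentiable_continuous; exact: (s [::]). Qed.

Lemma smooth_is_derive phi v z : smooth phi -> is_derive z v phi ('D_v phi z).
Proof. by move=> s; apply: DeriveDef => //; apply: diff_derivable; exact: (s [::]). Qed.

Lemma periodic_dx a b k phi t : smooth phi -> cell_periodic a b (fun x => phi (t, x)) ->
  cell_periodic a b (fun x => dx k phi (t, x)).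
Proof.
move=> s per l x; set p := _ *: _.
have /is_derive_space/is_derive_dirP h := @smooth_is_derive phi (0, basis_vec R k) (t, x + p) s.
have h' : is_derive x (basis_vec R k) (fun y => phi (t, y)) (dx k phi (t, x + p)).
  apply/is_derive_dirP; move: h; congr is_derive; apply/funext => r.
  by rewrite addrAC per.
by have /is_derive_space h2 := h'; exact: (esym (derive_val (is_derive := h2))).
Qed.

End space_time_derivatives.

Section classical_solution.
Variables (R : realType) (a b : 'rV[R]_3) (mu : R) (u : 'rV[R]_3).
Hypothesis hab : forall k : 'I_3, a 0 k < b 0 k.

(* Formal adjoint of the advection-diffusion operator, up to sign. *)
Definition adjoint (phi : R * space3 R -> R) (z : R * space3 R) : R :=
  dt phi z + \sum_(k < 3) u 0 k * dx k phi z + mu * \sum_(k < 3) dx k (dx k phi) z.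

Lemma continuous_adjoint phi : smooth phi -> continuous (adjoint phi).
Proof.
move=> s.
have cd v psi : smooth psi -> continuous ('D_v psi).
  by move=> ps; apply: smooth_continuous; exact: smooth_derive.
rewrite /adjoint (_ : (fun z => _) = fun z => dt phi z +
   (u 0 0 * dx 0 phi z + u 0 1 * dx 1 phi z + u 0 (inord 2) * dx (inord 2) phi z) +
   mu * (dx 0 (dx 0 phi) z + dx 1 (dx 1 phi) z + dx (inord 2) (dx (inord 2) phi) z)); last first.
  by apply/funext => z; rewrite !sum3.
have c1 k : continuous (fun z => u 0 k * dx k phi z).
  by move=> z; apply: cvgM; [exact: cvg_cst|exact: cd].
have c2 k : continuous (dx k (dx k phi)) by apply: cd; exact: smooth_derive.
move=> z; apply: cvgD; [apply: cvgD|apply: cvgM].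
- exact: cd.
- by apply: cvgD; [apply: cvgD|]; exact: c1.
- exact: cvg_cst.
- by apply: cvgD; [apply: cvgD|]; exact: c2.
Qed.

Variables (w wt : R * space3 R -> R) (wx wxx : 'I_3 -> R * space3 R -> R).
Hypotheses (cw : continuous w) (cwt : continuous wt)
  (cwx : forall k, continuous (wx k)) (cwxx : forall k, continuous (wxx k)).
Hypotheses (dw : forall z, is_derive z ((1 : R), (0 : space3 R)) w (wt z))
  (dwx : forall k z, is_derive z ((0 : R), basis_vec R k) w (wx k z))
  (dwxx : forall k z, is_derive z ((0 : R), basis_vec R k) (wx k) (wxx k z)).
Hypotheses (pw : forall t, cell_periodic a b (fun x => w (t, x)))
  (pwx : forall k t, cell_periodic a b (fun x => wx k (t, x))).
Hypothesis pde : forall z, wt z + \sum_(k < 3) u 0 k * wx k z = mu * \sum_(k < 3) wxx k z.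

(** By the equation for [w], w times the adjoint of phi is a time derivative plus a spatial
    divergence. The divergence integrates to 0 over the cell by periodicity, the time derivative by
    the vanishing of phi at both ends, after exchanging the integrals. *)
Lemma classical_weak phi s1 s2 : smooth phi -> (forall t, cell_periodic a b (fun x => phi (t, x))) ->
  s1 < s2 -> (forall x, phi (s1, x) = 0) -> (forall x, phi (s2, x) = 0) ->
  \int[@lebesgue_measure R]_(t in `[s1, s2]) \int[leb3 R]_(x in cell a b)
    (w (t, x) * adjoint phi (t, x)) = 0.
Proof.
move=> s per s12 phi1 phi2.
have cphi := smooth_continuous s.
have sd v : smooth ('D_v phi) by exact: smooth_derive.
have cd v : continuous ('D_v phi) := smooth_continuous (sd v).
pose D z := w z * dt phi z + wt z * phi z.
have cD : continuous D.
  by move=> z; apply: cvgD; apply: cvgM; [exact: cw|exact: cd|exact: cwt|exact: cphi].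
(* The derivative in direction k of the flux u_k w phi + mu (w d_k phi - phi d_k w); likewise [D] is
   the time derivative of w phi. *)
pose S k z := u 0 k * (w z * dx k phi z + wx k z * phi z) +
  mu * (w z * dx k (dx k phi) z - wxx k z * phi z).
have cS k : continuous (S k).
  move=> z; apply: cvgD; (apply: cvgM; first exact: cvg_cst); [apply: cvgD|apply: cvgB].
  - by apply: cvgM; [exact: cw|exact: cd].
  - by apply: cvgM; [exact: cwx|exact: cphi].
  - by apply: cvgM; [exact: cw|exact: (smooth_continuous (smooth_derive _ (sd _)))].
  - by apply: cvgM; [exact: cwxx|exact: cphi].
have S0 k t : \int[leb3 R]_(x in cell a b) S k (t, x) = 0.
  pose G (x : space3 R) : R := u 0 k * (w (t, x) * phi (t, x)) +
    mu * (w (t, x) * dx k phi (t, x) - wx k (t, x) * phi (t, x)).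
  apply: (@Rintegral_deriv_cell R a b hab G (fun x => S k (t, x)) k).
  - exact: continuous_slice.
  - move=> x.
    pose Gz z : R := u 0 k * (w z * phi z) + mu * (w z * dx k phi z - wx k z * phi z).
    apply: (proj1 (is_derive_space k Gz t x _)).
    have h1 := dwx k (t, x); have h2 := @smooth_is_derive _ phi (0, basis_vec R k) (t, x) s.
    have h3 := dwxx k (t, x); have h4 := @smooth_is_derive _ _ (0, basis_vec R k) (t, x) (sd (0, basis_vec R k)).
    have h12 := is_deriveZ (u 0 k) (is_deriveM h1 h2).
    have h34 := is_deriveZ mu (is_deriveB (is_deriveM h1 h4) (is_deriveM h3 h2)).
    apply: (is_derive_eq (is_deriveD h12 h34)).
    by rewrite /S /dx /GRing.scale/=; ring.
  - have pd := periodic_dx k s (per t).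
    by move=> l x; rewrite /G (pw t l x) (per t l x) (pd l x) (pwx k t l x).
transitivity (\int[@lebesgue_measure R]_(t in `[s1, s2])
    \int[leb3 R]_(x in cell a b) D (t, x)).
  apply: eq_Rintegral => t _.
  transitivity (\int[leb3 R]_(x in cell a b) (D (t, x) + (S 0 (t, x) + S 1 (t, x) + S (inord 2) (t, x)))).
    apply: eq_Rintegral => x _; rewrite /D /S /adjoint !sum3.
    have := pde (t, x); rewrite !sum3.
    set A := wt _ => h.
    have -> : A = mu * (wxx 0 (t, x) + wxx 1 (t, x) + wxx (inord 2) (t, x)) -
      (u 0 0 * wx 0 (t, x) + u 0 1 * wx 1 (t, x) + u 0 (inord 2) * wx (inord 2) (t, x)).
      by rewrite -h; ring.
    move: (w (t, x)) (phi (t, x)) (dt phi (t, x)) (dx 0 phi (t, x)) (dx 1 phi (t, x))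
      (dx (inord 2) phi (t, x)) (dx 0 (dx 0 phi) (t, x)) (dx 1 (dx 1 phi) (t, x))
      (dx (inord 2) (dx (inord 2) phi) (t, x)) => *.
    by ring.
  have iS k : (leb3 R).-integrable (cell a b) (EFin \o (fun x => S k (t, x))).
    exact/(continuous_integrable_cell hab)/continuous_slice.
  have mc := @measurable_cell _ a b.
  have i2 := integrable_cellD (iS 0) (iS 1).
  have i3 := integrable_cellD i2 (iS (inord 2)).
  have iD : (leb3 R).-integrable (cell a b) (EFin \o (fun x => D (t, x))).
    exact/(continuous_integrable_cell hab)/continuous_slice.
  rewrite (RintegralD mc iD i3) (RintegralD mc i2 (iS (inord 2))).
  by rewrite (RintegralD mc (iS 0) (iS 1)) !S0 !addr0.
apply: integral_time_cell_eq0 => // x.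
have h (t : R) : is_derive t 1 (fun t => w (t, x) * phi (t, x)) (D (t, x)).
  have h1 := proj1 (is_derive_time _ _ _ _) (dw (t, x)).
  have h2 := proj1 (is_derive_time _ _ _ _) (@smooth_is_derive _ phi (1, 0) (t, x) s).
  apply: (is_derive_eq (is_deriveM h1 h2)).
  by rewrite /D /dt /GRing.scale/=; ring.
have cDx : continuous (fun t => D (t, x)) by exact: continuous_time.
by have -> := FTC_is_derive s12 cDx h; rewrite phi1 phi2 !mulr0 subrr.
Qed.

End classical_solution.

(** A representative of the L^1 limit chosen point by point, so that periodicity, which is required
    at every point, is inherited from the sequence. Where the upper limit is infinite, [fine]
    returns 0. *)
Definition limsup_fun (R : realType) (T : Type) (f : nat -> T -> R) (x : T) : R :=
  fine (limn_esup (fun i => (f i x)%:E)).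

Section L1_limit.
Context d (T : measurableType d) (R : realType) (mu : {measure set T -> \bar R}).
Variables (D : set T) (mD : measurable D) (f : nat -> T -> R).
Hypothesis mf : forall i, measurable_fun D (f i).

Let G i x : \bar R := (\sum_(0 <= k <oo) `|f (i + k).+1 x - f (i + k) x|%:E)%E.

Let telescope i k x : `|f (i + k)%N x - f i x| <=
  \sum_(0 <= j < k) `|f (i + j).+1 x - f (i + j)%N x|.
Proof.
elim: k => [|k ih]; first by rewrite addn0 subrr normr0 big_nil.
rewrite big_nat_recr//= addnS.
rewrite (_ : f (i + k).+1 x - f i x = (f (i + k)%N x - f i x) + (f (i + k).+1 x - f (i + k)%N x)); last by ring.
by apply: (le_trans (ler_normD _ _)); rewrite lerD.
Qed.

(** Where the series [G i x] of consecutive differences converges, all later terms stay within its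
    sum of f_i(x), and so does their upper limit; where it diverges the bound is trivial. *)
Let dominated i x : (`|limsup_fun f x - f i x|%:E <= G i x)%E.
Proof.
have [->|Gy] := eqVneq (G i x) +oo%E; first by rewrite leey.
have G0 : (0 <= G i x)%E by apply: nneseries_ge0 => k _ _; rewrite lee_fin.
have Gf : G i x \is a fin_num by rewrite ge0_fin_numE// ltey.
pose K := fine (G i x).
have fK j : (i <= j)%N -> `|f j x - f i x| <= K.
  move=> ij; rewrite -(subnKC ij) -lee_fin fineK//.
  apply: (@le_trans _ _ (\sum_(0 <= k < j - i) `|f (i + k).+1 x - f (i + k)%N x|)%:E).
    by rewrite lee_fin telescope.
  rewrite -sumEFin; apply: nneseries_lim_ge => k _ _.
  by rewrite lee_fin.
pose u j := (f j x)%:E.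
have ub : (limn_esup u <= (f i x + K)%:E)%E.
  rewrite limn_esup_lim; apply: lime_le; first exact: is_cvg_esups.
  near=> n; apply: ge_ereal_sup => _ [m /= nm <-]; rewrite lee_fin.
  have im : (i <= m)%N by apply: leq_trans nm; near: n; exact: nbhs_infty_ge.
  by have := fK m im; rewrite ler_norml; lra.
have lb : ((f i x - K)%:E <= limn_esup u)%E.
  rewrite limn_esup_lim; apply: lime_ge; first exact: is_cvg_esups.
  near=> n; apply: (@le_trans _ _ (u n)).
    rewrite lee_fin; have im : (i <= n)%N by near: n; exact: nbhs_infty_ge.
    by have := fK n im; rewrite ler_norml; lra.
  by apply: ereal_sup_ubound; exists n => /=.
have uf : limn_esup u \is a fin_num.
  by rewrite fin_numElt (lt_le_trans _ lb) ?ltNyr// (le_lt_trans ub) ?ltry.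
rewrite -(fineK Gf) lee_fin -/K /limsup_fun -/u.
move: lb ub; rewrite -(fineK uf) !lee_fin => lb ub.
by rewrite ler_norml; apply/andP; split; lra.
Unshelve. all: by end_near. Qed.

Lemma measurable_limsup_fun : measurable_fun D (limsup_fun f).
Proof.
apply: measurableT_comp => //; apply: measurable_fun_limn_esup => i.
by apply/measurable_EFinP.
Qed.

Hypothesis f_cauchy : forall i,
  (\int[mu]_(x in D) `|f i.+1 x - f i x|%:E <= (2^-1 ^+ i)%:E)%E.

(** Termwise integration of the dominating series leaves a geometric tail starting at 2^-i, whose
    sum is twice its first term. *)
Lemma limsup_fun_L1 i :
  (\int[mu]_(x in D) `|limsup_fun f x - f i x|%:E <= (2 * 2^-1 ^+ i)%:E)%E.
Proof.
have mg k : measurable_fun D (fun x => `|f (i + k).+1 x - f (i + k)%N x|%:E).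
  apply/measurable_EFinP; apply: measurableT_comp => //.
  by apply: measurable_funB.
apply: (@le_trans _ _ (\int[mu]_(x in D) G i x)%E).
  apply: ge0_le_integral => //.
  - apply/measurable_EFinP; apply: measurableT_comp => //.
    by apply: measurable_funB => //; exact: measurable_limsup_fun.
  - have -> : G i = fun x => (\sum_(k <oo | k \in xpredT) `|f (i + k).+1 x - f (i + k) x|%:E)%E.
      by [].
    by apply: ge0_emeasurable_sum => [k x _ _|k _]; [rewrite lee_fin|exact: mg].
rewrite integral_nneseries//.
apply: lime_le; first by apply: is_cvg_nneseries => n _ _; exact: integral_ge0.
near=> n.
have h k : (\int[mu]_(x in D) `|f (i + k).+1 x - f (i + k)%N x|%:E <= (2^-1 ^+ i * 2^-1 ^+ k)%:E)%E.
  by rewrite -exprD; exact: f_cauchy.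
apply: (le_trans (lee_sum _ (fun k _ => h k))).
rewrite sumEFin lee_fin -mulr_sumr mulrC ler_pM2r ?exprn_gt0// ?invr_gt0//.
suff -> : \sum_(0 <= k < n) 2^-1 ^+ k = 2 - 2 * 2^-1 ^+ n :> R.
  by rewrite lerBlDr lerDl mulr_ge0// exprn_ge0// invr_ge0.
elim: (n) => [|m ih]; first by rewrite big_nil expr0 mulr1 subrr.
by rewrite big_nat_recr//= ih exprS; field.
Unshelve. all: by end_near. Qed.

End L1_limit.

(** * Explicit mode solutions and their partial sums *)

Section mode_flow.
Variables (R : realType) (a b : 'rV[R]_3) (mu : R) (u : 'rV[R]_3) (h : mode -> R).
Hypothesis hab : forall k : 'I_3, a 0 k < b 0 k.
Hypothesis mu0 : 0 <= mu.
Local Notation om n := (advection a b u n).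
Local Notation la n := (laplace_symbol a b n).
Local Notation H := (hartley a b).

Lemma advectionN n : om (- n) = - om n.
Proof. by rewrite /advection -sumrN; apply: eq_bigr => k _; rewrite freqN mulrN. Qed.

Lemma laplace_symbolN n : la (- n) = la n.
Proof. by rewrite /laplace_symbol; apply: eq_bigr => k _; rewrite freqN sqrrN. Qed.

Lemma laplace_symbol_ge0 n : 0 <= la n.
Proof. by rewrite sumr_ge0// => k _; exact: sqr_ge0. Qed.

(** The damped rotation that solves the limit system for the pair of indices n, -n with initial
    values h(n), h(-n). *)
Definition mode_flow (n : mode) (t : R) : R :=
  expR (- (mu * la n) * t) * (cos (om n * t) * h n + sin (om n * t) * h (- n)).

Lemma mode_flow0 n : mode_flow n 0 = h n.
Proof. by rewrite /mode_flow !mulr0 expR0 cos0 sin0 !mul1r mul0r addr0. Qed.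

Let is_derive_mul (c t : R) : is_derive t 1 (fun s : R => c * s) c.
Proof.
have := is_deriveZ c (is_derive_id t 1).
by rewrite /GRing.scale/= mulr1.
Qed.

Lemma is_derive_mode_flow n (t : R) :
  is_derive t 1 (mode_flow n) (om n * mode_flow (- n) t - mu * la n * mode_flow n t).
Proof.
have dE := is_derive_chain (is_derive_mul (- (mu * la n)) t) (is_derive_expR _).
have dC := is_derive_chain (is_derive_mul (om n) t) (is_derive_cos _).
have dS := is_derive_chain (is_derive_mul (om n) t) (is_derive_sin _).
have dT := is_deriveD (is_deriveM dC (is_derive_cst (h n) t 1))
  (is_deriveM dS (is_derive_cst (h (- n)) t 1)).
apply: (is_derive_eq (is_deriveM dE dT)).
rewrite /mode_flow advectionN laplace_symbolN opprK (mulNr (om n)) cosN sinN.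
set E := expR _; set C := cos _; set S := sin _.
transitivity (E * (C * 0 + h n * (- S * om n) + (S * 0 + h (- n) * (C * om n))) +
  (C * h n + S * h (- n)) * (E * - (mu * la n)) : R); first by [].
by ring.
Qed.

Lemma continuous_mode_flow n : continuous (mode_flow n).
Proof.
move=> t; apply: differentiable_continuous; apply/derivable1_diffP.
by case: (is_derive_mode_flow n t).
Qed.

Lemma mode_flow_bound n (t : R) : 0 <= t -> mode_flow n t ^+ 2 <= 2 * (h n ^+ 2 + h (- n) ^+ 2).
Proof.
move=> t0; rewrite /mode_flow exprMn.
have e1 : expR (- (mu * la n) * t) ^+ 2 <= 1.
  rewrite expr_le1// ?expR_ge0// -expR0 ler_expR mulNr oppr_le0.
  by rewrite !mulr_ge0// laplace_symbol_ge0.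
have := cos2Dsin2 (om n * t).
move: (cos _) (sin _) => c s cs.
have h1 : (c * h n + s * h (- n)) ^+ 2 <= 2 * (h n ^+ 2 + h (- n) ^+ 2).
  have -> : (c * h n + s * h (- n)) ^+ 2 = (c ^+ 2 + s ^+ 2) * (h n ^+ 2 + h (- n) ^+ 2) -
     (c * h (- n) - s * h n) ^+ 2 by ring.
  rewrite cs mul1r mulr_natl mulr2n.
  have := sqr_ge0 (c * h (- n) - s * h n); have := sqr_ge0 (h n); have := sqr_ge0 (h (- n)).
  by rewrite -mulr2n; lra.
by apply: le_trans h1; rewrite -[leRHS]mul1r ler_wpM2r// sqr_ge0.
Qed.

Definition flow_sum (F : seq mode) (z : R * space3 R) : R :=
  \sum_(n <- F) (mode_flow n z.1 / vol a b) * H n z.2.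

Lemma flow_sum_coef F n t : uniq F ->
  coef a b n (fun x => flow_sum F (t, x)) = if n \in F then mode_flow n t else 0.
Proof.
move=> uF; have -> := @coef_trig R a b hab F (fun n => mode_flow n t / vol a b) n uF; case: ifP => _; last by rewrite mul0r.
by rewrite divfK// gt_eqF// vol_gt0.
Qed.

(** The common form of a partial sum and of its derivatives: a time derivative changes only the time
    factors [r], while each spatial derivative also composes the index map [m] with negation. *)
Let term (r : mode -> R -> R) (m : mode -> mode) F (z : R * space3 R) : R :=
  \sum_(n <- F) (r n z.1 / vol a b) * H (m n) z.2.

Let continuous_term r m F : (forall n, continuous (r n)) -> continuous (term r m F).
Proof.
move=> cr; elim: F => [|n F ih].
  rewrite (_ : term _ _ _ = fun=> 0); first exact: cst_continuous.
  by apply/funext => z; rewrite /term big_nil.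
rewrite (_ : term _ _ _ = fun z => (r n z.1 / vol a b) * H (m n) z.2 + term r m F z).
  move=> z; apply: cvgD; last exact: ih.
  apply: cvgM.
    apply: cvgM; last exact: cvg_cst.
    by apply: (@continuous_comp _ _ _ fst (r n)); [exact: cvg_fst|exact: cr].
  by apply: (@continuous_comp _ _ _ snd (H (m n))); [exact: cvg_snd|exact: continuous_hartley].
by apply/funext => z; rewrite /term big_cons.
Qed.

Let term_time r dr m F z : (forall n (t : R), is_derive t 1 (r n) (dr n t)) ->
  is_derive z ((1 : R), (0 : space3 R)) (term r m F) (term dr m F z).
Proof.
move=> h1; case: z => t x; apply/is_derive_time.
apply: (@is_derive_bigsum R _ _ (fun n t => r n t / vol a b * H (m n) x)
  (fun n t => dr n t / vol a b * H (m n) x)) => n.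
have d1 := is_deriveM (is_deriveM (h1 n t) (is_derive_cst ((vol a b)^-1) t 1))
  (is_derive_cst (H (m n) x) t 1).
apply: (is_derive_eq d1).
rewrite /GRing.scale/=; ring.
Qed.

Let term_space r m F z k :
  is_derive z ((0 : R), basis_vec R k) (term r m F)
    (term (fun n t => r n t * freq a b (m n) k) (fun n => - m n) F z).
Proof.
case: z => t x; apply/is_derive_space.
rewrite /term; elim: F => [|n F ih].
  rewrite big_nil (_ : (fun z => _) = fun=> 0); first exact: is_derive_cst.
  by apply/funext => z; rewrite big_nil.
rewrite big_cons (_ : (fun y => _) = fun y : space3 R =>
   (r n t / vol a b) * H (m n) y + \sum_(n <- F) (r n t / vol a b) * H (m n) y); last first.
  by apply/funext => z; rewrite big_cons.
apply: (is_derive_eq (is_deriveD (is_deriveZ (r n t / vol a b) (is_derive_hartley a b (m n) k x)) ih)).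
rewrite /GRing.scale/=; ring.
Qed.

Let term_periodic r m F t : cell_periodic a b (fun x => term r m F (t, x)).
Proof.
by move=> k x; rewrite /term; apply: eq_bigr => n _; rewrite (periodic_hartley hab).
Qed.

Lemma flow_sum_periodic F t : cell_periodic a b (fun x => flow_sum F (t, x)).
Proof. exact: (term_periodic mode_flow id). Qed.

Lemma continuous_flow_sum F : continuous (flow_sum F).
Proof. by apply: (@continuous_term mode_flow id) => n; exact: continuous_mode_flow. Qed.

(** The set of indices has to be stable under negation: u.grad exchanges n and -n, so only symmetric
    partial sums solve the equation exactly. *)
Lemma flow_sum_weak F phi s1 s2 : perm_eq F (map -%R F) ->
  smooth phi -> (forall t, cell_periodic a b (fun x => phi (t, x))) ->
  s1 < s2 -> (forall x, phi (s1, x) = 0) -> (forall x, phi (s2, x) = 0) ->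
  \int[@lebesgue_measure R]_(t in `[s1, s2]) \int[leb3 R]_(x in cell a b)
    (flow_sum F (t, x) * adjoint mu u phi (t, x)) = 0.
Proof.
move=> symF.
pose dr n t := om n * mode_flow (- n) t - mu * la n * mode_flow n t.
pose rx k n t := mode_flow n t * freq a b n k.
pose rxx k n t := mode_flow n t * freq a b n k * freq a b (- n) k.
have cr n : continuous (mode_flow n) by exact: continuous_mode_flow.
apply: (@classical_weak R a b mu u hab (flow_sum F) (term dr id F)
  (fun k => term (rx k) -%R F) (fun k => term (rxx k) (fun n => - - n) F)).
- exact: continuous_flow_sum.
- apply: continuous_term => n t; apply: cvgB; (apply: cvgM; first exact: cvg_cst); exact: cr.
- by move=> k; apply: continuous_term => n t; apply: cvgM; [exact: cr|exact: cvg_cst].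
- move=> k; apply: continuous_term => n t.
  by apply: cvgM; [apply: cvgM; [exact: cr|]|]; exact: cvg_cst.
- by move=> z; apply: (@term_time mode_flow dr id) => n t; exact: is_derive_mode_flow.
- by move=> k z; exact: (@term_space mode_flow id).
- by move=> k z; exact: (@term_space (rx k) -%R).
- by move=> t; exact: flow_sum_periodic.
- by move=> k t; exact: term_periodic.
- move=> z.
  (* The contribution of n to the residual of the equation. It is odd in n, so its sum over a
     symmetric set vanishes. *)
  pose g n := om n * (mode_flow (- n) z.1 / vol a b * H n z.2 + mode_flow n z.1 / vol a b * H (- n) z.2).
  have g0 : \sum_(n <- F) g n = 0.
    have : \sum_(n <- F) g n = - \sum_(n <- F) g n.
      rewrite {1}(perm_big _ symF)/= big_map -sumrN; apply: eq_bigr => n _.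
      by rewrite /g advectionN opprK; ring.
    by lra.
  apply/eqP; rewrite -subr_eq0; apply/eqP; rewrite -[RHS]g0 /term.
  rewrite (eq_bigr (fun k => \sum_(n <- F) u 0 k * (rx k n z.1 / vol a b * H (- n) z.2))); last first.
    by move=> k _; rewrite mulr_sumr.
  rewrite exchange_big/= [X in _ - mu * X]exchange_big/= mulr_sumr -sumrN -!big_split/=.
  apply: eq_bigr => n _; rewrite -/(- - n) opprK /g /dr /rx /rxx /advection /laplace_symbol !sum3 !freqN.
  by ring.
Qed.

End mode_flow.

Section L1_facts.
Variables (R : realType) (a b : 'rV[R]_3).
Hypothesis hab : forall k : 'I_3, a 0 k < b 0 k.
Local Notation C n g := (coef a b n g).
Local Notation ig g := ((leb3 R).-integrable (cell a b) (EFin \o g)).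
Let mc : measurable (cell a b : set (mspace3 R)).
Proof. exact: measurable_cell. Qed.

Lemma Rintegral_norm_ge0 (g : space3 R -> R) : 0 <= \int[leb3 R]_(x in cell a b) `|g x|.
Proof. by apply: Rintegral_ge0 => x _. Qed.

Lemma ae_eq_coef (g h : space3 R -> R) : ig g -> ig h -> (forall n, C n g = C n h) ->
  {ae leb3 R, forall x, cell a b x -> g x = h x}.
Proof.
move=> gi hi gh.
have di : ig (fun x => g x - h x) by exact: integrable_cellB.
have d0 : \int[leb3 R]_(x in cell a b) `|g x - h x| = 0.
  apply/eqP; rewrite eq_le Rintegral_norm_ge0 andbT; apply/ler_addgt0Pl => e e0.
  rewrite addr0 -[e](divfK (_ : 2 != 0 :> R))// mulrC.
  apply: (L1_le_coef hab) => //; first by rewrite divr_gt0.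
  move=> F _; rewrite big1 => [|n _]; first exact: sqr_ge0.
  by rewrite mode_coefB// gh subrr expr0n.
have d0' : (\int[leb3 R]_(x in cell a b) `|(EFin \o (fun x => (g x - h x)%R)) x| = 0)%E.
  by have := L1dist_cell gi hi; rewrite d0.
have [+ _] := ae_eq_integral_abs (leb3 R) mc (measurable_int _ di).
move=> /(_ d0'); apply: filterS => x /[apply]/= -[] /eqP.
by rewrite subr_eq0 => /eqP.
Qed.

Lemma L1dist_subset (K : set (space3 R)) (g h : space3 R -> R) : compact K -> K `<=` cell a b ->
  ig g -> ig h -> (L1dist K g h <= (\int[leb3 R]_(x in cell a b) `|g x - h x|)%:E)%E.
Proof.
move=> cK KC gi hi; rewrite -L1dist_cell//; apply: ge0_subset_integral => //.
  exact: compact_measurable3.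
apply/measurable_EFinP; apply: measurableT_comp => //.
by apply/measurable_EFinP; exact: (measurable_int _ (integrable_cellB gi hi)).
Qed.

Lemma L1_cauchy_coef (g h : space3 R -> R) n : ig g -> ig h ->
  `|C n g - C n h| <= 2 * \int[leb3 R]_(x in cell a b) `|g x - h x|.
Proof.
by move=> gi hi; rewrite -mode_coefB//; apply: coef_le_L1; exact: integrable_cellB.
Qed.

End L1_facts.

Lemma derive_zero_open (R : realType) (V : normedModType R) (U : set V) (f : V -> R) (v : V) :
  open U -> (forall z, U z -> f z = 0) -> forall z, U z -> 'D_v f z = 0.
Proof.
move=> oU f0 z Uz; rewrite (near_eq_derive (g := cst 0)) ?derive_cst//.
by apply: filterS (open_nbhs_nbhs (conj oU Uz)) => y Uy; rewrite f0.
Qed.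

Lemma adjoint_support (R : realType) (mu : R) (u : 'rV[R]_3) (phi : R * space3 R -> R) s1 s2 :
  (forall t x, ~ (s1 <= t <= s2) -> phi (t, x) = 0) ->
  forall t x, ~ (s1 <= t <= s2) -> adjoint mu u phi (t, x) = 0.
Proof.
move=> phi0 t x ts.
pose U : set (R * space3 R) := fst @^-1` (~` `[s1, s2]%classic).
have oU : open U.
  apply: open_comp; last by apply: closed_openC; exact: itv_closed.
  by move=> z _; exact: cvg_fst.
have Uz : U (t, x) by rewrite /U /=; apply: contra_not ts; rewrite in_itv.
have phiU z : U z -> phi z = 0.
  by case: z => r y /= h; apply: phi0 => rs; apply: h; rewrite /= in_itv.
have d0 v := derive_zero_open v oU phiU.
rewrite /adjoint /dt d0// !big1 ?mulr0 ?addr0// => k _.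
- by apply: (derive_zero_open _ oU) => // z; exact: d0.
- by rewrite /dx d0// mulr0.
Qed.

Lemma half_power_small (R : realType) (c e : R) : 0 < e ->
  exists N, forall i, (N <= i)%N -> c * 2^-1 ^+ i < e.
Proof.
move=> e0; have h1 : `|2^-1 : R| < 1 by rewrite ger0_norm ?invr_ge0// invf_lt1// ltr1n.
have /cvgrPdist_lt/(_ e e0)[N _ hN] := cvg_geometric c h1.
exists N => i /hN; rewrite sub0r normrN; exact: le_lt_trans (ler_norm _).
Qed.

Lemma near_forall_seq (T : Type) (J : eqType) (F : set_system T) (FF : Filter F) (s : seq J)
    (P : J -> T -> Prop) : (forall i, \forall x \near F, P i x) ->
  \forall x \near F, forall i, i \in s -> P i x.
Proof.
move=> hP; elim: s => [|i s ih]; first by apply: filterS filterT.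
apply: filterS2 (hP i) ih => x Pi Ps j; rewrite inE => /orP[/eqP ->//|]; exact: Ps.
Qed.

(** * The limit of the partial sums *)

Section construction.
Variables (R : realType) (a b : 'rV[R]_3) (mu : R) (u : 'rV[R]_3) (h : mode -> R) (B : R).
Hypothesis hab : forall k : 'I_3, a 0 k < b 0 k.
Hypothesis mu0 : 0 <= mu.
Hypothesis hB : forall F : seq mode, uniq F -> \sum_(n <- F) h n ^+ 2 <= B.
Local Notation C n g := (coef a b n g).
Local Notation ig g := ((leb3 R).-integrable (cell a b) (EFin \o g)).
Local Notation r := (mode_flow a b mu u h).
Let mc : measurable (cell a b : set (mspace3 R)).
Proof. exact: measurable_cell. Qed.

(* The factor 8 leaves room for the difference of two densities, each bounded
   mode by mode by [2 * (h n ^+ 2 + h (- n) ^+ 2)]. *)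
Definition mode_energy (n : mode) : R := 8 * (h n ^+ 2 + h (- n) ^+ 2).

Lemma mode_energy_ge0 n : 0 <= mode_energy n.
Proof. by rewrite mulr_ge0// addr_ge0// sqr_ge0. Qed.

Lemma mode_energy_sum F : uniq F -> \sum_(n <- F) mode_energy n <= 8 * (B + B).
Proof.
move=> uF; rewrite -mulr_sumr ler_pM2l// big_split/= lerD ?hB//.
have uNF : uniq (map -%R F) by rewrite map_inj_uniq//; exact: oppr_inj.
by have := hB uNF; rewrite big_map.
Qed.

Lemma mode_flow_energy n (t : R) : 0 <= t -> 4 * r n t ^+ 2 <= mode_energy n.
Proof.
move=> t0; have := mode_flow_bound a b u h mu0 n t0.
by rewrite /mode_energy; lra.
Qed.

Let small i : {Fe : seq mode * R | 0 < Fe.2 /\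
    forall g : space3 R -> R, ig g -> (forall n, C n g ^+ 2 <= mode_energy n) ->
      (forall n, n \in Fe.1 -> `|C n g| <= Fe.2) ->
      \int[leb3 R]_(x in cell a b) `|g x| <= 2^-1 ^+ i}.
Proof.
apply: cid; have d0 : 0 < 2^-1 ^+ i :> R by rewrite exprn_gt0// invr_gt0.
have [F [eta h1]] := L1_small hab mode_energy_ge0 mode_energy_sum d0.
by exists (F, eta).
Qed.

(** The modes that decide L^1 smallness at accuracy 2^-i, together with the mode encoded by the
    number i, so that every mode eventually occurs. The sets [G i] accumulate and symmetrise these
    blocks. *)
Let blk i : seq mode := (sval (small i)).1 ++ seq_of_opt (unpickle i : option mode).
Let G i : seq mode := undup (flatten [seq blk j ++ map -%R (blk j) | j <- iota 0 i.+1]).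

Let GP i n : reflect (exists2 j, (j <= i)%N & (n \in blk j) || (- n \in blk j)) (n \in G i).
Proof.
rewrite mem_undup; apply: (iffP flatten_mapP) => [[j]|[j ji nj]].
  rewrite mem_iota ltnS => /andP[_ ji]; rewrite mem_cat => nj; exists j => //.
  move: nj => /orP[->//|/mapP[m mj ->]].
  by rewrite opprK mj orbT.
exists j; first by rewrite mem_iota ltnS.
rewrite mem_cat; move: nj => /orP[->//|nj]; apply/orP; right.
by apply/mapP; exists (- n) => //; rewrite opprK.
Qed.

Let Gsub i j : (i <= j)%N -> {subset G i <= G j}.
Proof.
by move=> ij n /GP[l li nl]; apply/GP; exists l => //; exact: leq_trans li ij.
Qed.

Let Gsym i : perm_eq (G i) (map -%R (G i)).
Proof.
apply: uniq_perm; first exact: undup_uniq.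
  by rewrite map_inj_uniq ?undup_uniq//; exact: oppr_inj.
move=> n; apply/idP/mapP => [nG|[m mG ->]].
  exists (- n); last by rewrite opprK.
  by case/GP : nG => j ji nj; apply/GP; exists j => //; rewrite opprK orbC.
by case/GP : mG => j ji nj; apply/GP; exists j => //; rewrite opprK orbC.
Qed.

Let f t i x := flow_sum a b mu u h (G i) (t, x).
Let cf t i : continuous (f t i).
Proof. by apply: continuous_slice; exact: continuous_flow_sum. Qed.
Let fi t i : ig (f t i). Proof. exact: continuous_integrable_cell. Qed.
Let fC t i n : C n (f t i) = if n \in G i then r n t else 0.
Proof. by apply: flow_sum_coef => //; exact: undup_uniq. Qed.

(** Coefficients in the i-th block agree exactly in the two partial sums, and the others are
    dominated by [mode_energy]; this is what [small i] asks for. *)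
Let f_cauchy (t : R) i : 0 <= t ->
  \int[leb3 R]_(x in cell a b) `|f t i.+1 x - f t i x| <= 2^-1 ^+ i.
Proof.
move=> t0; have [e0 hs] := svalP (small i); apply: hs.
- exact: integrable_cellB.
- move=> n; rewrite mode_coefB// !fC.
  apply: le_trans (mode_flow_energy n t0); have := sqr_ge0 (r n t).
  case: ifP => _; case: ifP => _; rewrite ?subr0 ?subrr ?sub0r ?sqrrN ?expr0n/=; lra.
- move=> n nF; rewrite mode_coefB// !fC.
  have nG : n \in G i by apply/GP; exists i => //; rewrite mem_cat nF.
  by rewrite nG (Gsub (leqnSn i) nG) subrr normr0 ltW.
Qed.

Definition flow (t : R) : space3 R -> R := limsup_fun (f t).

Lemma flow_periodic t : cell_periodic a b (flow t).
Proof.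
move=> k x; rewrite /flow /limsup_fun; congr (fine (limn_esup _)).
by apply/funext => i; rewrite /f (flow_sum_periodic mu u h hab (G i) t k x).
Qed.

Let mf t i : measurable_fun (cell a b : set (mspace3 R)) (f t i).
Proof. by apply: measurable_funTS; exact: continuous_measurable3. Qed.

Let mflow t : measurable_fun (cell a b : set (mspace3 R)) (flow t).
Proof. exact: measurable_limsup_fun. Qed.

Let flow_L1 (t : R) i : 0 <= t ->
  ig (fun x => `|flow t x - f t i x|) /\
  \int[leb3 R]_(x in cell a b) `|flow t x - f t i x| <= 2 * 2^-1 ^+ i.
Proof.
move=> t0; apply: ge0_Rintegral_le => //.
- by apply: measurableT_comp => //; apply: measurable_funB.
- apply: limsup_fun_L1 => // j; rewrite -/(L1dist (cell a b) _ _) L1dist_cell// lee_fin.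
  exact: f_cauchy.
Qed.

Lemma flow_integrable (t : R) : 0 <= t -> ig (flow t).
Proof.
move=> t0; have [i0 _] := flow_L1 0 t0.
have d0 : ig (fun x => flow t x - f t 0 x).
  apply: (le_integrable mc _ _ i0).
    by apply/measurable_EFinP; exact: measurable_funB.
  by move=> x _; rewrite /= normr_id.
have := integrable_cellD d0 (fi t 0); congr (_.-integrable _ _).
by apply/funext => x /=; rewrite subrK.
Qed.

(** From index [pickle n] on, every partial sum has exactly the coefficient [r n t]. The error is at
    most 2 (from |H_n| <= 2) times the L^1 distance 2 * 2^-i, hence the 4. *)
Lemma flow_coef (t : R) n : 0 <= t -> C n (flow t) = r n t.
Proof.
move=> t0; apply/eqP; rewrite -subr_eq0 -normr_le0; apply/ler_addgt0Pl => e e0; rewrite addr0.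
have [N hN] := half_power_small 4 e0.
pose i := maxn N (pickle n).
apply: ltW; apply: le_lt_trans (hN i (leq_maxl _ _)).
have nG : n \in G i.
  apply/GP; exists (pickle n); first exact: leq_maxr.
  by rewrite mem_cat pickleK inE eqxx orbT.
have := fC t i n; rewrite nG => <-.
apply: (le_trans (L1_cauchy_coef n (flow_integrable t0) (fi t i))).
by have [_] := flow_L1 i t0; lra.
Qed.

Lemma flow_continuous (t e : R) : 0 <= t -> 0 < e ->
  \forall s \near t, 0 <= s -> \int[leb3 R]_(x in cell a b) `|flow s x - flow t x| <= e.
Proof.
move=> t0 e0.
have [F [eta [eta0 hF]]] := L1_small hab mode_energy_ge0 mode_energy_sum e0.
have : \forall s \near t, forall n, n \in F -> `|r n t - r n s| <= eta.
  apply: (@near_forall_seq R mode (nbhs t) _ F (fun n s => `|r n t - r n s| <= eta)) => n.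
  by have /cvgrPdist_le/(_ eta eta0) := @continuous_mode_flow _ a b mu u h n t.
apply: filterS => s hs s0.
have is_ := flow_integrable s0; have it := flow_integrable t0.
apply: hF; first exact: integrable_cellB.
- move=> n; rewrite mode_coefB// !flow_coef//.
  have := mode_flow_energy n s0; have := mode_flow_energy n t0.
  move: (r n s) (r n t) => x y h1 h2.
  have : (x - y) ^+ 2 = 2 * x ^+ 2 + 2 * y ^+ 2 - (x + y) ^+ 2 by ring.
  have := sqr_ge0 (x + y); lra.
- by move=> n nF; rewrite mode_coefB// !flow_coef// distrC; exact: hs.
Qed.

Lemma flow_in_C_L1loc (I : set R) : (forall t, I t -> 0 <= t) -> in_C_L1loc I (cell a b) flow.
Proof.
move=> I0; split=> [t /I0 t0 K cK KC|K cK KC t /[dup] It /I0 t0].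
  apply: integrableS (flow_integrable t0) => //; exact: compact_measurable3.
have near_le e : 0 < e ->
    \forall s \near within I (nbhs t), (L1dist K (flow s) (flow t) <= e%:E)%E.
  move=> e0; rewrite near_withinE; apply: filterS (flow_continuous t0 e0) => s hs /I0 s0.
  apply: (le_trans (L1dist_subset cK KC (flow_integrable s0) (flow_integrable t0))).
  by rewrite lee_fin; exact: hs.
have ge0 s : (0 <= L1dist K (flow s) (flow t))%E.
  by apply: integral_ge0 => x _; rewrite lee_fin.
apply/fine_cvgP; split.
  apply: filterS (near_le 1 ltr01) => s h1.
  by rewrite ge0_fin_numE// (le_lt_trans h1)// ltry.
apply/cvgrPdist_le => e e0; apply: filterS (near_le e e0) => s h1 /=.
rewrite sub0r normrN ger0_norm ?fine_ge0// -lee_fin fineK//.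
by rewrite ge0_fin_numE// (le_lt_trans h1)// ltry.
Qed.

(** The identity holds for each partial sum. On the time support of phi the spatial pairings
    converge uniformly in t, so their time integrals converge as well. *)
Lemma flow_weak (I : set R) (phi : R * space3 R -> R) : (forall t, I t -> 0 <= t) ->
  test_function I a b phi ->
  st_integral I a b (fun t x =>
            flow t x * dt phi (t, x)
          + \sum_(k < 3) u 0 k * flow t x * dx k phi (t, x)
          + mu * flow t x * \sum_(k < 3) dx k (dx k phi) (t, x)) = 0.
Proof.
move=> I0 [sphi pphi [s1 [s2 [sI phi0]]]].
pose psi := adjoint mu u phi.
have cpsi : continuous psi by exact: continuous_adjoint.
pose A (g : R -> space3 R -> R) t : R := \int[leb3 R]_(x in cell a b) (g t x * psi (t, x)).
transitivity (\int[@lebesgue_measure R]_(t in I) A flow t).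
  apply: eq_Rintegral => t _; apply: eq_Rintegral => x _; rewrite /psi /adjoint.
  rewrite (eq_bigr (fun k => flow t x * (u 0 k * dx k phi (t, x)))); last first.
    by move=> k _; ring.
  by rewrite -mulr_sumr; ring.
have A0 g t : ~ (s1 <= t <= s2) -> A g t = 0.
  move=> ts; rewrite /A /psi; under eq_Rintegral do rewrite (adjoint_support mu u phi0 _ ts) mulr0.
  by rewrite Rintegral_cst// mul0r.
pose J := `[s1, s2]%classic.
have A0J g t : ~ J t -> A g t = 0 by move=> h1; apply: A0; move: h1; rewrite /J /= in_itv.
have JI : J `<=` I by exact: subset_trans sI (@interior_subset _ _).
rewrite (Rintegral_support JI (A0J flow)).
have [s21|s12] := ltP s2 s1.
  rewrite (_ : J = set0) ?Rintegral_set0//; apply/seteqP; split => // t.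
  by rewrite /J /= in_itv/= => /andP[h1 h2]; have := lt_le_trans s21 (le_trans h1 h2); rewrite ltxx.
pose L i t := A (fun t => f t i) t.
have cL i : continuous (fun z : R * space3 R => flow_sum a b mu u h (G i) z * psi z).
  by move=> z; apply: cvgM; [exact: continuous_flow_sum|exact: cpsi].
have iL i : (@lebesgue_measure R).-integrable J (EFin \o L i).
  exact: (integrable_time_cell s1 s2 hab (@cL i)).
have L0 i : \int[@lebesgue_measure R]_(t in J) L i t = 0.
  (* Enlarging the interval makes phi vanish at both end points and excludes a degenerate interval.
     It may leave [I], since the partial sums solve the equation for all real times. *)
  have JJ : J `<=` `[s1 - 1, s2 + 1]%classic.
    by move=> t; rewrite /J /= !in_itv/= => /andP[? ?]; apply/andP; split; lra.
  rewrite -(Rintegral_support JJ (A0J (fun t => f t i))).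
  apply: flow_sum_weak => //; [lra| |].
  + by move=> x; apply: phi0 => /andP[? ?]; lra.
  + by move=> x; apply: phi0 => /andP[? ?]; lra.
have [M M0 psiM] := @continuous_bounded_time_cell R a b s1 s2 psi cpsi.
have J0 t : J t -> 0 <= t by move=> /JI /I0.
have close i t : J t -> `|A flow t - L i t| <= (M * 2) * 2^-1 ^+ i.
  move=> Jt; have t0 := J0 t Jt.
  have cpt : continuous (fun x => psi (t, x)) by exact: continuous_slice.
  have i1 : ig (fun x => flow t x * psi (t, x)).
    by apply: integrable_cell_continuous => //; exact: flow_integrable.
  have i2 : ig (fun x => f t i x * psi (t, x)) by exact: integrable_cell_continuous.
  have [i3 h3] := flow_L1 i t0.
  rewrite /A /L -RintegralB//.
  apply: (le_trans (le_normr_Rintegral mc (integrable_cellB i1 i2))).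
  apply: (@le_trans _ _ (\int[leb3 R]_(x in cell a b) (M * `|flow t x - f t i x|))).
    apply: le_Rintegral => //.
    - exact: (integrable_norm (integrable_cellB i1 i2)).
    - exact: integrable_cellZ.
    - move=> x cx; rewrite -mulrBl normrM mulrC ler_wpM2r//.
      by apply: psiM => //; move: Jt; rewrite /J /= in_itv.
  by rewrite RintegralZl// -mulrA ler_pM2l.
have mJ : measurable (J : set (measurableTypeR R)) by exact: measurable_itv.
have mA : measurable_fun (J : set (measurableTypeR R)) (A flow).
  apply: (@measurable_fun_cvg _ _ _ _ L) => [i|t Jt].
    by apply/measurable_EFinP; exact: (measurable_int _ (iL i)).
  apply/cvgrPdist_lt => e e0; have [N hN] := half_power_small (M * 2) e0.
  exists N => // i /= Ni; exact: le_lt_trans (close i t Jt) (hN i Ni).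
have Jfin : (@lebesgue_measure R J < +oo)%E.
  by rewrite lebesgue_measure_itv/=; case: ifP => // _; rewrite -EFinB ltry.
have iD i : (@lebesgue_measure R).-integrable J (EFin \o (fun t => A flow t - L i t)).
  apply: (@measurable_bounded_integrable _ _ _ _ _ _ mJ Jfin).
    apply: measurable_funB => //.
    by apply/measurable_EFinP; exact: (measurable_int _ (iL i)).
  exists (M * 2 * 2^-1 ^+ i); split; first exact: num_real.
  by move=> K hK t Jt; exact: le_trans (close i t Jt) (ltW hK).
apply/eqP; rewrite -normr_le0; apply/ler_addgt0Pl => e e0; rewrite addr0.
pose len := fine (@lebesgue_measure R J).
have [N hN] := half_power_small (M * 2 * len) e0.
have -> : \int[@lebesgue_measure R]_(t in J) A flow t =
    \int[@lebesgue_measure R]_(t in J) (A flow t - L N t).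
  rewrite -[RHS]addr0 -(L0 N) -RintegralD//.
  by apply: eq_Rintegral => t _; rewrite subrK.
apply: (le_trans (le_normr_Rintegral mJ (iD N))).
apply: (@le_trans _ _ (\int[@lebesgue_measure R]_(t in J) (M * 2 * 2^-1 ^+ N))).
  apply: le_Rintegral => //.
  - exact: (integrable_norm (iD N)).
  - apply: (@measurable_bounded_integrable _ _ _ _ _ _ mJ Jfin) => //.
    exists (M * 2 * 2^-1 ^+ N); split; first exact: num_real.
    by move=> K hK t _; rewrite /= ger0_norm ?(ltW hK)// !mulr_ge0// ltW.
  - by move=> t Jt; exact: close.
rewrite Rintegral_cst// -/len mulrAC; apply: ltW; exact: hN.
Qed.

End construction.

(** * The diffusive limit *)

Section d3q7.
Variables (R : realType) (a b : 'rV[R]_3) (lam theta eps : R) (u : 'rV[R]_3).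
Hypotheses (lam0 : 0 < lam) (theta0 : 0 < theta) (eps0 : 0 < eps).
Local Notation m j := (equilibrium lam theta u eps 1 j 0).

(** Groups the moving velocities by axis and orientation, which reduces the moments of the
    equilibrium to field identities. *)
Lemma sum_d3q7 (g0 : R) (G : 'I_3 -> R -> R) :
  \sum_(j < 7) (if j == 0 then g0 else G (dir j) (sgn_dir R j)) =
  g0 + \sum_(k < 3) (G k 1 + G k (- 1)).
Proof.
have i0 : inord 0 = 0 :> 'I_3 by apply: val_inj; rewrite /= inordK.
have i1 : inord 1 = 1 :> 'I_3 by apply: val_inj; rewrite /= inordK.
rewrite big_ord_recl eqxx; congr (_ + _).
rewrite 6!big_ord_recl big_ord0 sum3 addr0 /dir /sgn_dir /= /bump /= !i0 !i1.
by rewrite !exprD !expr0 !expr1 !(mul1r, mulr1, mulN1r, mulrN1, opprK) !addrA.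
Qed.

Lemma equilibrium1E (j : 'I_7) : m j = if j == 0 then 1 - 3 / theta
  else 1 / 2 * (1 / theta + sgn_dir R j * (eps / lam) * u 0 (dir j)).
Proof. by rewrite mxE !mulr1. Qed.

Lemma mode_speedE n (j : 'I_7) : mode_speed a b lam eps n j =
  if j == 0 then 0 else sgn_dir R j * (lam / eps) * freq a b n (dir j).
Proof.
rewrite /mode_speed /velocity; case: ifP => _.
  by rewrite big1// => k _; rewrite mxE mul0r.
rewrite (bigD1 (dir j))//= big1 ?addr0 => [|k kj].
  by rewrite !mxE !eqxx mulr1.
by rewrite !mxE (negbTE kj) andbF mulr0 mul0r.
Qed.

Lemma mode_speedN n (j : 'I_7) : mode_speed a b lam eps (- n) j = - mode_speed a b lam eps n j.
Proof. by rewrite /mode_speed -sumrN; apply: eq_bigr => k _; rewrite freqN mulrN. Qed.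

Lemma equilibrium_sum : \sum_j m j = 1.
Proof.
under eq_bigr do rewrite equilibrium1E.
rewrite (sum_d3q7 _ (fun k s => 1 / 2 * (1 / theta + s * (eps / lam) * u 0 k))) sum3.
by field; rewrite !gt_eqF.
Qed.

(** The part in 1/theta cancels between opposite velocities; in the drift part the factors eps/lam
    and lam/eps compensate. *)
Lemma equilibrium_flux n : \sum_j m j * mode_speed a b lam eps n j = advection a b u n.
Proof.
rewrite (eq_bigr (fun j : 'I_7 => if j == 0 then 0 else
   1 / 2 * (1 / theta + sgn_dir R j * (eps / lam) * u 0 (dir j)) *
   (sgn_dir R j * (lam / eps) * freq a b n (dir j)))); last first.
  by move=> j _; rewrite equilibrium1E mode_speedE; case: ifP => //; rewrite mulr0.
rewrite (sum_d3q7 _ (fun k s => 1 / 2 * (1 / theta + s * (eps / lam) * u 0 k) *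
   (s * (lam / eps) * freq a b n k))) /advection !sum3.
by field; rewrite !gt_eqF.
Qed.

(** Here the drift part cancels between opposite velocities. As every velocity lies on an axis there
    are no mixed products of frequencies, and the result is a multiple of the Laplace symbol. *)
Lemma equilibrium_stress n : eps ^+ 2 * \sum_j m j * mode_speed a b lam eps n j ^+ 2 =
  lam ^+ 2 / theta * laplace_symbol a b n.
Proof.
rewrite (eq_bigr (fun j : 'I_7 => if j == 0 then 0 else
   1 / 2 * (1 / theta + sgn_dir R j * (eps / lam) * u 0 (dir j)) *
   (sgn_dir R j * (lam / eps) * freq a b n (dir j)) ^+ 2)); last first.
  by move=> j _; rewrite equilibrium1E mode_speedE; case: ifP => //; rewrite expr0n/= mulr0.
rewrite (sum_d3q7 _ (fun k s => 1 / 2 * (1 / theta + s * (eps / lam) * u 0 k) *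
   (s * (lam / eps) * freq a b n k) ^+ 2)) /laplace_symbol !sum3.
by field; rewrite !gt_eqF.
Qed.

Lemma mode_speed_bound n (j : 'I_7) :
  `|mode_speed a b lam eps n j| <= lam * (\sum_k `|freq a b n k|) / eps.
Proof.
have S0 : 0 <= \sum_k `|freq a b n k| by rewrite sumr_ge0.
rewrite mode_speedE; case: ifP => _.
  by rewrite normr0 !mulr_ge0// ?invr_ge0 ltW.
have s1 : `|sgn_dir R j| = 1 by rewrite /sgn_dir normrX normrN1 expr1n.
rewrite normrM [X in X * _]normrM s1 mul1r (gtr0_norm (divr_gt0 lam0 eps0)) mulrAC.
rewrite ler_pM2r ?invr_gt0// ler_pM2l//.
by rewrite (bigD1 (dir j))//= lerDl sumr_ge0.
Qed.

End d3q7.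

Lemma ae_leb3S (R : realType) (P Q : space3 R -> Prop) : (forall x, P x -> Q x) ->
  {ae leb3 R, forall x, P x} -> {ae leb3 R, forall x, Q x}.
Proof.
by move=> PQ hP; apply: filterS hP => //; exact: (ae_filter_ringOfSetsType (leb3 R)).
Qed.

Section initial_data.
Variables (R : realType) (a b : 'rV[R]_3) (rho0 : space3 R -> R).
Hypothesis hab : forall k : 'I_3, a 0 k < b 0 k.
Local Notation ig g := ((leb3 R).-integrable (cell a b) (EFin \o g)).
Let mc : measurable (cell a b : set (mspace3 R)).
Proof. exact: measurable_cell. Qed.

Lemma coef_ae_eq (g h : space3 R -> R) n : ig g -> ig h ->
  {ae leb3 R, forall x, cell a b x -> g x = h x} -> coef a b n g = coef a b n h.
Proof.
move=> gi hi gh.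
have ign : ig (fun x => g x * hartley a b n x) by exact: integrable_hartley.
have ihn : ig (fun x => h x * hartley a b n x) by exact: integrable_hartley.
rewrite /coef /Rintegral; congr fine; apply: ae_eq_integral => //.
- exact: (measurable_int _ ign).
- exact: (measurable_int _ ihn).
- by apply: ae_leb3S gh => x h1 cx; rewrite /= h1.
Qed.

Lemma leb3_setT_gt0 : (0 < leb3 R setT)%E.
Proof.
apply: (@lt_le_trans _ _ (leb3 R (cell a b))).
  by rewrite leb3_cell// lte_fin vol_gt0.
by apply: le_measure; rewrite ?inE.
Qed.

Lemma Linfty_norm_ge0 : (0 <= Linfty_norm (cell a b) rho0)%E.
Proof. exact: Lnorm_ge0. Qed.

Lemma Linfty_norm_bound : (Linfty_norm (cell a b) rho0 < +oo)%E ->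
  {ae leb3 R, forall x, cell a b x -> `|rho0 x| <= fine (Linfty_norm (cell a b) rho0)}.
Proof.
move=> N1; have := @ess_sup_ge _ _ _ (leb3 R) (abse \o (EFin \o (rho0 \_ (cell a b)))).
(* The norm at exponent infinity unfolds to the essential supremum only when the whole space has
   positive measure. *)
have <- : Linfty_norm (cell a b) rho0 = ess_sup (leb3 R) (abse \o (EFin \o (rho0 \_ (cell a b)))).
  by rewrite /Linfty_norm unlock leb3_setT_gt0.
move=> h0; apply: ae_leb3S h0 => x h1 cx; rewrite -lee_fin fineK ?ge0_fin_numE ?Linfty_norm_ge0//.
by move: h1; rewrite /= patchE mem_set.
Qed.

Hypothesis hL1 : ig rho0.
Hypothesis hLinfty : (Linfty_norm (cell a b) rho0 < +oo)%E.

(** [rho0] obeys its L^infinity bound only almost everywhere. Truncation at that bound gives a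
    function bounded everywhere with the same coefficients, to which Bessel applies. *)
Lemma coef_summable : exists B, forall F : seq mode, uniq F ->
  \sum_(n <- F) coef a b n rho0 ^+ 2 <= B.
Proof.
pose N := fine (Linfty_norm (cell a b) rho0).
have N0 : 0 <= N by rewrite fine_ge0// Linfty_norm_ge0.
pose g x := Num.max (- N) (Num.min N (rho0 x)).
have gN x : `|g x| <= N.
  rewrite ler_norml /g le_max lexx/= ge_max ge_min lexx andbT.
  by rewrite (le_trans _ N0)// oppr_le0.
have mr : measurable_fun (cell a b : set (mspace3 R)) rho0.
  by apply/measurable_EFinP; exact: (measurable_int _ hL1).
have mg : measurable_fun (cell a b : set (mspace3 R)) g.
  by apply: measurable_maxr => //; apply: measurable_minr.
have gi : ig g by apply: (bounded_integrable_cell hab mg) => x _; exact: gN.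
have g2i : ig (fun x => g x ^+ 2).
  apply: (@bounded_integrable_cell _ _ _ hab _ (N ^+ 2)).
    exact: measurable_funX.
  by move=> x _; rewrite normrX lerXn2r ?nnegrE.
exists (vol a b * \int[leb3 R]_(x in cell a b) (g x ^+ 2)) => F uF.
rewrite (eq_bigr (fun n => coef a b n g ^+ 2)); first exact: bessel.
move=> n _; congr (_ ^+ 2); apply: coef_ae_eq => //.
apply: ae_leb3S (Linfty_norm_bound hLinfty) => x h1 cx; have := h1 cx.
rewrite -/N ler_norml => /andP[h2 h3].
by rewrite /g min_r// max_r.
Qed.

Lemma coef_zero_norm n : Linfty_norm (cell a b) rho0 = 0%E -> coef a b n rho0 = 0.
Proof.
move=> N0; have z : ig (fun=> 0) by apply: (continuous_integrable_cell hab); exact: cst_continuous.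
rewrite (@coef_ae_eq rho0 (fun=> 0) n hL1 z).
  rewrite /coef; under eq_Rintegral do rewrite mul0r.
  by rewrite Rintegral_cst// mul0r.
apply: ae_leb3S (Linfty_norm_bound hLinfty) => x h1 cx; have := h1 cx.
by rewrite N0/= normr_le0 => /eqP.
Qed.

End initial_data.

Lemma kinetic_limit_constant_le (R : realType) (T1 T2 w La B M : R) : T1 <= T2 ->
  kinetic_limit_constant T1 w La B M <= kinetic_limit_constant T2 w La B M.
Proof.
move=> T12; rewrite /kinetic_limit_constant lerD2r ler_pM2l// ler_wpM2r ?ler_expR//.
by rewrite addr_ge0// mulr_ge0// sqr_ge0.
Qed.

Lemma kinetic_limit_constant_ge0 (R : realType) (T w La B M : R) :
  0 <= kinetic_limit_constant T w La B M.
Proof.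
apply: addr_ge0; last by rewrite mulr_ge0// sqr_ge0.
apply: mulr_ge0 => //; apply: mulr_ge0; first exact: expR_ge0.
by rewrite addr_ge0// mulr_ge0// sqr_ge0.
Qed.

(** * Coefficients of the solutions of both equations *)

Section main.
Variables (R : realType) (a b : 'rV[R]_3).
Hypothesis hab : forall k : 'I_3, a 0 k < b 0 k.
Variable I : set R.
Hypotheses (hI : is_interval I) (hI0 : I 0) (hIpos : forall t, I t -> 0 <= t).
Variables (u : 'rV[R]_3) (mu lam theta : R).
Hypotheses (hmu : 0 < mu) (hlam : 0 < lam) (htheta : 0 < theta)
  (hmu_eq : mu = lam ^+ 2 / theta).
Variable rho0 : space3 R -> R.
Hypotheses (hL1 : (leb3 R).-integrable (cell a b) (EFin \o rho0))
  (hLinfty : (Linfty_norm (cell a b) rho0 < +oo)%E).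
Hypothesis hmono : forall eps : R, 0 < eps <= 1 -> forall (j : 'I_7) (eta1 eta2 : R),
     (`|eta1|%:E <= Linfty_norm (cell a b) rho0)%E ->
     (`|eta2|%:E <= Linfty_norm (cell a b) rho0)%E ->
     eta1 <= eta2 ->
     equilibrium lam theta u eps eta1 j 0 <= equilibrium lam theta u eps eta2 j 0.
Local Notation C n g := (coef a b n g).
Local Notation ig g := ((leb3 R).-integrable (cell a b) (EFin \o g)).
Local Notation om n := (advection a b u n).
Local Notation La n := (mu * laplace_symbol a b n).
Let h n := C n rho0.
Local Notation r := (mode_flow a b mu u h).
Local Notation m eps j := (equilibrium lam theta u eps 1 j 0).
Local Notation be eps n j := (mode_speed a b lam eps n j).
Let mu0 : 0 <= mu. Proof. exact: ltW. Qed.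

Let sub_interval T : I T -> `[0, T]%classic `<=` I.
Proof. by move=> IT s /=; rewrite in_itv/=; exact: hI. Qed.

Let interior_interval T : I T -> forall t : R, 0 < t < T -> I° t.
Proof.
move=> IT t tT; suff : `]0, T[%classic `<=` I°.
  by apply; rewrite /= in_itv.
rewrite -open_subsetE; last exact: interval_open.
by move=> s /=; rewrite in_itv/= => /andP[/ltW s0 /ltW sT]; apply: (hI hI0 IT); rewrite s0.
Qed.

Let coef_within (g : R -> space3 R -> R) n T : in_C_L1loc I (cell a b) g -> I T ->
  {within `[0, T], continuous (fun t => C n (g t))}.
Proof.
move=> gC IT; apply/subspace_continuousP => x xT.
have Ix : I x := sub_interval IT xT.
have hc := @coef_continuous R a b I g n x gC Ix.
have hw : within `[0, T] (nbhs x) `=>` within I (nbhs x).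
  move=> S; rewrite /within/= => hS; apply: filterS hS => s IS sT.
  by apply: IS; exact: (sub_interval IT).
exact: (cvg_trans (cvg_app _ hw) hc).
Qed.

Let flow_within n T : {within `[0, T], continuous (r n)}.
Proof. exact/continuous_subspaceT/continuous_mode_flow. Qed.

(** The difference to the explicit solution obeys the same linear system for n and -n. Its squared
    norm is nonincreasing, and it is 0 at time 0. *)
Lemma ade_coef (rho : R -> space3 R -> R) n t : ade_solution I a b mu u rho0 rho -> I t ->
  C n (rho t) = r n t.
Proof.
move=> sol It; have [_ rhoC init _] := sol.
have E0 k : C k (rho 0) = h k.
  by apply: coef_ae_eq => //; apply: in_L1loc_cell; case: rhoC => + _; exact.
have := hIpos It; rewrite le_eqVlt => /predU1P[<-|t0]; first by rewrite E0 mode_flow0.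
pose X s := C n (rho s) - r n s; pose Y s := C (- n) (rho s) - r (- n) s.
have dX (s : R) : 0 < s < t -> is_derive s 1 X (om n * Y s - La n * X s).
  move=> /(interior_interval It) Is.
  apply: (is_derive_eq (is_deriveB (ade_mode hab n sol Is) (is_derive_mode_flow a b mu u h n s))).
  by rewrite /X /Y; ring.
have dY (s : R) : 0 < s < t -> is_derive s 1 Y (- om n * X s - La n * Y s).
  move=> /(interior_interval It) Is.
  apply: (is_derive_eq (is_deriveB (ade_mode hab (- n) sol Is) (is_derive_mode_flow a b mu u h (- n) s))).
  by rewrite /X /Y opprK advectionN laplace_symbolN; ring.
have le : X t ^+ 2 + Y t ^+ 2 <= X 0 ^+ 2 + Y 0 ^+ 2.
  apply: (@nonincreasing_endpoints R t t0 (fun s => X s ^+ 2 + Y s ^+ 2)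
     (fun s => - 2 * (La n * (X s ^+ 2 + Y s ^+ 2)))).
  - have cX : {within `[0, t], continuous X}.
      by move=> s; apply: cvgB; [exact: coef_within|exact: flow_within].
    have cY : {within `[0, t], continuous Y}.
      by move=> s; apply: cvgB; [exact: coef_within|exact: flow_within].
    by move=> s; apply: cvgD; [apply: cvgM; exact: cX|apply: cvgM; exact: cY].
  - move=> s st; apply: (is_derive_eq (is_deriveD (is_derive_sqr (dX s st)) (is_derive_sqr (dY s st)))).
    by ring.
  - move=> s _; rewrite mulNr oppr_le0 mulr_ge0// mulr_ge0//.
      by rewrite mulr_ge0// laplace_symbol_ge0.
    by rewrite addr_ge0// sqr_ge0.
move: le; rewrite /X [in leRHS]/Y !E0 !mode_flow0 !subrr expr0n/= addr0 => le.
have h1 := sqr_ge0 (Y t).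
have : (C n (rho t) - r n t) ^+ 2 = 0.
  by apply/eqP; rewrite eq_le sqr_ge0 andbT; apply: le_trans le; rewrite lerDl.
by move=> /eqP; rewrite sqrf_eq0 subr_eq0 => /eqP.
Qed.

Section dvbe.
Variables (eps : R) (f : R -> space3 R -> 'cV[R]_7).
Hypothesis eps01 : 0 < eps <= 1.
Hypothesis sol : dvbe_solution I a b lam theta u 1 2 eps rho0 f.
Let ep0 : 0 < eps. Proof. by case/andP: eps01. Qed.
Let p n j t := C n (fun x => f t x j 0).

Let fC j : in_C_L1loc I (cell a b) (fun t x => f t x j 0).
Proof. by case: sol. Qed.

Let p0 n j : p n j 0 = m eps j * h n.
Proof.
have [_ _ init _] := sol.
have i1 : ig (fun x => f 0 x j 0) by apply: in_L1loc_cell; case: (fC j) => + _; exact.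
have i2 : ig (fun x => m eps j * rho0 x) by exact: integrable_cellZ.
rewrite /p (coef_ae_eq n i1 i2) ?mode_coefZ//.
by apply: ae_leb3S init => x h1 cx; rewrite h1// equilibrium_linear.
Qed.

Let dp n T : I T -> forall j (t : R), 0 < t < T -> is_derive t 1 (p n j)
  (be eps n j * p (- n) j t - eps ^- 2 * (p n j t - m eps j * \sum_i p n i t)).
Proof. by move=> IT j t /(interior_interval IT) It; exact: (dvbe_mode hab n j sol It). Qed.

Let dq n T : I T -> forall j (t : R), 0 < t < T -> is_derive t 1 (p (- n) j)
  (- be eps n j * p n j t - eps ^- 2 * (p (- n) j t - m eps j * \sum_i p (- n) i t)).
Proof.
move=> IT j t tT; have := dp (- n) IT j tT.
by rewrite mode_speedN opprK.
Qed.

Let cp n T : I T -> forall j, {within `[0, T], continuous (p n j)}.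
Proof. by move=> IT j; exact: coef_within (fC j) IT. Qed.

Let s0 : 0 <= eps ^- 2. Proof. by rewrite invr_ge0 exprn_ge0// ltW. Qed.
Let m1 : \sum_j m eps j = 1. Proof. exact: equilibrium_sum. Qed.

(** The equilibrium is linear in the density, so monotonicity between 0 and the positive norm of
    [rho0] forces each slope to be nonnegative. *)
Let m0 : Linfty_norm (cell a b) rho0 != 0%E -> forall j, 0 <= m eps j.
Proof.
move=> N0 j; have Nge0 := Linfty_norm_ge0 a b rho0.
pose N := fine (Linfty_norm (cell a b) rho0).
have NE : Linfty_norm (cell a b) rho0 = N%:E by rewrite /N fineK// ge0_fin_numE.
have N1 : 0 < N by rewrite lt_def -lee_fin -NE Nge0 andbT; move: N0; rewrite NE.
have := hmono eps01 j (eta1 := 0) (eta2 := N).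
rewrite NE normr0 lee_fin (ltW N1) lee_fin (ger0_norm (ltW N1)) lexx => /(_ isT isT isT).
by rewrite equilibrium_linear mulr0 equilibrium_linear pmulr_lge0.
Qed.

Let zero_case : Linfty_norm (cell a b) rho0 = 0%E -> forall n j t, I t -> p n j t = 0.
Proof.
move=> N0 n j t It; have h0 k : h k = 0 by exact: coef_zero_norm.
have z k i : p k i 0 = 0 by rewrite p0 h0 mulr0.
have := hIpos It; rewrite le_eqVlt => /predU1P[<-//|t0].
exact: (kinetic_zero t0 s0 (@cp n t It) (@cp (- n) t It) (@dp n t It) (@dq n t It) (z n) (z (- n))).
Qed.

Lemma dvbe_component_bound n j t : I t ->
  p n j t ^+ 2 + p (- n) j t ^+ 2 <= h n ^+ 2 + h (- n) ^+ 2.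
Proof.
move=> It; have [N0|N0] := eqVneq (Linfty_norm (cell a b) rho0) 0%E.
  by rewrite !zero_case// !expr0n/= addr0 addr_ge0// sqr_ge0.
apply: (kinetic_mode_bound (@cp n t It) (@cp (- n) t It) (@dp n t It) (@dq n t It) s0 (p0 n) (p0 (- n)) (m0 N0) m1).
by rewrite hIpos/=.
Qed.

Lemma dvbe_density_bound n t : I t ->
  (\sum_j p n j t) ^+ 2 <= h n ^+ 2 + h (- n) ^+ 2.
Proof.
move=> It; have [N0|N0] := eqVneq (Linfty_norm (cell a b) rho0) 0%E.
  by rewrite big1 => [|j _]; rewrite ?zero_case// expr0n/= addr_ge0// sqr_ge0.
have := kinetic_density_bound (@cp n t It) (@cp (- n) t It) (@dp n t It) (@dq n t It) s0 (p0 n) (p0 (- n)) (m0 N0) m1.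
move=> /(_ t); rewrite hIpos// lexx => /(_ isT); apply: le_trans.
by rewrite lerDl sqr_ge0.
Qed.

(** The last argument bounds single coefficients: |x| <= 1 + x^2 turns the energy bound into a bound
    on |x| without square roots. *)
Definition mode_constant n T := kinetic_limit_constant T (om n) (La n)
  (lam * \sum_k `|freq a b n k|) (1 + (h n ^+ 2 + h (- n) ^+ 2)).

Lemma dvbe_mode_limit n t T : I t -> t <= T ->
  (\sum_j p n j t - r n t) ^+ 2 <= mode_constant n T * eps ^+ 2.
Proof.
move=> It tT; have := hIpos It; rewrite le_eqVlt => /predU1P[<-|t0].
  under eq_bigr do rewrite p0.
  rewrite -mulr_suml m1 mul1r mode_flow0 subrr expr0n/=.
  by rewrite mulr_ge0 ?sqr_ge0// kinetic_limit_constant_ge0.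
(* Monotonicity of the constant in the final time makes the estimate uniform over t <= T. *)
apply: (@le_trans _ _ (mode_constant n t * eps ^+ 2)); last first.
  by rewrite ler_wpM2r ?sqr_ge0// kinetic_limit_constant_le.
have bnd k j s : 0 <= s <= t -> `|p k j s| <= 1 + (h k ^+ 2 + h (- k) ^+ 2).
  move=> st; have Is : I s by apply: (sub_interval It); rewrite /= in_itv.
  have := dvbe_component_bound k j Is; have := sqr_ge0 (p (- k) j s).
  have := sqr_ge0 (`|p k j s| - 1); rewrite sqrrB real_normK ?num_real// mulr1 expr1n.
  have := sqr_ge0 (p k j s); lra.
apply: (@kinetic_limit R (p n) (p (- n)) (mode_speed a b lam eps n)
  (fun j => m eps j) eps t t0 (@cp n t It) (@cp (- n) t It) (@dp n t It) (@dq n t It) eps01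
  (h n) (h (- n)) _ _ _ _ (p0 n) (p0 (- n)) m1 _ _ _ _ (bnd n) _ (r n) (r (- n))).
- exact: equilibrium_flux.
- by rewrite equilibrium_stress// -hmu_eq.
- by rewrite mulr_ge0// laplace_symbol_ge0.
- by move=> j; exact: mode_speed_bound.
- by move=> j s st; have := bnd (- n) j s st; rewrite opprK [h (- n) ^+ 2 + _]addrC.
- exact: flow_within.
- exact: flow_within.
- by move=> s _; exact: is_derive_mode_flow.
- move=> s _; apply: (is_derive_eq (is_derive_mode_flow a b mu u h (- n) s)).
  by rewrite opprK advectionN laplace_symbolN.
- exact: mode_flow0.
- exact: mode_flow0.
Qed.

End dvbe.

End main.

Lemma near_right_quadratic (R : realType) (c e : R) : 0 <= c -> 0 < e ->
  \forall eps \near 0^'+, c * eps ^+ 2 <= e.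
Proof.
move=> c0 e0; near=> eps.
have ep0 : 0 < eps by near: eps; exact: nbhs_right_gt.
have ep1 : eps <= 1 by near: eps; exact: nbhs_right_le.
have epc : eps <= e / (c + 1).
  by near: eps; apply: nbhs_right_le; rewrite divr_gt0// ltr_wpDl.
apply: (@le_trans _ _ ((c + 1) * eps)).
  by apply: ler_pM => //; [exact: sqr_ge0|rewrite lerDl|rewrite expr2 ler_piMr// ltW].
by rewrite mulrC -ler_pdivlMr// ltr_wpDl.
Unshelve. all: by end_near. Qed.

Unset Implicit Arguments.

Theorem theorem5 (R : realType)
  (a b : 'rV[R]_3) (hab : forall k : 'I_3, a 0 k < b 0 k)
  (I : set R) (hI : is_interval I) (hI0 : I 0)
  (hIpos : forall t, I t -> 0 <= t)
  (u : 'rV[R]_3) (mu lam theta : R)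
  (hmu : 0 < mu) (hlam : 0 < lam) (htheta : 0 < theta)
  (hmu_eq : mu = lam ^+ 2 / theta)
  (rho0 : space3 R -> R)
  (hper : cell_periodic a b rho0)
  (hL1 : (leb3 R).-integrable (cell a b) (EFin \o rho0))
  (hLinfty : (Linfty_norm (cell a b) rho0 < +oo)%E)
  (hstab1 : lam ^+ 2 / theta <= lam ^+ 2)
  (hstab2 : forall eps : R, 0 < eps <= 1 -> forall k : 'I_3,
     `|u 0 k| <= (lam ^+ 2 / theta) / Num.sqrt (eps ^+ 2 * lam ^+ 2))
  (hmono : forall eps : R, 0 < eps <= 1 -> forall (j : 'I_7) (eta1 eta2 : R),
     (`|eta1|%:E <= Linfty_norm (cell a b) rho0)%E ->
     (`|eta2|%:E <= Linfty_norm (cell a b) rho0)%E ->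
     eta1 <= eta2 ->
     equilibrium lam theta u eps eta1 j 0 <= equilibrium lam theta u eps eta2 j 0) :
  exists rho : R -> space3 R -> R,
    [/\ ade_solution I a b mu u rho0 rho,
        (forall rho' : R -> space3 R -> R, ade_solution I a b mu u rho0 rho' ->
           forall t, I t ->
             {ae leb3 R, forall x, cell a b x -> rho' t x = rho t x})
      & forall f : R -> R -> space3 R -> 'cV[R]_7,
          (forall eps : R, 0 < eps <= 1 ->
             dvbe_solution I a b lam theta u 1 2 eps rho0 (f eps)) ->
          cvg_C_L1loc I (cell a b) (fun eps t x => total_density (f eps t x)) rho].
Proof.
have mu0 := ltW hmu.
have [B hB] := coef_summable hab hL1 hLinfty.
have flowC := flow_coef u hab mu0 hB.
have flowI := flow_integrable u hab mu0 hB.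
exists (flow mu u hab hB); split.
- split.
  + by move=> t _; exact: flow_periodic.
  + exact: flow_in_C_L1loc.
  + apply: ae_eq_coef => //; first exact: flowI.
    by move=> n; rewrite flowC// mode_flow0.
  + by move=> phi; exact: flow_weak.
- move=> rho' sol t It; have t0 := hIpos t It.
  apply: ae_eq_coef => //; [|exact: flowI|].
    by apply: in_L1loc_cell; case: sol => _ [+ _] _ _; exact.
  by move=> n; rewrite flowC// (ade_coef hab hI hI0 hIpos hmu hL1 n sol It).
- move=> f sol J K cJ JI cK KC delta d0.
  have [T JT] : exists T, forall t, J t -> t <= T.
    have [M [_ hM]] := compact_bounded cJ; exists (M + 1) => t Jt.
    by apply: (le_trans (ler_norm t)); apply: hM => //; rewrite ltrDl.
  (* [F] and [eta] depend on delta only, not on eps or t; hence finitely many mode estimates, each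
     uniform in t, determine how small eps has to be. *)
  have [F [eta [eta0 hF]]] := L1_small hab (mode_energy_ge0 (coef a b ^~ rho0)) (mode_energy_sum hB) d0.
  have nearF : \forall eps \near 0^'+, forall n, n \in F ->
      mode_constant a b u mu lam rho0 n T * eps ^+ 2 <= eta ^+ 2.
    apply: (@near_forall_seq R mode (0^'+) _ F
      (fun n eps => mode_constant a b u mu lam rho0 n T * eps ^+ 2 <= eta ^+ 2)) => n.
    by apply: near_right_quadratic; [exact: kinetic_limit_constant_ge0|rewrite exprn_gt0].
  near=> eps => t Jt; have It := JI t Jt; have t0 := hIpos t It.
  have ep01 : 0 < eps <= 1.
    by apply/andP; split; near: eps; [exact: nbhs_right_gt|exact: nbhs_right_le].
  have hn n : n \in F -> mode_constant a b u mu lam rho0 n T * eps ^+ 2 <= eta ^+ 2.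
    by move: n; near: eps.
  have fs := sol eps ep01.
  have fi j : (leb3 R).-integrable (cell a b) (EFin \o (fun x => f eps t x j 0)).
    by apply: in_L1loc_cell; case: fs => _ fC _ _; case: (fC j) => + _; exact.
  have ti : (leb3 R).-integrable (cell a b) (EFin \o (fun x => total_density (f eps t x))).
    exact: integrable_cell_sum.
  apply: (le_trans (L1dist_subset cK KC ti (flowI t t0))); rewrite lee_fin.
  have coefE n : coef a b n (fun x => total_density (f eps t x) - flow mu u hab hB t x) =
      \sum_j coef a b n (fun x => f eps t x j 0) - mode_flow a b mu u (coef a b ^~ rho0) n t.
    by rewrite mode_coefB// ?flowC//; [rewrite /total_density mode_coef_sum|exact: flowI].
  apply: hF; first by apply: integrable_cellB => //; exact: flowI.
  (* With E = h(n)^2 + h(-n)^2, the squared coefficients of the two densities are at most E and 2E,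
     so that of the difference is at most 6E, below the 8E of [mode_energy]. *)
  + move=> n; rewrite coefE.
    have := dvbe_density_bound hab hI hI0 hIpos hlam htheta hL1 hLinfty hmono ep01 fs n It.
    have := mode_flow_bound a b u (coef a b ^~ rho0) mu0 n t0.
    rewrite /mode_energy; move: (\sum_j _) (mode_flow _ _ _ _ _ _ _) => x y h1 h2.
    have h3 : (x - y) ^+ 2 = 2 * x ^+ 2 + 2 * y ^+ 2 - (x + y) ^+ 2 by ring.
    have := sqr_ge0 (x + y); have := sqr_ge0 (coef a b n rho0).
    have := sqr_ge0 (coef a b (- n) rho0); lra.
  + move=> n nF; rewrite coefE -ler_sqr ?nnegrE ?(ltW eta0)// real_normK ?num_real//.
    apply: le_trans (hn n nF).
    exact: (dvbe_mode_limit hab hI hI0 hIpos hmu hlam htheta hmu_eq hL1 hLinfty hmono ep01 fs n It (JT t Jt)).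
Unshelve. all: by end_near. Qed.
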